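(* Let $\Lambda$ be a $\tau$-tilting finite algebra. Then there is a bijection between the set of $\kappa^d$-exceptional sequences in the lattice $\mathrm{tors}\,\Lambda$ of torsion classes and the set of $\tau$-exceptional sequences in $\mathrm{mod}\,\Lambda$. In particular, up to the correspondence between indecomposable $\tau$-rigid modules and completely join-irreducible torsion classes, the $\tau$-exceptional sequences of $\mathrm{mod}\,\Lambda$ are completely determined by the lattice of torsion classes.
   Context: $\Lambda$ is a finite-dimensional basic algebra over a field; $\mathrm{mod}\,\Lambda$ is the category of finitely generated left modules; subcategories are full and closed under isomorphism. A wide subcategory of $\mathrm{mod}\,\Lambda$ is one closed under kernels, cokernels and extensions. For a wide subcategory $\mathcal W$ and a subcategory (or module) $\mathcal C$ in $\mathcal W$, $\mathrm{Gen}_{\mathcal W}\,\mathcal C$ is the class of modules in $\mathcal W$ that are quotients of finite direct sums of modules in $\mathcal C$. A torsion class of $\mathcal W$ is a subcategory $\mathcal T\subseteq\mathcal W$ that is closed under extensions and satisfies $\mathcal T=\mathrm{Gen}_{\mathcal W}\mathcal T$; $\mathrm{tors}(\mathcal W)$ is the lattice of torsion classes of $\mathcal W$ ordered by inclusion, and $\mathrm{tors}\,\Lambda=\mathrm{tors}(\mathrm{mod}\,\Lambda)$. The algebra $\Lambda$ is $\tau$-tilting finite if $\mathrm{tors}\,\Lambda$ is finite; in that case $\mathrm{tors}\,\Lambda$ is a finite semidistributive lattice. $\tau$-exceptional sequences: for $\Lambda$ $\tau$-tilting finite, every wide subcategory $\mathcal W$ is equivalent to the category of finitely generated modules over a finite-dimensional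 algebra; let $\tau_{\mathcal W}$ be the resulting Auslander-Reiten translate on $\mathcal W$. A basic module $M\in\mathcal W$ is $\tau$-rigid in $\mathcal W$ if $\mathrm{Hom}_\Lambda(M,\tau_{\mathcal W}M)=0$, and then $\mathcal J_{\mathcal W}(M)=\{X\in\mathcal W\mid\mathrm{Hom}_\Lambda(M,X)=0=\mathrm{Hom}_\Lambda(X,\tau_{\mathcal W}M)\}$ is again a wide subcategory. A sequence $(M_k,\dots,M_1)$ of (isomorphism classes of) indecomposable modules is a $\tau$-exceptional sequence in $\mathcal W$ if $M_1$ is $\tau$-rigid in $\mathcal W$ and $(M_k,\dots,M_2)$ is a $\tau$-exceptional sequence in $\mathcal J_{\mathcal W}(M_1)$ (the empty sequence is $\tau$-exceptional). The correspondence: an element of a lattice is completely join-irreducible if it covers exactly one element. For each wide subcategory $\mathcal W$ (with $\Lambda$ $\tau$-tilting finite), $M\mapsto\mathrm{Gen}_{\mathcal W}M$ is a bijection from the indecomposable modules that are $\tau$-rigid in $\mathcal W$ to the completely join-irreducible elements of $\mathrm{tors}(\mathcal W)$. $\kappa^d$-exceptional sequences: a finite lattice $L$ is semidistributive if, for all $x,w\in L$ and $Y\subseteq L$ nonempty, $x\vee y=w$ for all $y\in Y$ implies $x\vee\bigwedge Y=w$, and $x\wedge y=w$ for all $y\in Y$ implies $x\wedge\bigvee Y=w$. Let $L$ be a finite semidistributive lattice. For a cover relation $u\lessdot v$ let $\mathrm{j\text{-}label}[u,v]=\min\{y\in L\mid y\vee u=v\}$, which exists and is a join-irreducible element; for $x\le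 y$ let $\mathrm{j\text{-}label}[x,y]=\{\mathrm{j\text{-}label}[u,v]\mid x\le u\lessdot v\le y\}$. Let $\mathrm{pop}_\uparrow(x)$ be the join of $x$ with all elements covering $x$. A sequence $(j_k,\dots,j_1)$ of (completely) join-irreducible elements of $L$ is, recursively, a $\kappa^d$-exceptional sequence in $L$ if $j_i\in\mathrm{j\text{-}label}[j_1,\mathrm{pop}_\uparrow(j_1)]$ for all $i>1$, and $(j_k\vee j_1,\dots,j_2\vee j_1)$ is a $\kappa^d$-exceptional sequence in the lattice $[j_1,\mathrm{pop}_\uparrow(j_1)]$ (which is again a finite semidistributive lattice, in which these elements are join-irreducible); the empty sequence is $\kappa^d$-exceptional. *)

(* Defs.v *)
From HB Require Import structures.
From mathcomp Require Import all_boot all_order all_algebra all_field.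
From mathcomp Require Import boolp classical_sets functions cardinality.

Set Implicit Arguments.
Unset Strict Implicit.
Unset Printing Implicit Defensive.
Import Order.TTheory GRing.Theory.
Local Open Scope classical_set_scope.
Local Open Scope ring_scope.

Section Interval.
Context {d : Order.disp_t} {L : latticeType d}.
Implicit Types x y u v j : L.
Local Open Scope order_scope.

Record interval x y := Interval { ival :> L; _ : x <= ival <= y }.

Section Instances.
Variables x y : L.
HB.instance Definition _ := [isSub for @ival x y].
HB.instance Definition _ := [Choice of interval x y by <:].

Fact interval_meet_closed : meet_closed [pred z | x <= z <= y].
Proof.
move=> u v; rewrite !inE => /andP[xu uy] /andP[xv vy].
by rewrite lexI xu xv (le_trans (leIl _ _) uy).
Qed.

Fact interval_join_closed : join_closed [pred z | x <= z <= y].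
Proof.
move=> u v; rewrite !inE => /andP[xu uy] /andP[xv vy].
by rewrite leUx uy vy (le_trans xu (leUl _ _)).
Qed.

HB.instance Definition _ :=
  Order.SubChoice_isSubLattice.Build d L [pred z | x <= z <= y] d
    (interval x y) interval_meet_closed interval_join_closed.
End Instances.

Definition covered_by u v : Prop := u < v /\ forall z, ~ (u < z < v).

Definition cji j : Prop := exists! i, covered_by i j.

Definition is_min (S : set L) j : Prop := S j /\ lbound S j.

Definition j_label u v : set L := is_min [set z | Order.join z u = v].

Definition j_labels x y : set L :=
  [set j | exists u v, [/\ x <= u, covered_by u v, v <= y & j_label u v j]].

(* [supremum] is the genuine join whenever that join exists; the default [x]  *)
(* is never used in a finite lattice.                                         *)
Definition pop_up x : L := supremum x (x |` [set y | covered_by x y]).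

End Interval.

(* Sequences are listed starting from their distinguished entry: the list     *)
(* [:: s_1; ...; s_k] stands for the sequence (s_k, ..., s_1).                 *)
(* The definition makes sense for every lattice, and is the notion of         *)
(* kappa^d-exceptional sequence when L is finite and semidistributive.        *)
Inductive kappa_exceptional :
    forall (d : Order.disp_t) (L : latticeType d), seq L -> Prop :=
| kappa_nil d (L : latticeType d) : @kappa_exceptional d L [::]
| kappa_cons d (L : latticeType d) (j : L) (js : seq L)
    (ks : seq (interval j (pop_up j))) :
    (forall i, i \in j :: js -> cji i) ->
    (forall i, i \in js -> j_labels j (pop_up j) i) ->
    [seq val k | k <- ks] = [seq Order.join i j | i <- js] ->
    kappa_exceptional ks ->
    kappa_exceptional (j :: js).

Section LeftModules.
Variable R : nzRingType.
Implicit Types M N : lmodType R.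

Definition isoM M N : Prop := exists f : {linear M -> N}, bijective f.

Definition zeroM M : Prop := forall x : M, x = 0.

Definition hom_zero M N : Prop := forall (f : {linear M -> N}) (x : M), f x = 0.

Definition ker M N (f : {linear M -> N}) : set M := [set x | f x = 0].

Definition is_kernel M N (f : {linear M -> N}) (X : lmodType R)
    (i : {linear X -> M}) : Prop :=
  injective i /\ range i = ker f.

Definition is_cokernel M N (f : {linear M -> N}) (X : lmodType R)
    (p : {linear N -> X}) : Prop :=
  range p = setT /\ ker p = range f.

Definition short_exact M N (E : lmodType R) (i : {linear M -> E}) (p : {linear E -> N}) : Prop :=
  [/\ injective i, range p = setT & range i = ker p].

End LeftModules.

Section Modules.
Variables (K : fieldType) (A : falgType K).

(* A small model of the category of finitely generated left A-modules: since  *)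
(* A is finite-dimensional, such a module is, up to isomorphism, a column     *)
(* space K^n on which A acts by matrices. The carrier [carrier M] is an       *)
(* lmodType over A and morphisms are A-linear maps [{linear M -> N}].         *)
(* See [fgmod_dense] below.                                                   *)
Record fgmod := FgMod {
  fgdim : nat;
  fgact : A -> 'M[K]_fgdim;
  fgact_linear : linear fgact;
  fgact1 : fgact 1 = 1%:M;
  fgactM : {morph fgact : a b / a * b >-> a *m b} }.

Definition carrier (M : fgmod) : Type := 'cV[K]_(fgdim M).

Section Carrier.
Variable M : fgmod.
HB.instance Definition _ := GRing.Zmodule.copy (carrier M) 'cV[K]_(fgdim M).

Definition fgscale (a : A) (x : carrier M) : carrier M := fgact M a *m x.

Fact fgscaleA a b x : fgscale a (fgscale b x) = fgscale (a * b) x.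
Proof. by rewrite /fgscale fgactM mulmxA. Qed.
Fact fgscale1 : left_id 1 fgscale.
Proof. by move=> x; rewrite /fgscale fgact1 mul1mx. Qed.
Fact fgscaleDr : right_distributive fgscale +%R.
Proof. by move=> a x y; rewrite /fgscale mulmxDr. Qed.
Fact fgscaleDl x : {morph fgscale^~ x : a b / a + b}.
Proof.
move=> a b; rewrite /fgscale -mulmxDl; congr (_ *m _).
by have := fgact_linear M 1 a b; rewrite !scale1r.
Qed.
HB.instance Definition _ := GRing.Zmodule_isLmodule.Build A (carrier M)
  fgscaleA fgscale1 fgscaleDr fgscaleDl.
End Carrier.

Coercion fglmod (M : fgmod) : lmodType A := carrier M.


Lemma fgmod_dense (M : lmodType A) n (g : 'I_n -> M) :
    (forall x, exists c : 'I_n -> A, x = \sum_i c i *: g i) ->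
  exists N : fgmod, isoM N M.
Proof.
move=> gP.
pose phi m (e : 'I_m -> M) (v : 'cV[K]_m) : M := \sum_i (v i 0)%:A *: e i.
have phiP m (e : 'I_m -> M) k u v :
    phi m e (k *: u + v) = k%:A *: phi m e u + phi m e v.
  rewrite /phi scaler_sumr -big_split /=; apply: eq_bigr => i _.
  by rewrite !mxE scalerDl scalerDl scalerA mulr_algl scalerA.
pose spans m := `[< exists e : 'I_m -> M, forall x, exists v, x = phi m e v >].
have exspan : exists m, spans m.
  pose b := vbasis {:A}%VS; pose T : finType := ('I_n * 'I_(\dim {:A}%VS))%type.
  pose e (t : T) := b`_(t.2) *: g t.1.
  exists #|T|; apply/asboolP; exists (fun k => e (enum_val k)) => x.
  have [c ->] := gP x; pose v (t : T) := coord b t.2 (c t.1).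
  exists (\col_k v (enum_val k)).
  transitivity (\sum_(t : T) (v t)%:A *: e t); last first.
    rewrite /phi (reindex (@enum_val T T)) /=; last first.
      by exists enum_rank => k _; rewrite (enum_valK, enum_rankK).
    by apply: eq_bigr => k _; rewrite mxE.
  rewrite -(pair_bigA _ (fun i j => (v (i, j))%:A *: e (i, j))) /=.
  apply: eq_bigr => i _; rewrite {1}(coord_vbasis (memvf (c i))) scaler_suml.
  by apply: eq_bigr => j _; rewrite /e /v /= scalerA mulr_algl.
have [m /asboolP[e eP] mmin] := ex_minnP exspan.
have phi0 v : phi m e v = 0 -> v = 0.
  move=> v0; apply/matrixP => i0 j0; rewrite (ord1 j0) mxE.
  apply/eqP; apply: contraT => vi0.
  case: m i0 {j0} e eP mmin v v0 vi0 => [[]//|m] i0 e eP mmin v v0 vi0.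
  suff /mmin : spans m by rewrite ltnn.
  apply/asboolP; exists (e \o lift i0) => x; have [w ->] := eP x.
  pose w' := (- (w i0 0 / v i0 0)) *: v + w.
  exists (\col_i w' (lift i0 i) 0).
  have -> : phi m.+1 e w = phi m.+1 e w' by rewrite phiP v0 scaler0 add0r.
  rewrite /phi (bigD1_ord i0) //= {1}/w' !mxE mulNr divfK // addNr.
  rewrite scale0r scale0r add0r; apply: eq_bigr => i _.
  by rewrite [(\col_ _ _) _ _]mxE.
have phiI : injective (phi m e).
  move=> u v uv; have := phiP m e (-1) v u; rewrite uv scaleN1r scaleNr scale1r scaleN1r.
  by rewrite addNr => /phi0/eqP; rewrite addrC subr_eq0 => /eqP.
pose psi x : 'cV[K]_m := sval (cid (eP x)).
have psiK x : phi m e (psi x) = x by rewrite /psi; case: (cid _).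
have phiK v : psi (phi m e v) = v by apply: phiI; rewrite psiK.
pose rho a : 'M[K]_m :=
  \matrix_(i, j) psi (a *: phi m e (delta_mx j 0)) i 0.
have phiD u v : phi m e (u + v) = phi m e u + phi m e v.
  by have := phiP m e 1 u v; rewrite !scale1r.
have phiZ k u : phi m e (k *: u) = k%:A *: phi m e u.
  have := phiP m e k u 0; rewrite addr0 => ->.
  have -> : phi m e 0 = 0.
    by rewrite /phi big1 // => i _; rewrite mxE !scale0r.
  by rewrite addr0.
have phi_sum (I : finType) (F : I -> 'cV[K]_m) :
    phi m e (\sum_i F i) = \sum_i phi m e (F i).
  apply: big_morph => //; rewrite /phi big1 // => i _.
  by rewrite mxE !scale0r.
have rhoP a v : phi m e (rho a *m v) = a *: phi m e v.
  have vE : v = \sum_j v j 0 *: delta_mx j 0.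
    by rewrite {1}(matrix_sum_delta v); apply: eq_bigr => j _; rewrite big_ord1.
  have -> : rho a *m v = \sum_j v j 0 *: psi (a *: phi m e (delta_mx j 0)).
    apply/matrixP => i j; rewrite (ord1 j) !mxE summxE.
    by apply: eq_bigr => k _; rewrite !mxE mulrC.
  rewrite phi_sum {2}vE phi_sum scaler_sumr; apply: eq_bigr => j _.
  by rewrite !phiZ psiK !scalerA mulr_algl mulr_algr.
have mxP (B C : 'M[K]_m) : (forall v : 'cV[K]_m, B *m v = C *m v) -> B = C.
  move=> BC; apply/matrixP => i j.
  by have := BC (delta_mx j 0) => /matrixP/(_ i 0); rewrite -!colE !mxE.
have rho_linear : linear rho.
  move=> k a b; apply: mxP => v; apply: phiI.
  rewrite mulmxDl -scalemxAl phiP !rhoP scalerDl scalerA.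
  by rewrite mulr_algl.
have rho1 : rho 1 = 1%:M.
  by apply: mxP => v; apply: phiI; rewrite rhoP mul1mx scale1r.
have rhoM : {morph rho : a b / a * b >-> a *m b}.
  by move=> a b; apply: mxP => v; apply: phiI; rewrite -mulmxA !rhoP scalerA.
pose N := FgMod rho_linear rho1 rhoM.
pose f (x : N) : M := phi m e x.
have f_linear : linear f.
  by move=> a x y; rewrite /f phiD; congr (_ + _); apply: rhoP.
pose fL := GRing.isLinear.Build A N M *:%R f f_linear.
pose fl : {linear N -> M} := HB.pack f fL.
exists N, fl; exists psi => x; [exact: phiK | exact: psiK].
Qed.

End Modules.

Section Subcategories.
Variables (K : fieldType) (A : falgType K).
Implicit Types (W C T : set (fgmod A)) (M N X Y : fgmod A).

Definition isoclass M : set (fgmod A) := [set N : fgmod A | isoM M N].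

Definition indecomposable M : Prop :=
  ~ zeroM M /\ forall X Y, isoM M (X * Y)%type -> zeroM X \/ zeroM Y.

(* Every m : M can be written in exactly one way as the sum of the images     *)
(* under the i_k of elements of the X_k.                                      *)
Definition is_direct_sum (M : lmodType A) n (X : 'I_n -> fgmod A)
    (i : forall k, {linear X k -> M}) : Prop :=
  forall m : M, exists! x : forall k, X k, m = \sum_k i k (x k).

Definition basic_module (M : lmodType A) : Prop :=
  exists n (X : 'I_n -> fgmod A) (i : forall k, {linear X k -> M}),
    [/\ is_direct_sum i, forall k, indecomposable (X k)
      & forall k l, isoM (X k) (X l) -> k = l].

Definition basic_algebra : Prop := basic_module A^o.

Definition ext_closed T : Prop :=
  forall X Y (E : fgmod A) (i : {linear X -> E}) (p : {linear E -> Y}),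
    short_exact i p -> T X -> T Y -> T E.

Definition is_wide W : Prop :=
  [/\ W !=set0,
      forall M N (f : {linear M -> N}) X (i : {linear X -> M}),
        W M -> W N -> is_kernel f i -> W X,
      forall M N (f : {linear M -> N}) X (p : {linear N -> X}),
        W M -> W N -> is_cokernel f p -> W X
    & ext_closed W].

Record wide := Wide { wideset :> set (fgmod A); wideP : is_wide wideset }.

Fact is_wide_setT : is_wide setT.
Proof.
have flat (x y : 'M[K]_0) : x = y by rewrite [x]thinmx0 [y]thinmx0.
split=> //; exists (@FgMod _ A 0 (fun=> 0) (fun _ _ _ => flat _ _)
  (flat _ _) (fun _ _ => flat _ _)).
by [].
Qed.

Definition modcat : wide := Wide is_wide_setT.

Definition Gen W C : set (fgmod A) :=
  [set X : fgmod A | W X /\ exists n (Y : 'I_n -> fgmod A) (f : forall k, {linear Y k -> X}),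
     (forall k, C (Y k)) /\
     (forall x : X, exists y : forall k, Y k, x = \sum_k f k (y k))].

Definition is_torsion_class W T : Prop :=
  [/\ T `<=` W, ext_closed T & T = Gen W T].

Lemma Gen_subset W C C' : C `<=` C' -> Gen W C `<=` Gen W C'.
Proof.
move=> CC' X [WX [n [Y [f [CY fP]]]]]; split=> //; exists n, Y, f.
by split=> // k; exact: CC'.
Qed.

Lemma subset_Gen W C : C `<=` W -> C `<=` Gen W C.
Proof.
move=> CW X CX; split; first exact: CW.
exists 1%N, (fun=> X), (fun=> idfun); split=> // x; exists (fun=> x).
by rewrite big_ord1.
Qed.

Lemma torsion_class_top (W : wide) : is_torsion_class W W.
Proof.
have [_ _ _ Wext] := wideP W.
by split=> //; apply/seteqP; split=> [|X []//]; exact: subset_Gen.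
Qed.

Lemma torsion_class_bigcap W (F : set (set (fgmod A))) :
    F !=set0 -> F `<=` is_torsion_class W ->
  is_torsion_class W (\bigcap_(T in F) T).
Proof.
move=> [T0 FT0] FW.
have capW : \bigcap_(T in F) T `<=` W.
  by move=> X /(_ _ FT0); have [+ _ _] := FW _ FT0; apply.
split=> //.
  move=> X Y E i p ip XF YF T FT; have [_ Text _] := FW _ FT.
  by apply: Text ip (XF _ FT) (YF _ FT).
apply/seteqP; split; first exact: subset_Gen.
move=> X XG T FT; have [_ _ ->] := FW _ FT.
by apply: Gen_subset XG => Z; exact.
Qed.

End Subcategories.

Arguments modcat {K} A.

Section Tors.
Variables (K : fieldType) (A : falgType K) (W : wide A).

Record tors := Tors {
  torsset :> set (fgmod A); _ : `[< is_torsion_class W torsset >] }.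
HB.instance Definition _ := [isSub for torsset].
HB.instance Definition _ := [Choice of tors by <:].
HB.instance Definition _ :=
  [SubChoice_isSubPOrder of tors by <: with set_display].

Lemma torsP (T : tors) : is_torsion_class W T.
Proof. by apply/asboolP; case: T. Qed.

Lemma le_torsE (T U : tors) : (T <= U)%O = `[< T `<=` U >].
Proof. by rewrite leEsub; apply/subsetPset/asboolP. Qed.

Fact tors_meet_subproof (T U : tors) :
  `[< is_torsion_class W (\bigcap_(S in [set torsset T; torsset U]) S) >].
Proof.
apply/asboolP/torsion_class_bigcap; first by exists T; left.
by move=> _ [] ->; exact: torsP.
Qed.

Fact tors_join_subproof (T U : tors) :
  `[< is_torsion_class W
       (\bigcap_(S in [set S | [/\ is_torsion_class W S, T `<=` S & U `<=` S]]) S) >].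
Proof.
apply/asboolP/torsion_class_bigcap; last by move=> S [].
have [TW _ _] := torsP T; have [UW _ _] := torsP U.
by exists W; split=> //; exact: torsion_class_top.
Qed.

Definition tors_meet T U : tors := Tors (tors_meet_subproof T U).
Definition tors_join T U : tors := Tors (tors_join_subproof T U).

Fact tors_meetP (S T U : tors) :
  (S <= tors_meet T U)%O = (S <= T)%O && (S <= U)%O.
Proof.
rewrite !le_torsE; apply/asboolP/andP => /=.
  move=> h; split; apply/asboolP => X /h; apply; [by left|by right].
by move=> [/asboolP ST /asboolP SU] X SX _ [] ->; [exact: ST|exact: SU].
Qed.

Fact tors_joinP (S T U : tors) :
  (tors_join S T <= U)%O = (S <= U)%O && (T <= U)%O.
Proof.
rewrite !le_torsE; apply/asboolP/andP => /=.
  by move=> h; split; apply/asboolP => X SX; apply: h => Z [_ SZ TZ]; auto.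
move=> [/asboolP SU /asboolP TU] X; apply; split=> //; exact: torsP.
Qed.

HB.instance Definition _ :=
  Order.POrder_MeetJoin_isLattice.Build set_display tors tors_meetP tors_joinP.

End Tors.

Definition tau_tilting_finite (K : fieldType) (A : falgType K) : Prop :=
  finite_set [set: tors (modcat A)].

Section AuslanderReiten.
Variables (K : fieldType) (A : falgType K).
Implicit Types (M N P X : fgmod A).

Definition projective P : Prop :=
  forall M N (p : {linear M -> N}) (h : {linear P -> N}), range p = setT ->
    exists l : {linear P -> M}, p \o l =1 h.

(* For P projective, this says that P, with f, is a projective cover of the   *)
(* image of f: the corestriction of f to its image is an essential            *)
(* epimorphism.                                                               *)
Definition essential P M (f : {linear P -> M}) : Prop :=
  forall X (h : {linear X -> P}), range (f \o h) = range f -> range h = setT.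

(* P1 -f-> P0 -g-> M -> 0                                                     *)
Definition minimal_projective_presentation P1 P0 M
    (f : {linear P1 -> P0}) (g : {linear P0 -> M}) : Prop :=
  [/\ projective P1, projective P0, range g = setT, range f = ker g
    & essential f /\ essential g].

(* Elements of D Hom_A(P, A), where D = Hom_K(-, K).                          *)
Definition dual_functional P (phi : {linear P -> A^o} -> K) : Prop :=
  forall (k : K) (h h1 h2 : {linear P -> A^o}),
    (forall x, h x = k%:A *: h1 x + h2 x) -> phi h = k * phi h1 + phi h2.

(* N is isomorphic to D Tr M. Here Tr M is the cokernel of the map            *)
(* Hom_A(P0, A) -> Hom_A(P1, A), q |-> q \o f, of right A-modules, with       *)
(* (h a)(x) = h(x) a, so that D Tr M is the left A-module of the functionals  *)
(* phi on Hom_A(P1, A) that vanish on all q \o f, with (a phi)(h) = phi(h a). *)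
(* The map iota is an isomorphism from N onto that module.                    *)
Definition is_AR_translate M N : Prop :=
  exists P1 P0 (f : {linear P1 -> P0}) (g : {linear P0 -> M})
         (iota : N -> {linear P1 -> A^o} -> K),
    minimal_projective_presentation f g /\
    [/\ injective iota,
        forall x y h, iota (x + y) h = iota x h + iota y h,
        forall (a : A) x (h ha : {linear P1 -> A^o}),
          (forall y, ha y = (h y : A) * a) -> iota (a *: x) h = iota x ha
      & range iota =
        [set phi | dual_functional phi /\
           forall (q : {linear P0 -> A^o}) (h : {linear P1 -> A^o}),
             h =1 q \o f -> phi h = 0]].

End AuslanderReiten.

Section TauExceptional.
Variables (K : fieldType) (A : falgType K).
Implicit Types (W : set (fgmod A)) (M N X : fgmod A).

(* A K-linear equivalence from the full subcategory W of mod A to mod B; the  *)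
(* values of eqv_obj and eqv_hom outside of W are irrelevant.                 *)
Record equivalence (B : falgType K) W := Equivalence {
  eqv_obj : fgmod A -> fgmod B;
  eqv_hom : forall M N, {linear M -> N} -> {linear eqv_obj M -> eqv_obj N};
  eqv_linear : forall M N, W M -> W N ->
    forall (k : K) (h f g : {linear M -> N}),
      (forall x, h x = k%:A *: f x + g x) ->
      forall y, eqv_hom h y = k%:A *: eqv_hom f y + eqv_hom g y;
  eqv_id : forall M, W M -> forall f : {linear M -> M},
    f =1 id -> eqv_hom f =1 id;
  eqv_comp : forall (L M N : fgmod A), W L -> W M -> W N ->
    forall (f : {linear L -> M}) (g : {linear M -> N}) (h : {linear L -> N}),
      h =1 g \o f -> eqv_hom h =1 eqv_hom g \o eqv_hom f;
  eqv_full_faithful : forall M N, W M -> W N -> bijective (@eqv_hom M N);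
  eqv_dense : forall Y : fgmod B, exists2 M, W M & isoM (eqv_obj M) Y }.

(* N is isomorphic to tau_W M. *)
Definition is_tau W M N : Prop :=
  [/\ W M, W N & exists (B : falgType K) (F : equivalence B W),
     is_AR_translate (eqv_obj F M) (eqv_obj F N)].

Definition tau_rigid W M : Prop :=
  exists2 N, is_tau W M N & hom_zero M N.

Definition tau_perp W M : set (fgmod A) :=
  [set X : fgmod A | [/\ W X, hom_zero M X & exists2 N, is_tau W M N & hom_zero X N]].

Inductive tau_exceptional : set (fgmod A) -> seq (fgmod A) -> Prop :=
| tau_nil W : tau_exceptional W [::]
| tau_cons W M Ms :
    indecomposable M -> tau_rigid W M ->
    tau_exceptional (tau_perp W M) Ms -> tau_exceptional W (M :: Ms).

(* The entrywise correspondence between the two kinds of sequences: M_1       *)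
(* corresponds to Gen_W M_1 in tors(W) and, recursively, (M_k, ..., M_2)      *)
(* corresponds in V = J_W(M_1) to ((j_k v j_1) /\ V, ..., (j_2 v j_1) /\ V).  *)
(* The map T |-> T /\ V is the identification of the interval                 *)
(* [j_1, pop_up j_1] of tors(W) with tors(V).                                 *)
Inductive Gen_correspond :
    forall W : wide A, seq (fgmod A) -> seq (tors W) -> Prop :=
| Gen_correspond_nil (W : wide A) : @Gen_correspond W [::] [::]
| Gen_correspond_cons (W V : wide A) M Ms (j : tors W) (js : seq (tors W))
    (ks : seq (tors V)) :
    torsset j = Gen W [set M] ->
    wideset V = tau_perp W M ->
    [seq torsset k | k <- ks] =
      [seq torsset (Order.join i j) `&` V | i <- js] ->
    Gen_correspond Ms ks ->
    @Gen_correspond W (M :: Ms) (j :: js).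

Definition tau_exceptional_sequences : set (seq (set (fgmod A))) :=
  [set [seq isoclass M | M <- Ms] | Ms in tau_exceptional (modcat A)].

Definition kappa_exceptional_sequences : set (seq (tors (modcat A))) :=
  [set js | kappa_exceptional js].

End TauExceptional.

Arguments tau_exceptional_sequences {K} A.
Arguments kappa_exceptional_sequences {K} A.

(* Main.v *)
Require Import Defs.
From HB Require Import structures.
From mathcomp Require Import all_boot all_order all_algebra all_field.
From mathcomp Require Import boolp classical_sets functions cardinality.
(* [interval] also names a notion of MathComp. *)
Import Defs.

(* Hom(X, tau_W M) = 0 holds if and only if Ext^1(M, X') = 0 for all          *)
(* quotients X' of X in W ([csplit]).  This criterion only mentions cokernels *)
(* and sections, so it passes through the equivalence of W with a module      *)
(* category, and tau disappears from the problem.                             *)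
(* Let u < v be a cover of tors(W), and S a smallest module in v but not in u *)
(* (a brick).  Every nonzero map from an object of v to S is onto, with       *)
(* kernel in v.  Hence the Ext-projectives of v that do not lie in u split    *)
(* off an indecomposable Q which covers S, and those in u generate u; since   *)
(* tors(W) is finite, one of them is enough.  Descending from the top of      *)
(* tors(W), every torsion class is generated by one Ext-projective.  The same *)
(* modules Q give the bijection between indecomposable tau-rigid modules and  *)
(* join-irreducible torsion classes.                                          *)
(* For M indecomposable and rigid in W, put V = {X | csplit M X}.  Then       *)
(* J_W(M) is the intersection of V with the right perpendicular of M; it is   *)
(* wide, it has a progenerator, the interval [Gen M, V] of tors(W) is         *)
(* isomorphic to tors(J_W(M)), and V = pop_up(Gen M).  In a finite lattice    *)
(* whose covers have j-labels, i |-> i v j maps the labels of an interval     *)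
(* [j, y] bijectively onto its join-irreducible elements, and the theorem     *)
(* follows by induction on the length of the sequences.                       *)

Set Implicit Arguments.
Unset Strict Implicit.
Unset Printing Implicit Defensive.
Import Order.TTheory GRing.Theory.
Local Open Scope classical_set_scope.
Local Open Scope ring_scope.

(** * Modules, submodules and homomorphisms *)

(** Both kinds of sequences obey the same recursion. A tau-exceptional sequence starts with an
    indecomposable tau-rigid M and continues in J_W(M); a kappa^d-exceptional one starts with a
    join-irreducible j and continues in the interval [j, pop_up j]. The two recursions agree at
    every step, for W with a progenerator and finitely many torsion classes ([good]), for three
    reasons.

    The starting entries match: M |-> Gen M is a bijection onto the join-irreducible torsion classes
    ([rigid_cji], [cji_rigid], [rigid_iso]). Let S label a cover u < v. Every map from an
    Ext-projective of v to S lifts along every nonzero map from an object of v to S ([cover_lift]),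
    and the Fitting lemma makes the resulting endomorphisms of an indecomposable M over S
    automorphisms ([indec_endo]). Such an M exists when v is finitely generated
    ([cover_projective]); this property descends along covers from the top of the finite lattice
    ([fin_gen_cover], [fin_gen_all]).

    The lattices match: with V = {X | Hom(X, tau_W M) = 0}, intersection with J_W(M) identifies
    [Gen M, V] with tors(J_W(M)), with inverse [star], and V = pop_up (Gen M) ([pop_up_Gen], from
    [cover_le_perp] and [perp_le_join]). Since J_W(M) is again wide and [good] ([jasso_wide],
    [progenerator_jasso], [finite_tors_jasso]), [good_step] can be iterated.

    The remaining entries match: in [j, y] the map i |-> i v j is a bijection from the j-labels to
    the join-irreducible elements ([ijoin_inj], [cji_ijoin]); covers of tors(W) have j-labels by
    [j_label_exists].

    The translate is eliminated by [tau_csplit]: Hom(X, tau_W M) = 0 becomes the splitting condition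
    [csplit], which is stated inside W. That tau_W exists at all follows from Morita theory for a
    progenerator ([progenerator_equivalence]) and a construction of D Tr ([AR_exists]).

    Induction on the length gives existence in both directions ([tau_kappa], [kappa_tau]) and
    uniqueness ([Gen_correspond_unique], [Gen_correspond_inj]). For the second half of the theorem,
    kappa^d-exceptional sequences are carried along an isomorphism of lattices
    ([kappa_exceptional_iso]) and translated back. *)

Definition surjective (T U : Type) (f : T -> U) := forall y, exists x, f x = y.

Lemma surjectiveE (T U : Type) (f : T -> U) : surjective f <-> range f = setT.
Proof.
split=> [fS|fS y]; first by apply/seteqP; split=> [//|y _]; have [x <-] := fS y; exists x.
have [x _ <-] : range f y by rewrite fS.
by exists x.
Qed.

Section LinearMaps.
Variable R : nzRingType.
Implicit Types U V X Y : lmodType R.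

Definition mklin U V (f : U -> V) (h : linear f) : {linear U -> V} :=
  HB.pack f (GRing.isLinear.Build R U V *:%R f h).

(** Proof irrelevance for the structure fields. Equality of bundled maps is needed because [eqv_hom]
    and the functionals in [is_AR_translate] take bundled maps as arguments. *)
Lemma lin_ext U V (f g : {linear U -> V}) : f =1 g -> f = g.
Proof.
case: f => f [[cf] [lf]]; case: g => g [[cg] [lg]] /= /funext efg.
move: cf lf cg lg; rewrite efg => cf lf cg lg.
by rewrite (Prop_irrelevance cf cg) (Prop_irrelevance lf lg).
Qed.

Lemma lin_inj U V (f : {linear U -> V}) :
  (forall x, f x = 0 -> x = 0) <-> injective f.
Proof.
split=> [f0 x y exy|fI x]; last by rewrite -(linear0 f); exact: fI.
by apply/eqP; rewrite -subr_eq0; apply/eqP/f0; rewrite linearB exy subrr.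
Qed.

Lemma factor_inj U V X (i : {linear X -> V}) (f : {linear U -> V}) :
  injective i -> (forall u, exists x, i x = f u) ->
  exists g : {linear U -> X}, forall u, i (g u) = f u.
Proof.
move=> iI /choice[g gP]; have gl : linear g.
  by move=> a x y; apply: iI; rewrite linearP !gP linearP.
by exists (mklin gl).
Qed.

Lemma factor_surj U V X (p : {linear U -> X}) (f : {linear U -> V}) :
  surjective p -> (forall u, p u = 0 -> f u = 0) ->
  exists g : {linear X -> V}, forall u, g (p u) = f u.
Proof.
move=> pS pf; have [s sP] := choice pS.
have fs u : f (s (p u)) = f u.
  by apply/eqP; rewrite -subr_eq0 -linearB; apply/eqP/pf; rewrite linearB sP subrr.
have gl : linear (fun x => f (s x)).
  move=> a x y /=; rewrite -linearP -(fs (a *: s x + s y)) linearP.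
  by rewrite !sP.
by exists (mklin gl).
Qed.

Lemma inv_lin U V (f : {linear U -> V}) : injective f -> surjective f ->
  exists2 g : {linear V -> U}, (forall x, g (f x) = x) & (forall y, f (g y) = y).
Proof.
move=> fI fS; have [|g gP] := @factor_inj V V U f idfun fI; first by move=> u; exact: fS.
by exists g => // x; apply: fI; rewrite gP.
Qed.

Lemma isoMP U V : isoM U V <-> exists2 f : {linear U -> V}, injective f & surjective f.
Proof.
split=> [[f [g fK gK]]|[f fI fS]].
  by exists f => [x y /(congr1 g)|y]; [rewrite !fK|exists (g y)].
by have [g fK gK] := inv_lin fI fS; exists f; exists g.
Qed.

Lemma isoM_refl U : isoM U U.
Proof. by exists idfun; exists id. Qed.

Lemma isoM_sym U V : isoM U V -> isoM V U.
Proof.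
move=> /isoMP[f fI fS]; have [g fK gK] := inv_lin fI fS.
by exists g; exists f.
Qed.

Lemma isoM_trans U V X : isoM U V -> isoM V X -> isoM U X.
Proof.
by move=> [f fB] [g gB]; exists (g \o f); apply: bij_comp.
Qed.

End LinearMaps.

(** Take a matrix of maximal rank among those whose row space consists of transposes of elements of
    [S]: one more vector of [S] as a row would raise the rank. *)
Lemma subspace_mx (K : fieldType) n (S : set 'cV[K]_n) :
    S 0 -> (forall k x y, S x -> S y -> S (k *: x + y)) ->
  exists U : 'M[K]_n, forall x, S x <-> (x^T <= U)%MS.
Proof.
move=> S0 SP.
pose ok r := `[< exists2 U : 'M[K]_n, (forall v : 'rV_n, (v <= U)%MS -> S v^T) & \rank U = r >].
have ok0 : exists r, ok r.
  exists 0%N; apply/asboolP; exists 0; last exact: mxrank0.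
  by move=> v /submx0null ->; rewrite trmx0.
have okb r : ok r -> (r <= n)%N by move=> /asboolP[U _ <-]; exact: rank_leq_row.
have [r /asboolP[U US Ur] rmax] := ex_maxnP ok0 okb.
exists U => x; split=> [Sx|/US]; last by rewrite trmxK.
apply: contraT => xU; suff: ok (\rank (U + x^T)%MS).
  move=> /rmax; rewrite -Ur leqNgt => /negP[].
  rewrite (ltn_leqif (mxrank_leqif_sup (addsmxSl U x^T))).
  by apply: contra xU => /(submx_trans (addsmxSr U x^T)).
apply/asboolP; exists (U + x^T)%MS => // v /sub_addsmxP[[u1 u2] /= ->].
have [k ->] : exists k : K, u2 = k%:M by exists (u2 0 0); exact: mx11_scalar.
rewrite mul_scalar_mx linearD /= linearZ /= trmxK addrC; apply: SP => //.
by apply: US; exact: submxMl.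
Qed.

Lemma subspace_inc (K : fieldType) n (S : set 'cV[K]_n) :
    S 0 -> (forall k x y, S x -> S y -> S (k *: x + y)) ->
  exists r (I : 'M[K]_(n, r)) (L : 'M[K]_(r, n)),
    [/\ L *m I = 1%:M, forall x, S (I *m x) & forall x, S x -> I *m (L *m x) = x].
Proof.
move=> S0 SP; have [U UP] := subspace_mx S0 SP.
exists (\rank U), (row_base U)^T, (pinvmx (row_base U))^T; split.
- by rewrite -trmx_mul mulmxVp ?trmx1 // row_base_free.
- by move=> x; apply/UP; rewrite trmx_mul trmxK -(eq_row_base U) submxMl.
- move=> x /UP; rewrite -(eq_row_base U) => xU.
  by apply: trmx_inj; rewrite !trmx_mul !trmxK mulmxKpV.
Qed.

Lemma subspace_quo (K : fieldType) n (S : set 'cV[K]_n) :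
    S 0 -> (forall k x y, S x -> S y -> S (k *: x + y)) ->
  exists r (P : 'M[K]_(r, n)) (R : 'M[K]_(n, r)),
    P *m R = 1%:M /\ forall x, S x <-> P *m x = 0.
Proof.
move=> S0 SP; have [U UP] := subspace_mx S0 SP.
pose C := cokermx U.
exists (\rank C), (col_base C)^T, (pinvmx (col_base C)^T); split.
  rewrite mulmxVp //; have := col_base_full C.
  by rewrite /row_full /row_free mxrank_tr.
move=> x; rewrite UP.
have xC : x^T *m C = x^T *m col_base C *m row_base C by rewrite -mulmxA mulmx_base.
split=> [|Px].
  rewrite submxE -/C xC => /eqP h; apply: trmx_inj; rewrite trmx_mul trmxK trmx0.
  by apply: (row_free_inj (row_base_free C)); rewrite mul0mx.
rewrite submxE -/C xC; apply/eqP.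
have -> : x^T *m col_base C = 0 by apply: trmx_inj; rewrite trmx_mul trmxK trmx0.
by rewrite mul0mx.
Qed.

Section FinGenModules.
Variables (K : fieldType) (A : falgType K).
Implicit Types M N X Y Z : fgmod A.

Lemma fgact_alg M (k : K) : fgact M k%:A = k%:M.
Proof.
have := fgact_linear M k 1 0; rewrite addr0 => ->.
have -> : fgact M 0 = 0.
  by have := fgact_linear M (-1) 0 0; rewrite scaler0 addr0 scaleN1r addNr.
by rewrite addr0 fgact1 scalemx1.
Qed.

Lemma kscaleE M (k : K) (x : M) : k%:A *: x = (k *: (x : 'cV[K]_(fgdim M))) :> M.
Proof. by rewrite -mul_scalar_mx -fgact_alg. Qed.

Lemma kscale_comm (U : lmodType A) (k : K) (a : A) (x : U) :
  k%:A *: (a *: x) = a *: (k%:A *: x).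
Proof. by rewrite !scalerA mulr_algl mulr_algr. Qed.

Lemma colsum (m : nat) (x : 'cV[K]_m) : x = \sum_i x i 0 *: delta_mx i 0.
Proof.
by rewrite {1}[x]matrix_sum_delta; apply: eq_bigr => i _; rewrite big_ord1.
Qed.

Lemma fg_gen M (x : M) :
  x = \sum_i ((x : 'cV[K]_(fgdim M)) i 0)%:A *: (delta_mx i 0 : M).
Proof.
by rewrite {1}[x](colsum (x : 'cV_(fgdim M))); apply: eq_bigr => i _; rewrite kscaleE.
Qed.

Definition hmx M N (f : {linear M -> N}) : 'M[K]_(fgdim N, fgdim M) :=
  \matrix_(i, j) (f (delta_mx j 0 : M) : 'cV[K]_(fgdim N)) i 0.

Lemma hmxP M N (f : {linear M -> N}) (x : M) :
  f x = hmx f *m (x : 'cV[K]_(fgdim M)).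
Proof.
rewrite [x in LHS]fg_gen linear_sum [x in RHS](colsum (x : 'cV_(fgdim M))).
rewrite mulmx_sumr; apply: eq_bigr => i _.
rewrite linearZ /= kscaleE -scalemxAr; apply: (congr1 (fun v : 'cV[K]_(fgdim N) => x i 0 *: v)).
by apply/matrixP => j k; rewrite (ord1 k) -colE !mxE.
Qed.

Lemma mxlin M N (F : 'M[K]_(fgdim N, fgdim M)) :
    (forall a, F *m fgact M a = fgact N a *m F) ->
  exists f : {linear M -> N}, forall x : M, f x = F *m (x : 'cV[K]_(fgdim M)).
Proof.
move=> FP; have fl : linear (fun x : M => F *m (x : 'cV[K]_(fgdim M)) : N).
  move=> a x y.
  suff: F *m (fgact M a *m (x : 'cV[K]_(fgdim M)) + (y : 'cV[K]_(fgdim M))) =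
    fgact N a *m (F *m (x : 'cV[K]_(fgdim M))) + F *m (y : 'cV[K]_(fgdim M)) by [].
  by rewrite mulmxDr !mulmxA FP.
by exists (mklin fl).
Qed.

Definition submod M (S : set M) := S 0 /\ forall a x y, S x -> S y -> S (a *: x + y).

Lemma submod_sub M (S : set M) : submod S ->
  exists X (i : {linear X -> M}), injective i /\ forall y, S y <-> exists x, i x = y.
Proof.
move=> [S0 SP].
have [|k x y Sx Sy|r [I [L [LI SI IL]]]] := @subspace_inc K (fgdim M) S.
- exact: S0.
- by rewrite -kscaleE; exact: SP.
have Sa a x : S x -> S (fgact M a *m x).
  by move=> Sx; have := SP a x 0 Sx S0; rewrite addr0.
pose act a := L *m fgact M a *m I.
have Iact a : I *m act a = fgact M a *m I.
  apply/row_matrixP; move=> i; apply/rowP => j.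
  have := IL _ (Sa a _ (SI (delta_mx j 0))).
  rewrite /act !mulmxA => /(congr1 (fun v : 'cV_ _ => v i 0)).
  by rewrite -!colE !mxE.
have act_lin : linear act.
  by move=> k a b; rewrite /act fgact_linear mulmxDr mulmxDl -scalemxAr -scalemxAl.
have act1 : act 1 = 1%:M by rewrite /act fgact1 mulmx1.
have actM : {morph act : a b / a * b >-> a *m b}.
  move=> a b; rewrite {2}/act -mulmxA -[LHS]mul1mx -LI -!mulmxA; congr (L *m _).
  by rewrite Iact (mulmxA (fgact M a)) -(mulmxA _ I) Iact mulmxA -fgactM.
pose X := FgMod act_lin act1 actM.
have [i iE] := @mxlin X M I Iact.
exists X, i; split.
  by move=> x y; rewrite !iE => /(congr1 (mulmx L)); rewrite !mulmxA LI !mul1mx.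
move=> y; split=> [Sy|[x <-]]; last by rewrite iE.
by exists (L *m y); rewrite iE IL.
Qed.

Lemma submod_quo M (S : set M) : submod S ->
  exists Y (p : {linear M -> Y}), surjective p /\ forall x, S x <-> p x = 0.
Proof.
move=> [S0 SP].
have [|k x y Sx Sy|r [P [R [PR PS]]]] := @subspace_quo K (fgdim M) S.
- exact: S0.
- by rewrite -kscaleE; exact: SP.
have Sa a x : S x -> S (fgact M a *m x).
  by move=> Sx; have := SP a x 0 Sx S0; rewrite addr0.
pose act a := P *m fgact M a *m R.
have Pact a : P *m fgact M a = act a *m P.
  apply/row_matrixP; move=> i; apply/rowP => j.
  pose v : 'cV[K]_(fgdim M) := delta_mx j 0.
  have /(Sa a)/PS : S (v - R *m (P *m v)).
    by apply/PS; rewrite mulmxBr (mulmxA P R) PR mul1mx subrr.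
  move=> /eqP; rewrite !mulmxBr subr_eq0 !mulmxA => /eqP.
  by rewrite /act /v => /(congr1 (fun v : 'cV_ _ => v i 0)); rewrite -!colE !mxE.
have act_lin : linear act.
  by move=> k a b; rewrite /act fgact_linear mulmxDr mulmxDl -scalemxAr -scalemxAl.
have act1 : act 1 = 1%:M by rewrite /act fgact1 mulmx1.
have actM : {morph act : a b / a * b >-> a *m b}.
  by move=> a b; rewrite {1}/act fgactM mulmxA Pact /act !mulmxA.
pose Y := FgMod act_lin act1 actM.
have [p pE] := @mxlin M Y P Pact.
exists Y, p; split; last by move=> x; rewrite pE.
by move=> y; exists (R *m y); rewrite pE mulmxA PR mul1mx.
Qed.

End FinGenModules.

Section KLinear.
Variables (K : fieldType) (A : falgType K).

Fact klin_subproof (U V : lmodType A) r (c : 'I_r -> K) (h : 'I_r -> {linear U -> V}) :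
  linear (fun x => \sum_i (c i)%:A *: h i x).
Proof.
move=> a x y; rewrite scaler_sumr -big_split /=; apply: eq_bigr => i _.
by rewrite linearP scalerDr kscale_comm.
Qed.

Definition klin (U V : lmodType A) r (c : 'I_r -> K) (h : 'I_r -> {linear U -> V}) :
  {linear U -> V} := mklin (klin_subproof c h).

Lemma klinE (U V : lmodType A) r (c : 'I_r -> K) (h : 'I_r -> {linear U -> V}) x :
  klin c h x = \sum_i (c i)%:A *: h i x.
Proof. by []. Qed.
End KLinear.

Section Tools.
Variables (K : fieldType) (A : falgType K).
Implicit Types M N X Y Z D : fgmod A.

Lemma mx_ext m n (B C : 'M[K]_(m, n)) : (forall v : 'cV_n, B *m v = C *m v) -> B = C.
Proof.
by move=> BC; apply/matrixP => i j; have /matrixP/(_ i 0) := BC (delta_mx j 0); rewrite -!colE !mxE.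
Qed.

Lemma hmx_comm M N (f : {linear M -> N}) a : hmx f *m fgact M a = fgact N a *m hmx f.
Proof.
apply: mx_ext => v; rewrite -!mulmxA.
by have := linearP f a (v : M) 0; rewrite linear0 !addr0 !hmxP.
Qed.

Lemma injective_mx M N (f : {linear M -> N}) : injective f -> row_full (hmx f).
Proof.
move=> fI; have : row_free (hmx f)^T.
  apply: inj_row_free => v v0; apply: trmx_inj; rewrite trmx0; apply: fI.
  by rewrite linear0 hmxP -[hmx f]trmxK -trmx_mul v0 trmx0.
by rewrite /row_free mxrank_tr /row_full.
Qed.

Lemma surjective_mx M N (f : {linear M -> N}) : surjective f -> row_free (hmx f).
Proof.
move=> fS; have [s sP] := choice fS; apply/row_freeP.
exists (\matrix_(i, j) (s (delta_mx j 0) : 'cV[K]__) i 0).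
apply/matrixP => i j; have /(congr1 (fun v : 'cV[K]_(fgdim N) => v i 0)) := sP (delta_mx j 0).
rewrite hmxP => h; rewrite !mxE [in LHS] /=.
rewrite !mxE andbT in h; rewrite -h.
by apply: eq_bigr => k _; rewrite !mxE.
Qed.

Lemma mx_injective M N (f : {linear M -> N}) : row_full (hmx f) -> injective f.
Proof.
move=> /row_fullP[B BF] x y; rewrite !hmxP => /(congr1 (mulmx B)).
by rewrite !mulmxA BF !mul1mx.
Qed.

Lemma mx_surjective M N (f : {linear M -> N}) : row_free (hmx f) -> surjective f.
Proof.
by move=> /row_freeP[B FB] y; exists (B *m y); rewrite hmxP mulmxA FB mul1mx.
Qed.

Lemma surj_dim M N (f : {linear M -> N}) : surjective f -> (fgdim N <= fgdim M)%N.
Proof. by move/surjective_mx => /eqP<-; exact: rank_leq_col. Qed.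

Lemma inj_surj M N (f : {linear M -> N}) :
  injective f -> (fgdim N <= fgdim M)%N -> surjective f.
Proof.
move=> /injective_mx/eqP fI le; apply: mx_surjective.
by rewrite /row_free eqn_leq rank_leq_row fI.
Qed.

Lemma surj_inj M N (f : {linear M -> N}) :
  surjective f -> (fgdim M <= fgdim N)%N -> injective f.
Proof.
move=> /surjective_mx/eqP fI le; apply: mx_injective.
by rewrite /row_full eqn_leq rank_leq_col fI.
Qed.

Definition is_biprod D X Y (i1 : {linear X -> D}) (i2 : {linear Y -> D})
    (p1 : {linear D -> X}) (p2 : {linear D -> Y}) : Prop :=
  [/\ forall x, p1 (i1 x) = x, forall x, p2 (i1 x) = 0, forall y, p1 (i2 y) = 0,
      forall y, p2 (i2 y) = y & forall z, z = i1 (p1 z) + i2 (p2 z)].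

Lemma biprod X Y : exists D (i1 : {linear X -> D}) (i2 : {linear Y -> D})
  (p1 : {linear D -> X}) (p2 : {linear D -> Y}), is_biprod i1 i2 p1 p2.
Proof.
pose act a := block_mx (fgact X a) 0 0 (fgact Y a).
have act_lin : linear act.
  move=> k a b; rewrite /act !fgact_linear scale_block_mx add_block_mx.
  by rewrite !scaler0 !addr0.
have act1 : act 1 = 1%:M by rewrite /act !fgact1 -scalar_mx_block.
have actM : {morph act : a b / a * b >-> a *m b}.
  by move=> a b; rewrite /act !fgactM mulmx_block !(mulmx0, mul0mx, addr0, add0r).
pose D := FgMod act_lin act1 actM.
have [|i1 i1E] := @mxlin K A X D (col_mx 1%:M 0).
  by move=> a; rewrite mul_block_col mul_col_mx !(mul0mx, mulmx0, mul1mx, mulmx1, addr0).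
have [|i2 i2E] := @mxlin K A Y D (col_mx 0 1%:M).
  by move=> a; rewrite mul_block_col mul_col_mx !(mul0mx, mulmx0, mul1mx, mulmx1, add0r).
have [|p1 p1E] := @mxlin K A D X (row_mx 1%:M 0).
  by move=> a; rewrite mul_row_block mul_mx_row !(mul0mx, mulmx0, mul1mx, mulmx1, addr0).
have [|p2 p2E] := @mxlin K A D Y (row_mx 0 1%:M).
  by move=> a; rewrite mul_row_block mul_mx_row !(mul0mx, mulmx0, mul1mx, mulmx1, add0r).
exists D, i1, i2, p1, p2; split=> z; rewrite ?p1E ?p2E ?i1E ?i2E.
- by rewrite mulmxA mul_row_col !(mulmx1, mul0mx, addr0, mul1mx).
- by rewrite mulmxA mul_row_col !(mulmx1, mul0mx, addr0, mul1mx, mulmx0).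
- by rewrite mulmxA mul_row_col !(mulmx1, mul0mx, addr0, mul1mx, mulmx0).
- by rewrite mulmxA mul_row_col !(mulmx1, mul0mx, add0r, mul1mx).
- suff : z = (col_mx 1%:M 0 *m row_mx 1%:M 0 + col_mx 0 1%:M *m row_mx 0 1%:M) *m z.
    by rewrite mulmxDl -!mulmxA.
  rewrite !mul_col_row add_block_mx !(mul0mx, mulmx0, mul1mx, mulmx1, addr0, add0r).
  by rewrite -scalar_mx_block mul1mx.
Qed.

Lemma zero_exists : exists Z, zeroM Z.
Proof.
have [[M _] _ _ _] := is_wide_setT A.
have [|Z [p [pS pP]]] := @submod_quo K A M setT; first by split.
by exists Z => x; have [y <-] := pS x; apply/pP.
Qed.

(** Hom(X, Y) is the space of matrices commuting with the action, flattened by [mxvec] so that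
    [subspace_inc] provides a basis. *)
Lemma hom_basis X Y : exists r (h : 'I_r -> {linear X -> Y}),
  (forall f : {linear X -> Y}, exists c : 'I_r -> K, forall x, f x = klin c h x) /\
  (forall c : 'I_r -> K, (forall x, klin c h x = 0) -> forall i, c i = 0).
Proof.
pose S (v : 'cV[K]_(fgdim Y * fgdim X)) := forall a,
  vec_mx v^T *m fgact X a = fgact Y a *m vec_mx v^T.
have [a|k x y Sx Sy a|r [I [L [LI SI IL]]]] := @subspace_inc K _ S.
- by rewrite trmx0 linear0 mul0mx mulmx0.
- by rewrite !linearP /= mulmxDl -scalemxAl Sx Sy.
have /choice[h hP] (i : 'I_r) : exists h : {linear X -> Y}, forall x : X,
    h x = vec_mx (I *m (delta_mx i 0 : 'cV_r))^T *m (x : 'cV[K]_(fgdim X)).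
  by apply: mxlin => a; exact: SI.
have hE (c : 'cV[K]_r) (x : X) : klin (fun i => c i 0) h x =
    vec_mx (I *m c)^T *m (x : 'cV[K]_(fgdim X)).
  rewrite [c in RHS]colsum mulmx_sumr !linear_sum /= mulmx_suml.
  apply: eq_bigr => i _; rewrite kscaleE hP -scalemxAr !linearZ /= -scalemxAl.
  by [].
exists r, h; split=> [f|c c0 i].
  have Sf : S (mxvec (hmx f))^T.
    move=> a; rewrite trmxK mxvecK.
    exact: hmx_comm.
  exists (fun i => (L *m (mxvec (hmx f))^T) i 0) => x.
  by rewrite hE IL // trmxK mxvecK hmxP.
have /(congr1 (fun v : 'cV[K]_r => v i 0)) : \col_i c i = 0 :> 'cV[K]_r.
  rewrite -[LHS]mul1mx -LI -mulmxA.
  suff -> : I *m (\col_i c i) = 0 by rewrite mulmx0.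
  apply: trmx_inj; rewrite trmx0 -[LHS]vec_mxK.
  suff -> : vec_mx (I *m \col_i c i)^T = 0 by rewrite linear0.
  apply: mx_ext => v; rewrite -hE mul0mx -(c0 v).
  by congr (klin _ h v); apply/funext => l; rewrite mxE.
by rewrite !mxE.
Qed.

End Tools.

Lemma pair_ext (T U : Type) (p q : T * U) : p.1 = q.1 -> p.2 = q.2 -> p = q.
Proof. by case: p q => [a b] [c d] /= -> ->. Qed.

(** * Direct summands and the Fitting lemma *)

Section Decomposition.
Variables (K : fieldType) (A : falgType K).
Implicit Types M N X Y Z D : fgmod A.

Lemma ker_submod M N (f : {linear M -> N}) : submod (fun x => f x = 0).
Proof.
by split=> [|a x y fx fy]; rewrite ?linear0 // linearP fx fy scaler0 addr0.
Qed.

Lemma image_submod M N (f : {linear M -> N}) : submod (fun y => exists x, f x = y).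
Proof.
split=> [|a _ _ [x <-] [y <-]]; first by exists 0; rewrite linear0.
by exists (a *: x + y); rewrite linearP.
Qed.

Lemma ker_exists M N (f : {linear M -> N}) : exists X (i : {linear X -> M}),
  injective i /\ forall y, f y = 0 <-> exists x, i x = y.
Proof. exact: submod_sub (ker_submod f). Qed.

Lemma image_exists M N (f : {linear M -> N}) :
  exists X (c : {linear M -> X}) (i : {linear X -> N}),
  [/\ surjective c, injective i & forall x, i (c x) = f x].
Proof.
have [X [i [iI iP]]] := submod_sub (image_submod f).
have [|c cP] := factor_inj (f := f) iI; first by move=> u; apply/iP; exists u.
exists X, c, i; split=> // y; have /iP[x xP] : exists x, i x = i y by exists y.
by exists x; apply: iI; rewrite cP.
Qed.

Lemma biprod_prod D X Y (i1 : {linear X -> D}) (i2 : {linear Y -> D})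
  (p1 : {linear D -> X}) (p2 : {linear D -> Y}) :
  is_biprod i1 i2 p1 p2 -> isoM D (X * Y)%type.
Proof.
move=> [p1i1 p2i1 p1i2 p2i2 zE].
have fl : linear (fun d => (p1 d, p2 d)) by move=> a x y; rewrite !linearP.
exists (mklin fl); exists (fun xy => i1 xy.1 + i2 xy.2) => [z|[x y]] /=.
  by rewrite -zE.
by rewrite !linearD p1i1 p2i1 p1i2 p2i2 addr0 add0r.
Qed.

Lemma prod_biprod D X Y : isoM D (X * Y)%type ->
  exists (i1 : {linear X -> D}) (i2 : {linear Y -> D})
  (p1 : {linear D -> X}) (p2 : {linear D -> Y}), is_biprod i1 i2 p1 p2.
Proof.
move=> /isoMP[f fI fS]; have [g fK gK] := inv_lin fI fS.
have i1l : linear (fun x => g (x, 0)).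
  move=> a x y; rewrite -linearP; congr (g _).
  by apply: pair_ext; rewrite /= ?scaler0 ?addr0.
have i2l : linear (fun x => g (0, x)).
  move=> a x y; rewrite -linearP; congr (g _).
  by apply: pair_ext; rewrite /= ?scaler0 ?addr0.
have p1l : linear (fun x => (f x).1) by move=> a x y; rewrite linearP.
have p2l : linear (fun x => (f x).2) by move=> a x y; rewrite linearP.
exists (mklin i1l), (mklin i2l), (mklin p1l), (mklin p2l).
split=> x /=; rewrite ?gK //.
by rewrite -linearD -[LHS]fK; congr (g _); apply: pair_ext; rewrite /= ?addr0 ?add0r.
Qed.

Lemma retract_biprod X M (i : {linear X -> M}) (r : {linear M -> X}) :
  (forall x, r (i x) = x) ->
  exists N (k : {linear N -> M}) (q : {linear M -> N}), is_biprod i k r q.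
Proof.
move=> ri; have [N [k [kI kP]]] := ker_exists r.
have [|g gP] := factor_inj (f := idfun \- (i \o r)) kI.
  by move=> m; apply/kP; rewrite /= linearB /= ri subrr.
have rk y : r (k y) = 0 by apply/kP; exists y.
exists N, k, g; split=> // [x|y|z].
- by apply: kI; rewrite gP /= ri subrr linear0.
- by apply: kI; rewrite gP /= rk linear0 subr0.
- by rewrite gP /= addrC subrK.
Qed.

Lemma indec_retract M X (i : {linear X -> M}) (r : {linear M -> X}) :
  indecomposable M -> (forall x, r (i x) = x) -> zeroM X \/ surjective i.
Proof.
move=> [_ Mi] ri; have [N [k [q b]]] := retract_biprod ri.
have [|N0] := Mi _ _ (biprod_prod b); first by left.
right=> m; exists (r m); have [_ _ _ _ /(_ m)] := b.
by rewrite (N0 (q m)) linear0 addr0.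
Qed.

Fixpoint epow M (e : {linear M -> M}) n : {linear M -> M} :=
  if n is n'.+1 then e \o epow e n' else idfun.

Lemma epowD M (e : {linear M -> M}) m n x : epow e (m + n) x = epow e m (epow e n x).
Proof. by elim: m => //= m ->. Qed.

(** Choose a power of [e] whose image has least dimension. Restricted to its image this power is
    onto, hence bijective, and its inverse turns the image into a direct summand. *)
Lemma fitting M (e : {linear M -> M}) : exists n X (i : {linear X -> M}) (r : {linear M -> X}),
  (forall x, r (i x) = x) /\
  (forall y, (exists x, i x = y) <-> exists z, epow e n.+1 z = y).
Proof.
pose ok d := `[< exists n X (c : {linear M -> X}) (i : {linear X -> M}),
   [/\ surjective c, injective i, forall x, i (c x) = epow e n.+1 x & fgdim X = d] >].
have ex : exists d, ok d.
  have [X [c [i [cS iI icE]]]] := image_exists (epow e 1).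
  by exists (fgdim X); apply/asboolP; exists 0%N, X, c, i.
have [_ /asboolP[n [X [c [i [cS iI icE <-]]]]] dmin] := ex_minnP ex.
have [J [d [j [dS jI jdE]]]] := image_exists (c \o i).
have le : (fgdim X <= fgdim J)%N.
  (* The square of [epow e n.+1] is [epow e (n + n.+1).+1], and its image is [J]. *)
  apply: dmin; apply/asboolP; exists (n + n.+1)%N, J, (d \o c), (i \o j); split=> //.
  - by move=> y; have [x <-] := dS y; have [z <-] := cS x; exists z.
  - by move=> x y /iI /jI.
  - by move=> x; rewrite -addSn epowD -!icE /= jdE.
have jS := inj_surj jI le.
have ciS : surjective (c \o i).
  by move=> y; have [x <-] := jS y; have [z <-] := dS x; exists z; rewrite -jdE.
have ciI := surj_inj ciS (leqnn _).
have [g gK gK'] := inv_lin ciI ciS.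
exists n, X, i, (g \o c); split=> [x|y]; first by rewrite /= -[RHS]gK.
split=> [[x <-]|[z <-]]; last by exists (c z).
by have [z <-] := cS x; exists z.
Qed.

Lemma endo_surj M (e : {linear M -> M}) : surjective e -> injective e.
Proof. by move=> eS; apply: surj_inj. Qed.

(** All powers of [e] are compatible with the nonzero map [pi], so none vanishes. By [fitting] the
    image of a power is a nonzero summand of [M], hence all of [M]. *)
Lemma indec_endo M (S : fgmod A) (pi : {linear M -> S}) (e : {linear M -> M}) :
    indecomposable M -> (exists x, pi x <> 0) -> (forall x, pi (e x) = pi x) ->
  injective e /\ surjective e.
Proof.
move=> Mi [x0 pix0] pie; have [n [X [i [r [ri iP]]]]] := fitting e.
have pin m x : pi (epow e m x) = pi x by elim: m => //= m <-.
suff eS : surjective e by split=> //; apply: endo_surj.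
have [X0|iS] := indec_retract Mi ri.
  have [x xE] : exists x, i x = epow e n.+1 x0 by apply/iP; exists x0.
  by case: pix0; rewrite -(pin n.+1) -xE (X0 x) !linear0.
move=> y; have /iP[z <-] : exists x, i x = y by exact: iS.
by exists (epow e n z).
Qed.

End Decomposition.

(** * Wide subcategories and torsion classes *)

Section Classes.
Variables (K : fieldType) (A : falgType K).
Implicit Types (W T U : set (fgmod A)) (M N X Y Z D E C S P Q F G I J L V : fgmod A).

(** The kernel is represented by any injective map onto it with source in [T], so that no canonical
    kernel object has to be chosen. *)
Definition kernel_in T X Y (f : {linear X -> Y}) : Prop :=
  exists N (i : {linear N -> X}),
    [/\ T N, injective i & forall x, f x = 0 <-> exists y, i y = x].

Lemma kernel_inW T U X Y (f : {linear X -> Y}) : T `<=` U -> kernel_in T f -> kernel_in U f.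
Proof. by move=> TU [N [i [/TU ? iI iP]]]; exists N, i. Qed.

Lemma ext_closedE T : ext_closed T <->
  forall E Y (p : {linear E -> Y}), surjective p -> kernel_in T p -> T Y -> T E.
Proof.
split=> [TE E Y p pS [N [i [TN iI iP]]] TY|TE X Y E i p [iI pS ip] TX TY].
  apply: (TE N Y E i p) => //; split=> //; first exact/surjectiveE.
  by apply/seteqP; split=> x /=; [move=> [y _ <-]; apply/iP; exists y|move=> /iP[y <-]; exists y].
apply: (TE E Y p) => //; first exact/surjectiveE.
exists X, i; split=> // x; split=> [px|[y <-]].
  have : ker p x by []. 
  by rewrite -ip => -[y _ <-]; exists y.
have : range i (i y) by exists y.
by rewrite ip.
Qed.

Section Wide.
Variable W : set (fgmod A).
Hypothesis Ww : is_wide W.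

Lemma wide_kerP M N (f : {linear M -> N}) X (i : {linear X -> M}) :
  W M -> W N -> injective i -> (forall x, f x = 0 <-> exists y, i y = x) -> W X.
Proof.
move=> WM WN iI iP; have [_ Wk _ _] := Ww; apply: (Wk M N f X i) => //; split=> //.
by apply/seteqP; split=> x /=; [move=> [y _ <-]; apply/iP; exists y|move=> /iP[y <-]; exists y].
Qed.

Lemma wide_ker M N (f : {linear M -> N}) : W M -> W N -> kernel_in W f.
Proof.
move=> WM WN; have [X [i [iI iP]]] := ker_exists f.
by exists X, i; split=> //; apply: wide_kerP iP.
Qed.

Lemma wide_cokP M N (f : {linear M -> N}) X (p : {linear N -> X}) :
  W M -> W N -> surjective p -> (forall y, p y = 0 <-> exists x, f x = y) -> W X.
Proof.
move=> WM WN pS pP; have [_ _ Wc _] := Ww; apply: (Wc M N f X p) => //; split=> //.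
  exact/surjectiveE.
by apply/seteqP; split=> x /=; [move=> /pP[y <-]; exists y|move=> [y _ <-]; apply/pP; exists y].
Qed.

Lemma wide_cok M N (f : {linear M -> N}) : W M -> W N ->
  exists C (p : {linear N -> C}), [/\ W C, surjective p & forall y, p y = 0 <-> exists x, f x = y].
Proof.
move=> WM WN; have [C [p [pS pP]]] := submod_quo (image_submod f).
have pP' y : p y = 0 <-> exists x, f x = y by split=> /pP.
by exists C, p; split=> //; apply: wide_cokP pP'.
Qed.

Lemma wide_ext E Y (p : {linear E -> Y}) : surjective p -> kernel_in W p -> W Y -> W E.
Proof. by have [_ _ _ /ext_closedE] := Ww; apply. Qed.

Lemma wide_iso X Y (f : {linear X -> Y}) : injective f -> surjective f -> W X -> W Y.
Proof.
move=> fI fS WX; apply: (@wide_cokP X X (\0) Y f) => // x.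
by split=> [fx|[y <-]]; [exists 0; apply: fI; rewrite fx /= linear0|rewrite /= linear0].
Qed.

Lemma wide_zero Z : zeroM Z -> W Z.
Proof.
move=> Z0; have [[X WX] _ _ _] := Ww.
apply: (@wide_cokP X X idfun Z (\0)) => // [z|x]; first by exists 0; rewrite [RHS]Z0.
by split=> // _; exists x.
Qed.

Lemma wide_biprod D X Y (i1 : {linear X -> D}) (i2 : {linear Y -> D})
  (p1 : {linear D -> X}) (p2 : {linear D -> Y}) :
  is_biprod i1 i2 p1 p2 -> W X -> W Y -> W D.
Proof.
move=> [p1i1 p2i1 p1i2 p2i2 zE] WX WY; apply: (@wide_ext D Y p2) => //.
  by move=> y; exists (i2 y).
exists X, i1; split=> // [x y /(congr1 p1)|x]; first by rewrite !p1i1.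
split=> [px|[y <-]//]; exists (p1 x).
by rewrite [RHS]zE px linear0 addr0.
Qed.

Lemma wide_image M N (f : {linear M -> N}) : W M -> W N ->
  exists X (c : {linear M -> X}) (i : {linear X -> N}),
  [/\ W X, surjective c, injective i & forall x, i (c x) = f x].
Proof.
move=> WM WN; have [X [c [i [cS iI icE]]]] := image_exists f.
exists X, c, i; split=> //; have [L [l [WL lI lP]]] := wide_ker f WM WN.
apply: (@wide_cokP L M l X c) => // x; rewrite -lP -icE.
by split=> [->|ic0]; [rewrite linear0|apply: iI; rewrite ic0 linear0].
Qed.

Lemma wide_retract X M (i : {linear X -> M}) (r : {linear M -> X}) :
  (forall x, r (i x) = x) -> W M -> W X.
Proof.
move=> ri WM; pose f : {linear M -> M} := idfun \- (i \o r).
apply: (@wide_kerP M M f X i) => // [x y /(congr1 r)|x]; first by rewrite !ri.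
rewrite /f /=; split=> [/eqP|[y <-]]; last by rewrite ri subrr.
by rewrite subr_eq0 => /eqP e; exists (r x).
Qed.

Definition is_pullback E X Y Z (f : {linear X -> Z}) (g : {linear Y -> Z})
    (p1 : {linear E -> X}) (p2 : {linear E -> Y}) : Prop :=
  [/\ forall e, f (p1 e) = g (p2 e), forall x y, f x = g y -> exists e, p1 e = x /\ p2 e = y
    & forall e, p1 e = 0 -> p2 e = 0 -> e = 0].

Lemma wide_pullback X Y Z (f : {linear X -> Z}) (g : {linear Y -> Z}) :
  W X -> W Y -> W Z -> exists E (p1 : {linear E -> X}) (p2 : {linear E -> Y}),
  W E /\ is_pullback f g p1 p2.
Proof.
move=> WX WY WZ; have [D [i1 [i2 [p1 [p2 b]]]]] := biprod X Y.
have [p1i1 p2i1 p1i2 p2i2 zE] := b; have WD := wide_biprod b WX WY.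
have [E [i [WE iI iP]]] := wide_ker ((f \o p1) \- (g \o p2)) WD WZ.
exists E, (p1 \o i), (p2 \o i); split=> //; split=> /=.
- move=> e; have /iP/eqP : exists y, i y = i e by exists e.
  by rewrite /= subr_eq0 => /eqP.
- move=> x y fg; have [|e eE] := (iP (i1 x + i2 y)).1.
    by rewrite /= !linearD p1i1 p1i2 p2i1 p2i2 !linear0 addr0 add0r fg subrr.
  by exists e; rewrite eE !linearD p1i1 p1i2 p2i1 p2i2 addr0 add0r.
- by move=> e e1 e2; apply: iI; rewrite linear0 [LHS]zE e1 e2 !linear0 addr0.
Qed.

End Wide.

Lemma pullback_map V E X Y Z (f : {linear X -> Z}) (g : {linear Y -> Z})
    (p1 : {linear E -> X}) (p2 : {linear E -> Y}) (a : {linear V -> X}) (b : {linear V -> Y}) :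
  is_pullback f g p1 p2 -> (forall v, f (a v) = g (b v)) ->
  exists u : {linear V -> E}, (forall v, p1 (u v) = a v) /\ (forall v, p2 (u v) = b v).
Proof.
move=> [_ pP pI] ab; have /choice[u uP] v : exists e, p1 e = a v /\ p2 e = b v by exact: pP.
have ul : linear u.
  move=> k x y; apply/eqP; rewrite -subr_eq0; apply/eqP.
  apply: pI; rewrite linearB linearP ?(uP _).1 ?(uP _).2 linearP subrr //.
by exists (mklin ul); split=> v; case: (uP v).
Qed.

Lemma pullback_ker T E X Y Z (f : {linear X -> Z}) (g : {linear Y -> Z})
    (p1 : {linear E -> X}) (p2 : {linear E -> Y}) :
  is_pullback f g p1 p2 -> kernel_in T f -> kernel_in T p2.
Proof.
move=> p [N [i [TN iI iP]]].
have [|u [u1 u2]] := @pullback_map N E X Y Z f g p1 p2 i (\0) p.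
  by move=> v; rewrite linear0; apply/iP; exists v.
exists N, u; split=> // [x y /(congr1 p1)|e]; first by rewrite !u1 => /iI.
have [fg _ pI] := p.
split=> [pe|[y <-]]; last by rewrite u2.
have [|y yE] := (iP (p1 e)).1; first by rewrite fg pe linear0.
exists y; apply/eqP; rewrite -subr_eq0; apply/eqP.
by apply: pI; rewrite linearB ?u1 ?u2 ?yE ?pe /= ?subrr.
Qed.

Lemma pullback_surj E X Y Z (f : {linear X -> Z}) (g : {linear Y -> Z})
    (p1 : {linear E -> X}) (p2 : {linear E -> Y}) :
  is_pullback f g p1 p2 -> surjective f -> surjective p2.
Proof.
move=> [_ pP _] fS y; have [x xE] := fS (g y).
by have [e [_ <-]] := pP x y xE; exists e.
Qed.

Lemma family_sum T n (Y : 'I_n -> fgmod A) X (f : forall k, {linear Y k -> X}) :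
    (forall Z, zeroM Z -> T Z) ->
    (forall D X Y (i1 : {linear X -> D}) (i2 : {linear Y -> D})
       (p1 : {linear D -> X}) (p2 : {linear D -> Y}),
       is_biprod i1 i2 p1 p2 -> T X -> T Y -> T D) ->
    (forall k, T (Y k)) ->
  exists D (s : {linear D -> X}), T D /\
    forall k, exists j : {linear Y k -> D}, forall y, s (j y) = f k y.
Proof.
move=> T0 TD; elim: n Y f => [|n IH] Y f TY.
  have [Z Z0] := zero_exists A; exists Z, (\0); split; first exact: T0.
  by case.
have [|D [s [TDD sP]]] := IH (fun k => Y (lift ord0 k)) (fun k => f (lift ord0 k)).
  by move=> k; exact: TY.
have [E [i1 [i2 [p1 [p2 b]]]]] := biprod (Y ord0) D.
have [p1i1 p2i1 p1i2 p2i2 zE] := b.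
exists E, ((f ord0 \o p1) \+ (s \o p2)); split; first exact: TD b _ _.
move=> k; case: (unliftP ord0 k) => [l ->|->].
  have [j jP] := sP l; exists (i2 \o j) => y /=.
  by rewrite p1i2 p2i2 linear0 add0r jP.
by exists i1 => y /=; rewrite p1i1 p2i1 linear0 addr0.
Qed.

End Classes.

(** * Torsion classes and Ext-projective objects *)

Section Torsion.
Variables (K : fieldType) (A : falgType K).
Implicit Types (T U : set (fgmod A)) (M N X Y Z D E C S P Q F G I J L V : fgmod A).

Lemma fgmod_min (Pr : fgmod A -> Prop) : (exists X, Pr X) ->
  exists2 X, Pr X & forall Y, Pr Y -> (fgdim X <= fgdim Y)%N.
Proof.
move=> [X0 PX0]; pose ok d := `[< exists2 X, Pr X & fgdim X = d >].
have ex : exists d, ok d by exists (fgdim X0); apply/asboolP; exists X0.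
have [_ /asboolP[X PX <-] Xmin] := ex_minnP ex.
by exists X => // Y PY; apply: Xmin; apply/asboolP; exists Y.
Qed.

Lemma family_prod T n (Y : 'I_n -> fgmod A) X (f : forall k, {linear X -> Y k}) :
    (forall Z, zeroM Z -> T Z) ->
    (forall D X Y (i1 : {linear X -> D}) (i2 : {linear Y -> D})
       (p1 : {linear D -> X}) (p2 : {linear D -> Y}),
       is_biprod i1 i2 p1 p2 -> T X -> T Y -> T D) ->
    (forall k, T (Y k)) ->
  exists D (s : {linear X -> D}), T D /\
    forall k, exists j : {linear D -> Y k}, forall x, j (s x) = f k x.
Proof.
move=> T0 TD; elim: n Y f => [|n IH] Y f TY.
  have [Z Z0] := zero_exists A; exists Z, (\0); split; first exact: T0.
  by case.
have [|D [s [TDD sP]]] := IH (fun k => Y (lift ord0 k)) (fun k => f (lift ord0 k)).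
  by move=> k; exact: TY.
have [E [i1 [i2 [p1 [p2 b]]]]] := biprod (Y ord0) D.
have [p1i1 p2i1 p1i2 p2i2 zE] := b.
exists E, ((i1 \o f ord0) \+ (i2 \o s)); split; first exact: TD b _ _.
move=> k; case: (unliftP ord0 k) => [l ->|->].
  have [j jP] := sP l; exists (j \o p2) => x /=.
  by rewrite linearD p2i1 p2i2 add0r jP.
by exists p1 => x /=; rewrite linearD p1i1 p1i2 addr0.
Qed.

Definition tfree T Y := forall Z (f : {linear Z -> Y}), T Z -> forall z, f z = 0.

Lemma tfree_sub T X Y (i : {linear X -> Y}) : injective i -> tfree T Y -> tfree T X.
Proof. by move=> iI Yf Z f TZ z; apply: iI; rewrite linear0; apply: (Yf Z (i \o f)). Qed.

Lemma kernel_in_comp T X Y Z (f : {linear X -> Y}) (g : {linear Y -> Z}) :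
  ext_closed T -> surjective f -> kernel_in T f -> kernel_in T g -> kernel_in T (g \o f).
Proof.
move=> /ext_closedE Text fS [N [i [TN iI iP]]] [L [j [TL jI jP]]].
have [D [k [kI kP]]] := ker_exists (g \o f).
exists D, k; split=> //.
have [|h hP] := factor_inj (f := f \o k) jI.
  by move=> d; apply/jP; apply/(kP (k d)); exists d.
apply: (Text D L h) => //.
  move=> l; have [x xE] := fS (j l).
  have [|d dE] := (kP x).1; first by rewrite /= xE; apply/jP; exists l.
  by exists d; apply: jI; rewrite hP /= dE.
have [|m mP] := factor_inj (f := i) kI.
  move=> n; apply/kP => /=; have -> : f (i n) = 0 by apply/iP; exists n.
  by rewrite linear0.
exists N, m; split=> //.
  by move=> x y e; apply: iI; rewrite -!mP e.
move=> d; split=> [hd|[n <-]].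
  have [|n nE] := (iP (k d)).1; first by rewrite -[LHS]/((f \o k) d) -hP hd linear0.
  by exists n; apply: kI; rewrite mP.
apply: jI; rewrite hP linear0 /= mP; apply/iP; by exists n.
Qed.

Section InWide.
Variable W : set (fgmod A).
Hypothesis Ww : is_wide W.

Lemma ext_biprod T : ext_closed T ->
  forall D X Y (i1 : {linear X -> D}) (i2 : {linear Y -> D})
  (p1 : {linear D -> X}) (p2 : {linear D -> Y}),
  is_biprod i1 i2 p1 p2 -> T X -> T Y -> T D.
Proof.
move=> /ext_closedE Text D X Y i1 i2 p1 p2 [p1i1 p2i1 p1i2 p2i2 zE] TX TY.
apply: (Text D Y p2) => //; first by move=> y; exists (i2 y).
exists X, i1; split=> // [x y /(congr1 p1)|x]; first by rewrite !p1i1.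
split=> [px|[y <-]//]; exists (p1 x).
by rewrite [RHS]zE px linear0 addr0.
Qed.

Definition genby Y X := exists n (f : 'I_n -> {linear Y -> X}),
  forall x, exists y : 'I_n -> Y, x = \sum_k f k (y k).

Lemma Gen1E M X : Gen W [set M] X <-> W X /\ genby M X.
Proof.
split=> [[WX [n [Y [f [CY fP]]]]]|[WX [n [f fP]]]]; split=> //; last first.
  by exists n, (fun=> M), f.
have /choice[g gP] : forall k, exists g : {linear M -> X}, forall y : Y k,
    exists m, g m = f k y.
  by move=> k; move: (f k); rewrite (CY k) => h; exists h => y; exists y.
exists n, g => x; have [y ->] := fP x.
have /choice[z zP] k := gP k (y k); exists z.
by apply: eq_bigr => k _; rewrite zP.
Qed.

Section TorsionClass.
Variable T : set (fgmod A).
Hypothesis tT : is_torsion_class W T.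

Lemma torsion_sub : T `<=` W. Proof. by case: tT. Qed.

Lemma torsion_ext E Y (p : {linear E -> Y}) : surjective p -> kernel_in T p -> T Y -> T E.
Proof. by have [_ /ext_closedE h _] := tT; apply: h. Qed.

Lemma torsion_quo X Y (p : {linear X -> Y}) : surjective p -> T X -> W Y -> T Y.
Proof.
move=> pS TX WY; have [_ _ ->] := tT; split=> //.
exists 1%N, (fun=> X), (fun=> p); split=> // y; have [x <-] := pS y.
by exists (fun=> x); rewrite big_ord1.
Qed.

Lemma torsion_zero Z : zeroM Z -> T Z.
Proof.
move=> Z0; have [_ _ ->] := tT; split; first exact: wide_zero.
exists 0%N, (fun=> Z), (fun=> idfun); split; first by case.
by move=> x; exists (fun=> 0); rewrite big_ord0; exact: Z0.
Qed.

Lemma torsion_iso X Y (f : {linear X -> Y}) : injective f -> surjective f -> T X -> T Y.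
Proof. by move=> fI fS TX; apply: (torsion_quo fS TX); exact: (wide_iso Ww fI fS (torsion_sub TX)). Qed.

Lemma torsion_biprod D X Y (i1 : {linear X -> D}) (i2 : {linear Y -> D})
  (p1 : {linear D -> X}) (p2 : {linear D -> Y}) :
  is_biprod i1 i2 p1 p2 -> T X -> T Y -> T D.
Proof. by case: tT => _ /ext_biprod h _; apply: h. Qed.

Lemma torsion_genby Y X : T Y -> W X -> genby Y X -> T X.
Proof.
move=> TY WX [n [f fP]].
have [D [s [TD sP]]] := @family_sum K A T n (fun=> Y) X f torsion_zero torsion_biprod (fun=> TY).
apply: (torsion_quo (p := s)) => // x; have [y ->] := fP x.
have /choice[j jP] := sP; exists (\sum_k j k (y k)).
by rewrite linear_sum; apply: eq_bigr => k _; rewrite jP.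
Qed.

(** The quotient of least dimension with kernel in [T] is torsion-free: the image of a nonzero map
    from an object of [T] could be divided out too, as [T] is closed under quotients and
    extensions. *)
Lemma torsion_quotient X : W X -> exists Y (p : {linear X -> Y}),
  [/\ W Y, surjective p, kernel_in T p & tfree T Y].
Proof.
move=> WX; pose Pr Y := exists p : {linear X -> Y}, [/\ W Y, surjective p & kernel_in T p].
have [|Y [p [WY pS pT]] Ymin] := @fgmod_min Pr.
  exists X, idfun; split=> //; first by move=> x; exists x.
  have [Z Z0] := zero_exists A; exists Z, (\0); split; first exact: torsion_zero.
    by move=> x y _; rewrite (Z0 x) (Z0 y).
  by move=> x; split=> [/= ->|[y <-]//]; exists (0 : Z).
exists Y, p; split=> // Z f TZ.
have [C [q [WC qS qP]]] := wide_cok Ww f (torsion_sub TZ) WY.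
have [I [c [i [WI cS iI icE]]]] := wide_image Ww f (torsion_sub TZ) WY.
have qI : injective q.
  apply: surj_inj => //.
  apply: Ymin; exists (q \o p); split=> //.
    by move=> y; have [x <-] := qS y; have [z <-] := pS x; exists z.
  apply: kernel_in_comp => //; first by case: tT.
  exists I, i; split=> //; first exact: torsion_quo cS TZ WI.
  move=> y; rewrite qP; split=> [[x <-]|[x <-]]; first by exists (c x).
  by have [z <-] := cS x; exists z; rewrite icE.
by move=> z; apply: qI; rewrite linear0; apply/qP; exists z.
Qed.

End TorsionClass.

Lemma torsion_classI T : T `<=` W -> (forall Z, zeroM Z -> T Z) ->
    (forall X Y (p : {linear X -> Y}), surjective p -> T X -> W Y -> T Y) ->
    (forall E Y (p : {linear E -> Y}), surjective p -> kernel_in T p -> T Y -> T E) ->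
  is_torsion_class W T.
Proof.
move=> TW T0 Tq Te; have Text : ext_closed T by exact/ext_closedE.
split=> //; apply/seteqP; split; first exact: subset_Gen.
move=> X [WX [n [Y [f [TY fP]]]]].
have [D [s [TD sP]]] := @family_sum K A T n Y X f T0 (ext_biprod Text) TY.
apply: (Tq D X s) => // x; have [y ->] := fP x.
have jP k := cid (sP k); exists (\sum_k sval (jP k) (y k)).
by rewrite linear_sum; apply: eq_bigr => k _; rewrite (svalP (jP k)).
Qed.

Lemma torsion_class_perp T (R : fgmod A -> Prop) : is_torsion_class W T ->
  is_torsion_class W (fun Y => T Y /\ forall X (f : {linear Y -> X}), R X -> forall y, f y = 0).
Proof.
move=> tT; apply: torsion_classI.
- by move=> Y [/(torsion_sub tT)].
- by move=> Z Z0; split; [exact: torsion_zero|move=> X f _ y; rewrite (Z0 y) linear0].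
- move=> X Y p pS [TX Xp] WY; split; first exact: torsion_quo pS TX WY.
  by move=> Z f RZ y; have [x <-] := pS y; apply: (Xp _ (f \o p)).
- move=> E Y p pS pT [TY Yp]; split.
    by apply: torsion_ext pS _ TY => //; apply: kernel_inW pT => Z [].
  move=> X f RX; have [N [i [[_ Np] iI iP]]] := pT.
  have [|g gP] := factor_surj (f := f) pS.
    by move=> u /iP[n <-]; apply: (Np _ (f \o i)).
  by move=> y; rewrite -gP; apply: Yp.
Qed.

(** For [M] in W this is the vanishing of Ext^1(M, N) for all N in [T], phrased as a lifting
    property. *)
Definition ext_projective T M := forall Y Z (g : {linear Y -> Z}), W Y -> W Z -> surjective g ->
  kernel_in T g -> forall u : {linear M -> Z}, exists v : {linear M -> Y}, forall x, g (v x) = u x.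

Lemma ext_projective_split T M : W M ->
    (forall F (q : {linear F -> M}), W F -> surjective q -> kernel_in T q ->
      exists s : {linear M -> F}, forall x, q (s x) = x) -> ext_projective T M.
Proof.
move=> WM sp Y Z g WY WZ gS gT u.
have [E [p1 [p2 [WE pb]]]] := wide_pullback Ww g u WY WM WZ.
have [s sP] := sp E p2 WE (pullback_surj pb gS) (pullback_ker pb gT).
by exists (p1 \o s) => x /=; have [-> _ _] := pb; rewrite sP.
Qed.

Lemma ext_projective_retract T M X (i : {linear X -> M}) (r : {linear M -> X}) :
  (forall x, r (i x) = x) -> ext_projective T M -> ext_projective T X.
Proof.
move=> ri PM Y Z g WY WZ gS gT u.
have [v vP] := PM Y Z g WY WZ gS gT (u \o r); exists (v \o i) => x.
by rewrite /= vP /= ri.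
Qed.

Lemma ext_projectiveS T U M : U `<=` T -> ext_projective T M -> ext_projective U M.
Proof. by move=> UT PM Y Z g WY WZ gS /(kernel_inW UT); apply: PM. Qed.

Lemma ext_projective_biprod T D X Y (i1 : {linear X -> D}) (i2 : {linear Y -> D})
  (p1 : {linear D -> X}) (p2 : {linear D -> Y}) :
  is_biprod i1 i2 p1 p2 -> ext_projective T X -> ext_projective T Y -> ext_projective T D.
Proof.
move=> [p1i1 p2i1 p1i2 p2i2 zE] PX PY M N g WM WN gS gT u.
have [v1 v1P] := PX M N g WM WN gS gT (u \o i1).
have [v2 v2P] := PY M N g WM WN gS gT (u \o i2).
by exists ((v1 \o p1) \+ (v2 \o p2)) => x; rewrite /= linearD v1P v2P /= -linearD -zE.
Qed.

Lemma ext_projective_zero T Z : zeroM Z -> ext_projective T Z.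
Proof. by move=> Z0 X Y g _ _ _ _ u; exists (\0) => x; rewrite (Z0 x) !linear0. Qed.

Definition fin_gen T := exists2 Y, T Y & forall X, T X -> genby Y X.

Definition progenerator G := [/\ W G, ext_projective W G & forall X, W X -> genby G X].

(** * Minimal approximations of a progenerator *)

Section Approx.
Variable G : fgmod A.
Hypothesis Gp : progenerator G.

Definition left_approx T E (a : {linear G -> E}) := T E /\
  forall X (f : {linear G -> X}), T X -> exists g : {linear E -> X}, forall x, f x = g (a x).

Lemma progenerator_lift Y Z (g : {linear Y -> Z}) (u : {linear G -> Z}) : W Y -> W Z ->
  surjective g -> exists v : {linear G -> Y}, forall x, g (v x) = u x.
Proof. by move=> WY WZ gS; have [_ GP _] := Gp; apply: GP => //; apply: wide_ker. Qed.

(** An induction principle: [D] is a finite power of [Y], which inherits [Q] from [Y]. *)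
Lemma genby_surj Y X (Q : fgmod A -> Prop) : genby Y X ->
    (forall Z, zeroM Z -> Q Z) ->
    (forall D X Y (i1 : {linear X -> D}) (i2 : {linear Y -> D})
       (p1 : {linear D -> X}) (p2 : {linear D -> Y}),
       is_biprod i1 i2 p1 p2 -> Q X -> Q Y -> Q D) -> Q Y ->
  exists D (s : {linear D -> X}), Q D /\ surjective s.
Proof.
move=> [n [f fP]] Q0 QD QY.
have [D [s [QDD sP]]] := @family_sum K A Q n (fun=> Y) X f Q0 QD (fun=> QY).
exists D, s; split=> // x; have [y ->] := fP x.
have /choice[j jP] := sP; exists (\sum_k j k (y k)).
by rewrite linear_sum; apply: eq_bigr => k _; rewrite jP.
Qed.

Lemma genby0 X : (forall f : {linear G -> X}, forall x, f x = 0) -> W X -> zeroM X.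
Proof.
move=> f0 WX; have [_ _ Gg] := Gp; have [n [f fP]] := Gg X WX.
by move=> x; have [y ->] := fP x; apply: big1 => k _; apply: f0.
Qed.

(** Let [Y] generate [T]. A basis of Hom(G, Y) defines G -> Y^r, through which every map G -> Y
    factors; a map from G to an object of [T] lifts to a finite power of [Y], because G is
    projective in W. *)
Lemma left_approx_exists T : is_torsion_class W T -> fin_gen T -> exists E (a : {linear G -> E}), left_approx T a.
Proof.
move=> tT [Y TY TG]; have [r [h [hP _]]] := hom_basis G Y.
have [E [a [TE aP]]] := @family_prod T r (fun=> Y) G h (torsion_zero tT) (torsion_biprod tT) (fun=> TY).
exists E, a; split=> // X f TX.
pose Q D := T D /\ forall f : {linear G -> D}, exists g : {linear E -> D}, forall x, f x = g (a x).
have [| | |D [s [[TD DP] sS]]] := @genby_surj Y X Q (TG X TX).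
- move=> Z Z0; split; first exact: torsion_zero.
  by move=> u; exists (\0) => x; rewrite (Z0 (u x)).
- move=> D M N i1 i2 p1 p2 b [TM MP] [TN NP]; split; first exact: (torsion_biprod tT b).
  move=> u; have [g1 g1P] := MP (p1 \o u); have [g2 g2P] := NP (p2 \o u).
  exists ((i1 \o g1) \+ (i2 \o g2)) => x; rewrite /= -g1P -g2P /=.
  by case: b.
- split=> // u; have [c cP] := hP u; have /choice[j jP] := aP.
  exists (klin c j) => x; rewrite cP !klinE; apply: eq_bigr => k _; congr (_ *: _).
  by rewrite jP.
have [v vP] := progenerator_lift f (torsion_sub tT TD) (torsion_sub tT TX) sS.
have [g gP] := DP v; exists (s \o g) => x /=.
by rewrite -gP vP.
Qed.

(** If [E] has least dimension, an endomorphism [e] with e a = a is bijective, by the Fitting lemma.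
    Lifting [a] to [F] and extending the lift to [E] thus splits an epimorphism F -> E with kernel
    in [T]. For [C], a lift of [c] is corrected by a map into the kernel of F -> C until it vanishes
    on the image of [a]. *)
Lemma left_approx_minimal T : is_torsion_class W T -> fin_gen T ->
  exists E C (a : {linear G -> E}) (c : {linear E -> C}),
  [/\ left_approx T a, T C, surjective c, forall e, c e = 0 <-> exists x, a x = e & ext_projective T E /\ ext_projective T C].
Proof.
move=> tT /(left_approx_exists tT) ex.
have [E [a la] Emin] := @fgmod_min (fun E => exists a : {linear G -> E}, left_approx T a) ex.
have [WG _ _] := Gp; have [TE aP] := la; have WE := torsion_sub tT TE.
have [C [c [WC cS cP]]] := wide_cok Ww a WG WE.
have TC : T C by exact: torsion_quo cS TE WC.
exists E, C, a, c.
have XE : ext_projective T E.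
  apply: ext_projective_split => // F q WF qS qT; have TF : T F by exact: torsion_ext qS qT TE.
  have [u uP] := progenerator_lift a WF WE qS.
  have [b bP] := aP F u TF.
  pose e := q \o b; have ea x : e (a x) = a x by rewrite /e /= -bP uP.
  have [n [X [i [r [ri iP]]]]] := fitting e.
  have ena m x : epow e m (a x) = a x by elim: m => //= m ->; exact: ea.
  have iS : surjective i.
    apply: inj_surj; first by move=> x y /(congr1 r); rewrite !ri.
    apply: Emin; exists (r \o a); split.
      apply: (torsion_quo tT (p := r)) => //; first by move=> x; exists (i x).
      exact: wide_retract ri WE.
    move=> Z f TZ; have [g gP] := aP Z f TZ; exists (g \o i) => x /=.
    rewrite gP; congr (g _).
    have [y yE] : exists y, i y = a x by apply/iP; exists (a x).
    by rewrite -yE ri.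
  have eS : surjective e.
    move=> y; have /iP[z <-] : exists x, i x = y by exact: iS.
    by exists (epow e n z).
  have [d dK Kd] := inv_lin (endo_surj eS) eS.
  by exists (b \o d) => x; rewrite /= -[RHS]Kd.
split=> //; split=> //; apply: ext_projective_split => // F q WF qS qT.
have [v vP] := XE F C q WF WC qS qT c.
have [N [i [TN iI iP]]] := qT.
have [|x xP] := factor_inj (f := v \o a) iI.
  by move=> u; apply/iP; rewrite /= vP; apply/cP; exists u.
have [g gP] := aP N x TN.
have [|s sP] := factor_surj (f := v \- (i \o g)) cS.
  by move=> e /cP[y <-] /=; rewrite -gP xP subrr.
exists s => y; have [e <-] := cS y; rewrite sP /= linearB vP.
by have -> : q (i (g e)) = 0; [apply/iP; exists (g e)|rewrite subr0].
Qed.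

End Approx.
End InWide.
End Torsion.

(** * Covers of torsion classes *)

Lemma finite_maximal d (L : porderType d) (P : L -> Prop) :
    finite_set [set: L] -> (exists x, P x) ->
  exists2 m, P m & forall x, P x -> (m <= x)%O -> x = m.
Proof.
move=> /finite_seqP[s sP] [x0 Px0].
have ins x : x \in s by have : [set: L] x by []; rewrite sP.
pose mu x := count (fun y => (x <= y)%O) s.
pose ok n := `[< exists2 x, P x & mu x = n >].
have ex : exists n, ok n by exists (mu x0); apply/asboolP; exists x0.
have [_ /asboolP[m Pm <-] mmin] := ex_minnP ex.
exists m => // x Px mx; apply/eqP; rewrite eq_sym; apply: contraT => nmx.
have : (mu m <= mu x)%N by apply: mmin; apply/asboolP; exists x.
have mux : (mu x < mu m)%N; last by rewrite leqNgt mux.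
have xm : ~~ (x <= m)%O by apply: contra nmx => xm; rewrite eq_le mx xm.
pose a := fun y => (x <= y)%O; pose b := fun y => (m <= y)%O && ~~ (x <= y)%O.
have := count_predUI a b s.
rewrite (@eq_count _ (predI a b) pred0) ?count_pred0 ?addn0; last first.
  by move=> y; rewrite /a /b /=; case: (x <= y)%O; rewrite ?andbF.
rewrite (@eq_count _ (predU a b) (fun y => m <= y)%O); last first.
  by move=> y; rewrite /a /b /=; case: (boolP (x <= y)%O) => [/(le_trans mx) ->|_]; rewrite ?andbT.
rewrite -/(mu m) -/(mu x) => ->; rewrite -[X in (X < _)%N]addn0 ltn_add2l.
by rewrite -has_count; apply/hasP; exists m => //; rewrite /b lexx.
Qed.

(** * Resolutions by Ext-projectives, and labels of covers *)

Section Resolution.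
Variables (K : fieldType) (A : falgType K) (W : set (fgmod A)).
Hypothesis Ww : is_wide W.
Implicit Types (T U V : set (fgmod A)) (M N X Y Z D E C S P Q F G I J L R : fgmod A).

(** The pushout of the kernel inclusion N -> D along N -> Z, built as the quotient of [D] by the
    kernel of [p]. *)
Lemma pushdown D X N Z (g : {linear D -> X}) (i : {linear N -> D}) (p : {linear N -> Z}) :
    W D -> W N -> W Z -> injective i -> (forall x, g x = 0 <-> exists n, i n = x) -> surjective p ->
  exists Y (w : {linear D -> Y}) (w' : {linear Y -> X}) (j : {linear Z -> Y}),
  [/\ W Y, surjective w, forall x, w' (w x) = g x, forall n, j (p n) = w (i n)
    & injective j /\ forall y, w' y = 0 <-> exists z, j z = y].
Proof.
move=> WD WN WZ iI iP pS; have [L [l [WL lI lP]]] := wide_ker Ww p WN WZ.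
have [Y [w [WY wS wP]]] := wide_cok Ww (i \o l) WL WD.
have gi n : g (i n) = 0 by apply/iP; exists n.
have [|w' w'P] := factor_surj (f := g) wS.
  by move=> d /wP[x <-]; exact: gi.
have [|j jP] := factor_surj (f := w \o i) pS.
  by move=> n /lP[x <-]; apply/wP; exists x.
exists Y, w, w', j; split=> //; split.
  apply/lin_inj => z; have [n <-] := pS z.
  by rewrite jP => /wP[x /iI <-]; apply/lP; exists x.
move=> y; split=> [|[z <-]]; last first.
  by have [n <-] := pS z; rewrite jP /= w'P.
have [d <-] := wS y; rewrite w'P => /iP[n <-].
by exists (p n); rewrite jP.
Qed.

(** [P] is a sum of copies of the minimal approximation [E] of G and of its cokernel [C], one for
    each element of bases of Hom(E, X) and Hom(C, X). All maps from [E] and [C] to [X] then lift to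
    [P], which forces the torsion-free quotient [Z] of the kernel to vanish. *)
Lemma resolution G T X : progenerator W G -> is_torsion_class W T -> fin_gen T -> T X ->
  exists P (g : {linear P -> X}), [/\ T P, ext_projective W T P, surjective g & kernel_in T g].
Proof.
move=> Gp tT cT TX; have [E [C [a [c [[TE aP] TC cS cP [XE XC]]]]]] := left_approx_minimal Ww Gp tT cT.
have [r1 [h1 [h1P _]]] := hom_basis E X; have [r2 [h2 [h2P _]]] := hom_basis C X.
pose Q Z := T Z /\ ext_projective W T Z.
have Q0 Z : zeroM Z -> Q Z by move=> Z0; split; [exact: (torsion_zero Ww tT)|exact: ext_projective_zero].
have QD D M N (i1 : {linear M -> D}) (i2 : {linear N -> D})
    (p1 : {linear D -> M}) (p2 : {linear D -> N}) :
    is_biprod i1 i2 p1 p2 -> Q M -> Q N -> Q D.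
  move=> b [TM XM] [TN XN]; split; first exact: (torsion_biprod tT b).
  exact: (ext_projective_biprod b).
have QE : Q E by []. have QC : Q C by [].
have [D1 [s1 [QD1 s1P]]] := @family_sum K A Q r1 (fun=> E) X h1 Q0 QD (fun=> QE).
have [D2 [s2 [QD2 s2P]]] := @family_sum K A Q r2 (fun=> C) X h2 Q0 QD (fun=> QC).
have [D [i1 [i2 [p1 [p2 b]]]]] := biprod D1 D2.
have [TD XD] := QD _ _ _ _ _ _ _ b QD1 QD2.
pose g : {linear D -> X} := (s1 \o p1) \+ (s2 \o p2).
have [b1 b2 b3 b4 b5] := b.
have liftE (u : {linear E -> X}) : exists v : {linear E -> D}, forall x, g (v x) = u x.
  have [k kP] := h1P u; have /choice[j jP] := s1P.
  exists (i1 \o klin k j) => x; rewrite /g /= b1 b2 linear0 addr0 kP !klinE linear_sum.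
  apply: eq_bigr => l _; by rewrite linearZ /= jP.
have liftC (u : {linear C -> X}) : exists v : {linear C -> D}, forall x, g (v x) = u x.
  have [k kP] := h2P u; have /choice[j jP] := s2P.
  exists (i2 \o klin k j) => x; rewrite /g /= b3 b4 linear0 add0r kP !klinE linear_sum.
  apply: eq_bigr => l _; by rewrite linearZ /= jP.
have WX := torsion_sub tT TX; have WD := torsion_sub tT TD.
have [_ _ Gg] := Gp.
have gS : surjective g.
  have [n [f fP]] := Gg X WX.
  have /choice[k kP] : forall l, exists k : {linear E -> X}, forall x, f l x = k (a x).
    by move=> l; exact: aP.
  have /choice[v vP] : forall l, exists v : {linear E -> D}, forall x, g (v x) = k l x.
    by move=> l; exact: liftE.
  move=> x; have [y ->] := fP x; exists (\sum_l v l (a (y l))).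
  by rewrite linear_sum; apply: eq_bigr => l _; rewrite vP kP.
exists D, g; split=> //.
have [N [i [WN iI iP]]] := wide_ker Ww g WD WX.
have [Z [p [WZ pS pT Zf]]] := torsion_quotient Ww tT WN.
suff Z0 : zeroM Z by exists N, i; split=> //; apply: (torsion_ext tT pS pT); exact: (torsion_zero Ww tT).
have [Y [w [w' [j [WY wS ww jp [jI jP]]]]]] := pushdown WD WN WZ iI iP pS.
(* A map [x : G -> Z] is zero: j x extends along [a] to [y : E -> Y]. The map that w' y induces on
   [C] lifts to [D]; subtracting this lift from [y] leaves a map from [E], in [T], to the
   torsion-free [Z], which vanishes. So j x factors through c a = 0. *)
apply: (genby0 Gp) => // x y0.
have [y yP] := aP Y (j \o x) (torsion_quo tT wS TD WY).
have w'j z : w' (j z) = 0 by apply/jP; exists z.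
have [|cc ccP] := factor_surj (f := w' \o y) cS.
  by move=> e /cP[u <-] /=; rewrite -yP /= w'j.
have [c' c'P] := liftC cc.
have [|y2 y2P] := factor_inj (f := y \- (w \o c' \o c)) jI.
  by move=> e; apply/jP; rewrite /= linearB ww c'P ccP /= subrr.
apply: jI; rewrite linear0 -[LHS]/((j \o x) y0) yP.
have /esym/eqP := y2P (a y0); rewrite (Zf _ y2 TE) linear0 /= subr_eq0 => /eqP ->.
by have -> : c (a y0) = 0 by [apply/cP; exists y0]; rewrite !linear0.
Qed.

Definition tcover U T := [/\ is_torsion_class W U, is_torsion_class W T, U `<=` T, ~ (T `<=` U)
  & forall V, is_torsion_class W V -> U `<=` V -> V `<=` T -> V `<=` U \/ T `<=` V].

(** For a cover U < T this is the brick of the cover. *)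
Definition label U T S := [/\ T S, ~ U S & forall Y, T Y -> ~ U Y -> (fgdim S <= fgdim Y)%N].

Lemma label_exists U T : ~ (T `<=` U) -> exists S, label U T S.
Proof.
move=> TU; have [|S [TS US] Smin] := @fgmod_min _ _ (fun S => T S /\ ~ U S).
  by apply: contrapT => h; apply: TU => X TX; apply: contrapT => UX; apply: h; exists X.
by exists S; split=> // Y TY UY; apply: Smin.
Qed.

Section Cover.
Variables (U T : set (fgmod A)) (S : fgmod A).
Hypotheses (UT : tcover U T) (Sl : label U T S).

Let tU : is_torsion_class W U. Proof. by case: UT. Qed.
Let tT : is_torsion_class W T. Proof. by case: UT. Qed.
Let sUT : U `<=` T. Proof. by case: UT. Qed.
Let TS : T S. Proof. by case: Sl. Qed.
Let WS : W S. Proof. exact: torsion_sub tT _ TS. Qed.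

Lemma label_nonzero : exists x : S, x <> 0.
Proof.
apply: contrapT => h; have [_ US _] := Sl; apply: US; apply: (torsion_zero Ww tU).
by move=> x; apply: contrapT => x0; apply: h; exists x.
Qed.

Lemma label_quo Y (p : {linear S -> Y}) : surjective p -> W Y -> injective p \/ U Y.
Proof.
move=> pS WY; have [_ US Smin] := Sl; have [UY|UY] := pselect (U Y); [by right|left].
apply: (surj_inj pS); apply: Smin => //; exact: (torsion_quo tT pS TS WY).
Qed.

(** By minimality, proper quotients of [S] in W lie in [U]. If the torsion-free quotient of [S] were
    proper, [S] would be an extension of two objects of [U]. *)
Lemma label_tfree : tfree U S.
Proof.
have [Y [p [WY pS pU Yf]]] := torsion_quotient Ww tU WS.
have [pI|UY] := label_quo pS WY; first exact: tfree_sub pI Yf.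
by have [_ US _] := Sl; case: US; exact: (torsion_ext tU pS pU UY).
Qed.

Lemma label_surj Z (f : {linear Z -> S}) : T Z -> (exists z, f z <> 0) -> surjective f.
Proof.
move=> TZ [z0 fz0]; have [X [c [i [WX cS iI icE]]]] := wide_image Ww f (torsion_sub tT TZ) WS.
have TX : T X by exact: (torsion_quo tT cS TZ WX).
have [_ _ Smin] := Sl.
have iS : surjective i.
  apply: inj_surj iI (Smin _ TX _) => UX; apply: fz0.
  by rewrite -icE; apply: label_tfree.
by move=> y; have [x <-] := iS y; have [z <-] := cS x; exists z.
Qed.

(** The objects of [T] without nonzero maps to [S] form a torsion class that contains [U] and misses
    [S]; nothing lies strictly between [U] and [T]. *)
Lemma label_perp X : U X <-> T X /\ forall (f : {linear X -> S}) x, f x = 0.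
Proof.
split=> [UX|]; first by split=> [|f]; [exact: sUT|exact: label_tfree].
pose V := fun Y => T Y /\ forall X (f : {linear Y -> X}), X = S -> forall y, f y = 0.
have tV : is_torsion_class W V by exact: (torsion_class_perp Ww (fun X => X = S) tT).
have [_ _ _ _ /(_ V tV) h] := UT; case: h.
- by move=> Y UY; split=> [|M f MS]; [exact: sUT|move: f; rewrite MS => f; exact: label_tfree].
- by move=> Y [].
- by move=> VU [TX Xf]; apply: VU; split=> // M f MS; move: f; rewrite MS.
- move=> /(_ _ TS) [_ /(_ S idfun erefl) S0]; have [x x0] := label_nonzero.
  by case: x0; exact: S0.
Qed.

(** Dually, the objects of [T] without nonzero maps to any such [X] form a torsion class that
    contains [U] and [S], so it is [T]. *)
Lemma label_gen X : tfree U X -> (forall (f : {linear S -> X}) x, f x = 0) -> tfree T X.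
Proof.
move=> Uf Sf.
pose R X := tfree U X /\ forall (f : {linear S -> X}) x, f x = 0.
pose V := fun Y => T Y /\ forall X (f : {linear Y -> X}), R X -> forall y, f y = 0.
have tV : is_torsion_class W V by exact: (torsion_class_perp Ww R tT).
have [_ _ _ _ /(_ V tV) h] := UT; case: h.
- by move=> Y UY; split=> [|M f [Mf _]]; [exact: sUT|exact: Mf].
- by move=> Y [].
- move=> VU; have [_ US _] := Sl; case: US; apply: VU; split=> // M f [_ Mf]; exact: Mf.
- by move=> TV Z f /TV[_ Zf] z; apply: Zf.
Qed.

Lemma label_endo (e : {linear S -> S}) : (exists x, e x <> 0) -> injective e /\ surjective e.
Proof. by move=> /(label_surj TS) eS; split=> //; exact: endo_surj. Qed.

(** Push the kernel [N] out along its torsion-free quotient [F], giving 0 -> F -> E -> S with [E] in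
    [T]. By [label_gen] there is a nonzero map S -> E. It cannot land in [F], so it splits the
    sequence because [S] is a brick. Then [F] is a quotient of [E], hence in [T], and torsion-free,
    hence zero. *)
Lemma label_kernel Y (f : {linear Y -> S}) : T Y -> (exists z, f z <> 0) -> kernel_in T f.
Proof.
move=> TY [y0 fy0]; have WY := torsion_sub tT TY.
have [N [i [WN iI iP]]] := wide_ker Ww f WY WS.
have [F [p [WF pS pT Ff]]] := torsion_quotient Ww tT WN.
suff F0 : zeroM F by exists N, i; split=> //; apply: (torsion_ext tT pS pT); exact: (torsion_zero Ww tT).
have [E [w [f' [j [WE wS wf jp [jI jP]]]]]] := pushdown WY WN WF iI iP pS.
have TE : T E by exact: (torsion_quo tT wS TY WE).
have Euf : tfree U E.
  move=> V v UV z.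
  have [|v' v'P] := factor_inj (f := v) jI.
    by move=> u; apply/jP; apply: (label_tfree (f' \o v)).
  by rewrite -v'P (Ff _ v' (sUT UV)) linear0.
have [s [x0 sx0]] : exists (s : {linear S -> E}) x, s x <> 0.
  apply: contrapT => h; apply: fy0; rewrite -wf.
  have Ef : tfree T E.
    apply: label_gen => // g x; apply: contrapT => gx; apply: h; by exists g, x.
  by have -> : w y0 = 0; [exact: (Ef E idfun TE (w y0))|rewrite linear0].
have [fsI fsS] : injective (f' \o s) /\ surjective (f' \o s).
  apply: label_endo; apply: contrapT => h; apply: sx0.
  have [|s' s'P] := factor_inj (f := s) jI.
    by move=> u; apply/jP; apply: contrapT => fsu; apply: h; exists u.
  by rewrite -s'P (Ff _ s' TS) linear0.
have [b bK Kb] := inv_lin fsI fsS.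
have [|q qP] := factor_inj (f := idfun \- (s \o b \o f')) jI.
  by move=> e; apply/jP; rewrite /= linearB /= -[X in _ - X]/((f' \o s) (b (f' e))) Kb subrr.
have qj z : q (j z) = z.
  apply: jI; rewrite qP /=.
  have -> : f' (j z) = 0 by apply/jP; exists z.
  by rewrite !linear0 addr0.
have TF : T F by apply: (torsion_quo tT (p := q)) => // z; exists (j z).
by move=> z; apply: (Ff F idfun TF).
Qed.

Section Generator.
Variables (M : fgmod A) (pi : {linear M -> S}).
Hypotheses (Mi : indecomposable M) (TM : T M) (XM : ext_projective W T M) (pi0 : exists x, pi x <> 0).

Lemma cover_lift Q Y (rho : {linear Q -> S}) (sigma : {linear Y -> S}) :
  ext_projective W T Q -> T Y -> (exists y, sigma y <> 0) ->
  exists c : {linear Q -> Y}, forall x, sigma (c x) = rho x.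
Proof.
move=> XQ TY s0; apply: XQ => //; first exact: torsion_sub tT _ TY.
  exact: label_surj.
exact: label_kernel.
Qed.

(** Lifting [pi] along pi e produces [c] with pi e c = pi, and [indec_endo] applies to e c. *)
Lemma cover_endo (e : {linear M -> M}) : (exists x, pi (e x) <> 0) -> injective e /\ surjective e.
Proof.
move=> e0; have [c cP] := cover_lift (sigma := pi \o e) pi XM TM e0.
have [_ ecS] := indec_endo (e := e \o c) Mi pi0 cP.
have eS : surjective e by move=> y; have [x <-] := ecS y; exists (c x).
by split=> //; exact: endo_surj.
Qed.

(** The smallest Ext-projective resolution [P] of [X] in [T] lies in [U]. Otherwise [P] has a
    nonzero map [sigma] to [S], which stays nonzero on the kernel of [g] since Hom(X, S) = 0.
    Lifting [pi] along its restriction, and [sigma] along [pi], makes [M] a summand of [P] inside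
    that kernel; the complement is a smaller resolution. *)
Lemma cover_gen X : fin_gen T -> forall G, progenerator W G -> U X ->
  exists P (g : {linear P -> X}), [/\ U P, ext_projective W T P & surjective g].
Proof.
move=> cT G Gp UX; have TX := sUT UX; have WX := torsion_sub tT TX.
have ex : exists P, T P /\ ext_projective W T P /\ exists g : {linear P -> X}, surjective g /\ kernel_in T g.
  by have [P [g [TP XP gS gT]]] := resolution Gp tT cT TX; exists P; do 2!split=> //; exists g.
have [P [TP [XP [g [gS gT]]]] Pmin] := fgmod_min ex.
exists P, g; split=> //; apply: contrapT => UP.
have [sigma [p0 sp0]] : exists (sigma : {linear P -> S}) x, sigma x <> 0.
  apply: contrapT => h; apply: UP; apply/label_perp; split=> // f x.
  by apply: contrapT => fx; apply: h; exists f, x.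
have [N [i [TN iI iP]]] := gT.
have gi n : g (i n) = 0 by apply/iP; exists n.
have si0 : exists n, (sigma \o i) n <> 0.
  apply: contrapT => h; have [|s' s'P] := factor_surj (f := sigma) gS.
    by move=> u /iP[n <-]; apply: contrapT => sn; apply: h; exists n.
  by apply: sp0; rewrite -s'P; have [/(_ UX)[_ ->]] := label_perp X.
have [k kP] := cover_lift pi XM TN si0.
have [b bP] := cover_lift sigma XP TM pi0.
have [eI eS] : injective (b \o i \o k) /\ surjective (b \o i \o k).
  by apply: (indec_endo (pi := pi)) => // x /=; rewrite bP; exact: kP.
have [d dK Kd] := inv_lin eI eS.
have ri x : (d \o b) ((i \o k) x) = x by rewrite /= -[RHS]dK.
have [P1 [kk [q bi]]] := retract_biprod ri; have [b1 b2 b3 b4 b5] := bi.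
have WP := torsion_sub tT TP.
have WP1 : W P1 by exact: (wide_retract Ww b4 WP).
have qS : surjective q by move=> y; exists (kk y).
have TP1 : T P1 by exact: (torsion_quo tT qS TP WP1).
have gE p : g (kk (q p)) = g p.
  by rewrite [in RHS](b5 p) linearD /= gi add0r.
have qI : injective q.
  apply: (surj_inj qS); apply: Pmin; split=> //.
  split; first exact: (ext_projective_retract b4 XP).
  exists (g \o kk); split; first by move=> x; have [p <-] := gS x; exists (q p); rewrite /= gE.
  have [N1 [i1 [WN1 i1I i1P]]] := wide_ker Ww (g \o kk) WP1 (torsion_sub tT TX).
  exists N1, i1; split=> //.
  have [|t tP] := factor_inj (f := q \o i) i1I.
    by move=> n; apply/i1P; rewrite /= gE gi.
  apply: (torsion_quo tT (p := t)) => // y.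
  have /iP[n nE] : g (kk (i1 y)) = 0 by apply/i1P; exists y.
  by exists n; apply: i1I; rewrite tP /= nE b4.
have [x0 px0] := pi0; apply: px0.
have -> : x0 = 0; last by rewrite linear0.
by rewrite -(ri x0); have -> : (i \o k) x0 = 0; [apply: qI; rewrite b2 linear0|rewrite linear0].
Qed.

End Generator.
End Cover.
End Resolution.

Section FiniteOrder.
Variables (d : Order.disp_t) (L : latticeType d).
Hypothesis Lf : finite_set [set: L].
Implicit Types x y u : L.

Lemma finite_minimal (P : L -> Prop) : (exists x, P x) ->
  exists2 m, P m & forall x, P x -> (x <= m)%O -> x = m.
Proof. exact: (@finite_maximal _ L^d P Lf). Qed.

Lemma lower_cover x y : (x < y)%O -> exists2 u, (x <= u)%O & covered_by u y.
Proof.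
move=> xy; have [|u [xu uy] um] := @finite_maximal _ L (fun u => (x <= u)%O /\ (u < y)%O) Lf.
  by exists x.
exists u => //; split=> // z /andP[uz zy]; have zu := um z (conj (le_trans xu (ltW uz)) zy) (ltW uz).
by move: uz; rewrite zu ltxx.
Qed.

Lemma upper_cover x y : (x < y)%O -> exists2 u, (u <= y)%O & covered_by x u.
Proof.
move=> xy; have [|u [xu uy] um] := @finite_minimal (fun u => (x < u)%O /\ (u <= y)%O).
  by exists y.
exists u => //; split=> // z /andP[xz zu]; have zE := um z (conj xz (le_trans (ltW zu) uy)) (ltW zu).
by move: zu; rewrite zE ltxx.
Qed.

End FiniteOrder.

(** * Rigid modules and finite generation of torsion classes *)

Section Rigid.
Variables (K : fieldType) (A : falgType K).
Implicit Types (T U V : set (fgmod A)) (M N X Y Z D E C S P Q F G I J R : fgmod A).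

Section SplitClass.
Variable W : set (fgmod A).
Hypothesis Ww : is_wide W.

(* For M, X in W this says that Ext^1(M, X') = 0 for every quotient X' of X   *)
(* in W; equivalently, Hom(X, tau_W M) = 0.                                   *)
Definition csplit M X := forall E (h : {linear X -> E}) (p : {linear E -> M}),
  W E -> surjective p -> (forall e, p e = 0 <-> exists x, h x = e) ->
  exists s : {linear M -> E}, forall m, p (s m) = m.

Lemma csplit_lift M X F F1 (h : {linear X -> F}) (q : {linear F -> F1}) (u : {linear M -> F1}) :
    W M -> W F -> W F1 -> csplit M X -> surjective q ->
    (forall e, q e = 0 <-> exists x, h x = e) ->
  exists v : {linear M -> F}, forall m, q (v m) = u m.
Proof.
move=> WM WF WF1 MX qS qP; have [E [p1 [p2 [WE pb]]]] := wide_pullback Ww q u WF WM WF1.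
have [|w [w1 w2]] := @pullback_map _ _ X E F M F1 q u p1 p2 h (\0) pb.
  by move=> x; rewrite linear0; apply/qP; exists x.
have [e1 e2 e3] := pb.
have [|s sP] := MX E w p2 WE (pullback_surj pb qS).
  move=> e; split=> [p2e|[x <-]]; last by rewrite w2.
  have [|x xE] := (qP (p1 e)).1; first by rewrite e1 p2e linear0.
  exists x; apply/eqP; rewrite -subr_eq0; apply/eqP.
  by apply: e3; rewrite linearB ?w1 ?w2 ?xE ?p2e /= subrr.
by exists (p1 \o s) => m /=; rewrite e1 sP.
Qed.

Definition rigid_perp M : set (fgmod A) := fun X => W X /\ csplit M X.

(** For an extension of [Y] by [N], the splitting is done in two stages: [Y] gives a section modulo
    the image of [N], and [csplit_lift] for [N] lifts it. *)
Lemma rigid_perp_torsion M : W M -> is_torsion_class W (rigid_perp M).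
Proof.
move=> WM; apply: torsion_classI => //.
- by move=> X [].
- move=> Z Z0; split; first exact: wide_zero.
  move=> E h p WE pS hP; have pI : injective p.
    by apply/lin_inj => e /hP[x <-]; rewrite (Z0 x) linear0.
  by have [s sK Ks] := inv_lin pI pS; exists s.
- move=> X Y f fS [WX MX] WY; split=> // E h p WE pS hP.
  apply: (MX E (h \o f)) => // e; rewrite hP.
  by split=> [[y <-]|[x <-]]; [have [x <-] := fS y; exists x|exists (f x)].
- move=> E0 Y f fS fN [WY MY].
  have WE0 : W E0 by apply: wide_ext fS _ WY => //; apply: kernel_inW fN => Z [].
  split=> // F h p WF pS hP.
  have [N [i [[WN MN] iI iP]]] := fN.
  have [F1 [q [WF1 qS qP]]] := wide_cok Ww (h \o i) WN WF.
  have [|p1 p1P] := factor_surj (f := p) qS.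
    by move=> u /qP[n <-]; apply/hP; exists (i n).
  have [|h1 h1P] := factor_surj (f := q \o h) fS.
    by move=> u /iP[n <-]; apply/qP; exists n.
  have p1S : surjective p1 by move=> m; have [e <-] := pS m; exists (q e); rewrite p1P.
  have [|s1 s1P] := MY F1 h1 p1 WF1 p1S.
    move=> e; split=> [|[y <-]]; last first.
      have [x <-] := fS y; rewrite h1P /= p1P; apply/hP; by exists x.
    have [e' <-] := qS e; rewrite p1P => /hP[x <-].
    by exists (f x); rewrite h1P.
  have [s sP] := csplit_lift s1 WM WF WF1 MN qS qP.
  by exists s => m; rewrite -p1P sP.
Qed.

Lemma rigid_perp_ext_projective M : W M -> ext_projective W (rigid_perp M) M.
Proof.
move=> WM; apply: (ext_projective_split Ww) => // F q WF qS [N [i [[_ MN] iI iP]]].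
exact: (MN F i).
Qed.

Lemma ext_projective_csplit T M X : is_torsion_class W T -> W M -> ext_projective W T M -> T X -> csplit M X.
Proof.
move=> tT WM XM TX E h p WE pS hP.
apply: (XM E M p WE WM pS _ idfun).
have [I [c [i [WI cS iI icE]]]] := wide_image Ww h (torsion_sub tT TX) WE.
exists I, i; split=> //; first exact: (torsion_quo tT cS TX WI).
move=> e; rewrite hP; split=> [[x <-]|[y <-]]; first by exists (c x); rewrite icE.
by have [x <-] := cS y; exists x; rewrite icE.
Qed.

(** Closure under extensions is a horseshoe argument: maps from [P] that generate the quotient lift
    to [E], as [P] is Ext-projective, and generate [E] together with those that generate the
    kernel. *)
Lemma Gen1_torsion T P : is_torsion_class W T -> T P -> ext_projective W T P ->
  is_torsion_class W (Gen W [set P]) /\ Gen W [set P] `<=` T.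
Proof.
move=> tT TP XP.
have GT : Gen W [set P] `<=` T by move=> X /Gen1E[WX]; exact: (torsion_genby Ww tT TP).
split=> //; apply: torsion_classI => //.
- by move=> X [].
- move=> Z Z0; apply/Gen1E; split; first exact: wide_zero.
  exists 0%N, (fun=> \0) => z; exists (fun=> 0); rewrite big_ord0; exact: Z0.
- move=> X Y p pS /Gen1E[WX [n [f fP]]] WY; apply/Gen1E; split=> //.
  exists n, (fun k => p \o f k) => y; have [x <-] := pS y; have [z ->] := fP x.
  by exists z; rewrite linear_sum.
- move=> E Y p pS pN /[dup] /GT TY /Gen1E[WY [n [f fP]]].
  have WE : W E by apply: wide_ext pS _ WY => //; apply: kernel_inW pN => Z [].
  have pT : kernel_in T p by exact: kernel_inW pN.
  have /choice[f' f'P] : forall k, exists f' : {linear P -> E}, forall x, p (f' x) = f k x.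
    by move=> k; apply: XP.
  have [N [i [/Gen1E[WN [m [g gP]]] iI iP]]] := pN.
  apply/Gen1E; split=> //; exists (n + m)%N.
  exists (fun k : 'I_(n + m) => match fintype.split k with inl a => f' a | inr b => i \o g b end).
  move=> x; have [y yP] := fP (p x).
  have [|l lP] := (iP (x - \sum_k f' k (y k))).1.
    rewrite linearB linear_sum yP; apply/eqP; rewrite subr_eq0; apply/eqP.
    by apply: eq_bigr => k _; rewrite f'P.
  have [z zP] := gP l.
  exists (fun k : 'I_(n + m) => match fintype.split k with inl a => y a | inr b => z b end).
  rewrite big_split_ord /=.
  under eq_bigr => a _ do rewrite (unsplitK (inl a : 'I_n + 'I_m)).
  under [X in _ + X]eq_bigr => a _ do rewrite (unsplitK (inr a : 'I_n + 'I_m)).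
  by rewrite /= -linear_sum -zP lP addrC subrK.
Qed.

End SplitClass.

Section Good.
Variable W : wide A.
Let Ww : is_wide W := wideP W.
Implicit Types j u v : tors W.

Definition mktors T (h : is_torsion_class W T) : tors W := Tors (asboolT h).

Lemma letE u v : (u <= v)%O <-> (u : set (fgmod A)) `<=` v.
Proof. by rewrite le_torsE; split=> [/asboolP|?]; last exact/asboolP. Qed.

Lemma torsset_inj u v : (u : set (fgmod A)) = v -> u = v.
Proof. exact: val_inj. Qed.

Lemma lttE u v : (u < v)%O <-> (u : set (fgmod A)) `<=` v /\ ~ (v : set (fgmod A)) `<=` u.
Proof.
rewrite lt_leAnge; split=> [/andP[/letE uv /negP vu]|[uv vu]].
  by split=> // /letE.
by apply/andP; split; [exact/letE|apply/negP => /letE].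
Qed.

Lemma covered_tcover u v : covered_by u v <-> tcover W u v.
Proof.
split=> [[/lttE[uv vu] uzv]|[tu tv uv vu h]].
  split=> //; [exact: torsP|exact: torsP|move=> V tV uV Vv].
  have [Vu|Vu] := pselect (V `<=` u); first by left.
  right; apply: contrapT => vV; apply: (uzv (mktors tV)).
  by apply/andP; split; apply/lttE.
split; first exact/lttE.
move=> z /andP[/lttE[uz zu] /lttE[zv vz]].
by have [] := h z (torsP z) uz zv.
Qed.

Hypothesis Wf : finite_set [set: tors W].
Variable G : fgmod A.
Hypothesis Gp : progenerator W G.

Lemma nonzero_part S P (sigma : {linear P -> S}) X :
  (exists x, sigma x <> 0) -> genby X P ->
  exists f : {linear X -> P}, exists x, sigma (f x) <> 0.
Proof.
move=> [x0 sx0] [n [f fP]]; apply: contrapT => h; apply: sx0.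
have [y ->] := fP x0; rewrite linear_sum; apply: big1 => k _.
by apply: contrapT => sf; apply: h; exists (f k), (y k).
Qed.

(** An Ext-projective of least dimension with a nonzero map to [S] is indecomposable: the map is
    nonzero on one of two summands, and by minimality that summand is everything. *)
Lemma cover_projective U T S : tcover W U T -> label U T S -> fin_gen T ->
  exists Q (pi : {linear Q -> S}), [/\ indecomposable Q, T Q, ext_projective W T Q & exists x, pi x <> 0].
Proof.
move=> UT Sl cT; have [tU tT sUT _ _] := UT; have [TS _ _] := Sl.
have [s0 s00] := label_nonzero Ww UT Sl.
pose ok Q := T Q /\ ext_projective W T Q /\ exists (pi : {linear Q -> S}) x, pi x <> 0.
have ex : exists Q, ok Q.
  have [P [g [TP XP gS gT]]] := resolution Ww Gp tT cT TS.
  exists P; do 2!split=> //; exists g; have [p pE] := gS s0; exists p; by rewrite pE.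
have [Q [TQ [XQ [pi pi0]]] Qmin] := fgmod_min ex.
exists Q, pi; split=> //; have [x0 px0] := pi0; split.
  by move=> Q0; apply: px0; rewrite (Q0 x0) linear0.
move=> X Y /prod_biprod[i1 [i2 [p1 [p2 b]]]]; have [b1 b2 b3 b4 b5] := b.
have WQ := torsion_sub tT TQ.
have half X' Y' (j1 : {linear X' -> Q}) (r1 : {linear Q -> X'}) (j2 : {linear Y' -> Q}) :
    (forall x, r1 (j1 x) = x) -> (forall x, r1 (j2 x) = 0) -> injective j2 ->
    (exists x, pi (j1 x) <> 0) -> zeroM Y'.
  move=> rj rj2 j2I pj y.
  have WX' : wideset W X' by exact: (wide_retract Ww rj WQ).
  have rS : surjective r1 by move=> x; exists (j1 x).
  have jS : surjective j1.
    apply: inj_surj; first by move=> x z /(congr1 r1); rewrite !rj.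
    apply: Qmin; split; first exact: (torsion_quo tT rS TQ WX').
    by split; [exact: ext_projective_retract rj XQ|exists (pi \o j1)].
  by have [x xE] := jS (j2 y); apply: j2I; rewrite linear0 -xE -[x]rj xE rj2 linear0.
have i1I : injective i1 by move=> x z /(congr1 p1); rewrite !b1.
have i2I : injective i2 by move=> x z /(congr1 p2); rewrite !b4.
have [p1x|p1x] := pselect (exists x, pi (i1 x) <> 0); first by right; exact: half b1 b3 i2I p1x.
left; apply: half b4 b2 i1I _; exists (p2 x0) => h; apply: px0.
rewrite (b5 x0) linearD h addr0; apply: contrapT => h'; apply: p1x; by exists (p1 x0).
Qed.

(** Finiteness of tors(W) bounds the generators: among the classes Gen P with [P] in u and
    Ext-projective in v, take a maximal one. Adding to [P] the module [R] that [cover_gen] provides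
    for [X] cannot enlarge it, so [P] already generates [X]. *)
Lemma fin_gen_cover u v : covered_by u v -> fin_gen v -> fin_gen u.
Proof.
move=> /covered_tcover uv cv; have [tu tv suv vu _] := uv.
have [S Sl] := label_exists vu.
have [Q [pi [Qi vQ XQ pi0]]] := cover_projective uv Sl cv.
pose ok (w : tors W) := exists P, [/\ torsset u P, ext_projective W v P & (w : set _) = Gen W [set P]].
have mk P : torsset u P -> ext_projective W v P -> exists w : tors W, (w : set _) = Gen W [set P].
  by move=> uP XP; have [tP _] := Gen1_torsion Ww tv (suv _ uP) XP; exists (mktors tP).
have [|w [P [uP XP wE]] wmax] := @finite_maximal _ _ ok Wf.
  have [Z Z0] := zero_exists A; have uZ := torsion_zero Ww tu Z0.
  have XZ : ext_projective W v Z by exact: ext_projective_zero.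
  by have [w wE] := mk Z uZ XZ; exists w, Z.
exists P => // X uX.
have [R [g [uR XR gS]]] := cover_gen Ww uv Sl Qi vQ XQ pi0 cv Gp uX.
have [D [i1 [i2 [p1 [p2 b]]]]] := biprod P R.
have uD := torsion_biprod tu b uP uR; have XD := ext_projective_biprod b XP XR.
have [w' w'E] := mk D uD XD.
have b' := b; have [b1 b2 b3 b4 b5] := b'.
have GD Y (p : {linear D -> Y}) : surjective p -> torsset v Y -> Gen W [set D] Y.
  move=> pS vY; apply/Gen1E; split; first exact: torsion_sub tv _ vY.
  exists 1%N, (fun=> p) => y; have [x <-] := pS y; by exists (fun=> x); rewrite big_ord1.
have [tD GDv] := Gen1_torsion Ww tv (suv _ uD) XD.
have ww' : w' = w.
  apply: wmax; first by exists D.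
  apply/letE; rewrite wE w'E => Y /Gen1E[WY PY]; apply: (torsion_genby Ww tD) WY PY.
  by apply: (GD _ p1); [move=> x; exists (i1 x)|exact: suv].
have : Gen W [set P] X; last by case/Gen1E.
rewrite -wE -ww' w'E; apply: (GD _ (g \o p2)); last exact: suv.
by move=> x; have [r <-] := gS x; exists (i2 r); rewrite /= b4.
Qed.

(** A minimal finitely generated class above [T] is [T] itself: otherwise it covers a class above
    [T], which is again finitely generated. *)
Lemma fin_gen_all T : is_torsion_class W T -> fin_gen T.
Proof.
move=> tT; pose t := mktors tT.
have tW : is_torsion_class W W by exact: torsion_class_top.
have [|v [tv cv] vmin] := @finite_minimal _ _ Wf (fun v => (t <= v)%O /\ fin_gen v).
  exists (mktors tW); split; first by apply/letE; exact: torsion_sub tT.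
  by have [WG _ Gg] := Gp; exists G.
have [tvE|ntv] := eqVneq t v; first by rewrite -[T]/(torsset t) tvE.
have /(lower_cover Wf)[u tu uv] : (t < v)%O by rewrite lt_neqAle ntv.
have := vmin u (conj tu (fin_gen_cover uv cv)) (ltW uv.1).
by move=> uE; have [] := uv; rewrite uE ltxx.
Qed.

End Good.
End Rigid.

(** * Join-irreducible torsion classes and rigid modules *)

Section JoinIrreducible.
Variables (K : fieldType) (A : falgType K).
Implicit Types (T U V : set (fgmod A)) (M N X Y Z D E C S P Q F I J R : fgmod A).
Variable W : wide A.
Let Ww : is_wide W := wideP W.
Implicit Types j u v : tors W.
Hypothesis Wf : finite_set [set: tors W].
Variable G : fgmod A.
Hypothesis Gp : progenerator W G.

Definition rigid M := wideset W M /\ csplit W M M.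

Lemma Gen_self M : wideset W M -> Gen W [set M] M.
Proof. by move=> WM; apply: (@subset_Gen K A W [set M]) => // _ ->. Qed.

Lemma rigid_Gen M : rigid M ->
  [/\ is_torsion_class W (Gen W [set M]), Gen W [set M] `<=` rigid_perp W M
    & ext_projective W (rigid_perp W M) M].
Proof.
move=> [WM MM]; have [] := Gen1_torsion Ww (rigid_perp_torsion Ww WM) (conj WM MM) (rigid_perp_ext_projective Ww WM).
by move=> tM MV; split=> //; exact: rigid_perp_ext_projective.
Qed.

Lemma rigid_Gen_ext_projective M : rigid M -> ext_projective W (Gen W [set M]) M.
Proof. by move=> /rigid_Gen[_ MV]; exact: ext_projectiveS. Qed.

Lemma Gen_nonzero M X : Gen W [set M] X -> (exists x : X, x <> 0) ->
  exists g : {linear M -> X}, exists x, g x <> 0.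
Proof. by move=> /Gen1E[WX MX] f0; exact: (nonzero_part (sigma := idfun)) f0 MX. Qed.

(** Both labels are quotients of [M]. Either map kills the kernel of the other: otherwise
    [cover_lift] and [indec_endo] give an automorphism of [M] with image in that kernel. So the
    labels are quotients of each other, hence isomorphic, and by [label_perp] a label determines its
    cover. *)
Lemma covers_eq M u1 u2 v : indecomposable M -> ext_projective W v M -> torsset v = Gen W [set M] ->
  wideset W M -> covered_by u1 v -> covered_by u2 v ->
  (u1 : set _) `<=` u2.
Proof.
move=> Mi XM vM WM /covered_tcover c1 /covered_tcover c2.
have [_ tv _ vu1 _] := c1; have [_ _ _ vu2 _] := c2.
have [S1 l1] := label_exists vu1; have [S2 l2] := label_exists vu2.
have vMM : torsset v M by rewrite vM; exact: Gen_self.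
have [[vS1 _ _] [vS2 _ _]] := (l1, l2).
have gen S : torsset v S -> (exists x : S, x <> 0) -> exists g : {linear M -> S}, exists x, g x <> 0.
  by rewrite vM; exact: Gen_nonzero.
have [pi1 p10] := gen _ vS1 (label_nonzero Ww c1 l1).
have [pi2 p20] := gen _ vS2 (label_nonzero Ww c2 l2).
have key u S (c : tcover W u v) (l : label u v S) (pi : {linear M -> S}) u' S' (c' : tcover W u' v)
    (l' : label u' v S') (pi' : {linear M -> S'}) : (exists x, pi x <> 0) -> (exists x, pi' x <> 0) ->
  exists phi : {linear S -> S'}, surjective phi.
  move=> p0 p'0; have piS := label_surj Ww c l vMM p0.
  have [N [i [vN iI iP]]] := label_kernel Ww c l vMM p0.
  have [|phi phiP] := factor_surj (f := pi') piS; last first.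
    exists phi => y; have [x <-] := label_surj Ww c' l' vMM p'0 y.
    by exists (pi x); rewrite phiP.
  move=> x /iP[n <-]; apply: contrapT => n0.
  have [cc ccP] := cover_lift (sigma := pi' \o i) Ww c' l' pi' XM vN (ex_intro _ n n0).
  have [_ eS] := indec_endo (e := i \o cc) Mi p'0 ccP.
  have [x1 px1] := p0; apply: px1; have [z <-] := eS x1; apply/iP; by exists (cc z).
have [phi phiS] := key _ _ c1 l1 pi1 _ _ c2 l2 pi2 p10 p20.
have [psi psiS] := key _ _ c2 l2 pi2 _ _ c1 l1 pi1 p20 p10.
have psiI : injective psi by exact: surj_inj psiS (surj_dim phiS).
move=> X /(label_perp Ww c1 l1)[vX X1]; apply/(label_perp Ww c2 l2); split=> // f x.
by apply: psiI; rewrite linear0; apply: (X1 (psi \o f)).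
Qed.

Lemma zero_tors : exists z : tors W, forall X, torsset z X <-> zeroM X.
Proof.
have tz : is_torsion_class W (fun X => zeroM X).
  apply: torsion_classI => //; first exact: wide_zero.
    by move=> X Y p pS X0 _ y; have [x <-] := pS y; rewrite (X0 x) linear0.
  move=> E Y p pS [N [i [N0 iI iP]]] Y0 e.
  by have /iP[n <-] := Y0 (p e); rewrite (N0 n) linear0.
by exists (mktors tz).
Qed.

Lemma rigid_lower M v : indecomposable M -> wideset W M -> torsset v = Gen W [set M] ->
  exists u, covered_by u v.
Proof.
move=> [M0 _] WM vM; have [z zP] := zero_tors.
have /(lower_cover Wf)[u _ uv] : (z < v)%O; last by exists u.
apply/lttE; split=> [X /zP X0|]; first exact: (torsion_zero Ww (torsP v) X0).
by move=> vz; apply: M0; apply/zP/vz; rewrite vM; exact: Gen_self.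
Qed.

Lemma rigid_cji M v : indecomposable M -> rigid M -> torsset v = Gen W [set M] -> cji v.
Proof.
move=> Mi Mr vM; have WM : wideset W M by case: Mr.
have XM : ext_projective W v M by rewrite vM; exact: rigid_Gen_ext_projective.
have [u uv] := rigid_lower Mi WM vM; exists u; split=> // u' u'v.
apply: torsset_inj; apply/seteqP; split; exact: (covers_eq Mi XM vM WM).
Qed.

(** [Q] is the Ext-projective attached to the cover u < v. If Gen Q were smaller than v, it would
    lie in u, the only element covered by v; but [Q] has a nonzero map to the label, which receives
    none from u. *)
Lemma cji_rigid v : cji v -> exists M, [/\ indecomposable M, rigid M & torsset v = Gen W [set M]].
Proof.
move=> [u [uv uu]]; have c := (covered_tcover u v).1 uv; have [tu tv suv vu _] := c.
have [S l] := label_exists vu; have cv := fin_gen_all Wf Gp tv.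
have [Q [pi [Qi vQ XQ pi0]]] := cover_projective Gp c l cv.
have WQ := torsion_sub tv vQ.
exists Q; split=> //; first by split=> //; exact: (ext_projective_csplit Ww tv WQ XQ vQ).
have [tQ Qv] := Gen1_torsion Ww tv vQ XQ; pose q := mktors tQ.
suff -> : v = q by [].
apply/eqP; apply: contraT => nvq.
have /(lower_cover Wf)[u' qu' u'v] : (q < v)%O by rewrite lt_neqAle eq_sym nvq; apply/letE.
have [x0 px0] := pi0; case: px0; apply: (label_tfree Ww c l).
by rewrite (uu _ u'v); move/letE: qu'; apply; exact: Gen_self.
Qed.

(** Both modules map onto the label of a lower cover of the common class. Lifting each of these maps
    along the other gives maps between [M] and [M'] whose two composites are automorphisms. *)
Lemma rigid_iso M M' : indecomposable M -> rigid M -> indecomposable M' -> rigid M' ->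
  Gen W [set M] = Gen W [set M'] -> isoM M M'.
Proof.
move=> Mi Mr Mi' Mr' GG; have [tM _ _] := rigid_Gen Mr; pose v := mktors tM.
have WM : wideset W M by case: Mr. have WM' : wideset W M' by case: Mr'.
have [u /covered_tcover c] := rigid_lower Mi WM (erefl : torsset v = _).
have [tu tv suv vu _] := c; have [S l] := label_exists vu.
have vM : torsset v M by exact: Gen_self.
have vM' : torsset v M' by rewrite /= GG; exact: Gen_self.
have XM : ext_projective W v M by exact: rigid_Gen_ext_projective.
have XM' : ext_projective W v M' by rewrite /= GG; exact: rigid_Gen_ext_projective.
have [vS _ _] := l; have [s0 s00] := label_nonzero Ww c l.
have [pi pi0] : exists g : {linear M -> S}, exists x, g x <> 0.
  by apply: Gen_nonzero => //; exists s0.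
have [pi' pi'0] : exists g : {linear M' -> S}, exists x, g x <> 0.
  by apply: Gen_nonzero; [rewrite -GG|exists s0].
have [a aP] := cover_lift Ww c l pi XM vM' pi'0.
have [b bP] := cover_lift Ww c l pi' XM' vM pi0.
have [baI baS] : injective (b \o a) /\ surjective (b \o a).
  by apply: (indec_endo Mi pi0) => x /=; rewrite bP aP.
have [abI abS] : injective (a \o b) /\ surjective (a \o b).
  by apply: (indec_endo Mi' pi'0) => x /=; rewrite aP bP.
apply/isoMP; exists a; first by move=> x y e; apply: baI; rewrite /= e.
by move=> y; have [x <-] := abS y; exists (b x).
Qed.

(* The j-label of u < v is the torsion class generated by a label S.          *)
Lemma j_label_exists u v : covered_by u v -> exists j, j_label u v j.
Proof.
move=> uv; have [/lttE[suv vu] _] := uv; have c := (covered_tcover u v).1 uv.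
have [S l] := label_exists vu; have [vS uS _] := l.
have tj : is_torsion_class W (\bigcap_(T in [set T | is_torsion_class W T /\ T S]) T).
  apply: torsion_class_bigcap => [|T []//]; exists (torsset v); split=> //; exact: torsP.
exists (mktors tj); split=> /=.
  apply/eqP; rewrite eq_le leUx; apply/andP; split.
    apply/andP; split; last exact: ltW uv.1.
    by apply/letE => X; apply; split=> //; exact: torsP.
  apply: contraT => nle; case: uv => _ /(_ (Order.join (mktors tj) u))[].
  have jv : (Order.join (mktors tj) u <= v)%O.
    rewrite leUx (ltW (proj2 (lttE _ _) (conj suv vu))) andbT.
    by apply/letE => X; apply; split=> //; exact: torsP.
  apply/andP; split; last by rewrite lt_leAnge jv.
  rewrite lt_neqAle leUr andbT; apply/eqP => uE; apply: uS; rewrite uE.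
  have /letE : (mktors tj <= Order.join (mktors tj) u)%O by exact: leUl.
  by apply=> T [].
move=> z zuv; apply/letE => X; apply; split; first exact: torsP.
have zv : (z : set _) `<=` v by apply/letE; rewrite -zuv leUl.
have zu : ~ (z : set _) `<=` u.
  move=> /letE/join_r uz; have uE := etrans (esym uz) zuv.
  by apply: vu; rewrite uE.
have [Y zY uY] : exists2 Y, torsset z Y & ~ torsset u Y.
  by apply: contrapT => h; apply: zu => Y zY; apply: contrapT => uY; apply: h; exists Y.
have [f f0] : exists (f : {linear Y -> S}), exists x, f x <> 0.
  apply: contrapT => h; apply: uY; apply/(label_perp Ww c l); split; first exact: zv.
  by move=> f x; apply: contrapT => fx; apply: h; exists f, x.
apply: (torsion_quo (torsP z) (p := f)) => //; last exact: torsion_sub (torsP v) _ vS.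
by apply: (label_surj Ww c l) => //; exact: zv.
Qed.

End JoinIrreducible.

(** * Reduction at a rigid module *)

Lemma range_ker (R : nzRingType) (X Y Z : lmodType R) (i : {linear X -> Y}) (f : {linear Y -> Z}) :
  range i = ker f -> forall y, f y = 0 <-> exists x, i x = y.
Proof.
move=> e y; split=> [fy|[x <-]]; last first.
  have : range i (i x) by exists x.
  by rewrite e.
have [x _ <-] : range i y by rewrite e.
by exists x.
Qed.

Section Perp.
Variables (K : fieldType) (A : falgType K).
Implicit Types (T U : set (fgmod A)) (M N X Y Z D E C S P Q F I R : fgmod A).
Variable W : wide A.
Let Ww : is_wide W := wideP W.
Implicit Types j u v : tors W.
Variable M : fgmod A.
Hypothesis Mr : rigid W M.
Let WM : wideset W M. Proof. by case: Mr. Qed.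
Local Notation T := (Gen W [set M]).
Local Notation V := (rigid_perp W M).
Let tT : is_torsion_class W T. Proof. by case: (rigid_Gen Mr). Qed.
Let TV : T `<=` V. Proof. by case: (rigid_Gen Mr). Qed.
Let XM : ext_projective W V M. Proof. by case: (rigid_Gen Mr). Qed.
Let tV : is_torsion_class W V. Proof. exact: rigid_perp_torsion. Qed.

Definition jasso : set (fgmod A) := fun X => V X /\ hom_zero M X.

Lemma tfree_Gen X : tfree T X <-> hom_zero M X.
Proof.
split=> [Xf f|M0 Y f /Gen1E[_ [n [g gP]]] y]; first exact: Xf _ f (Gen_self WM).
have [z ->] := gP y; rewrite linear_sum; apply: big1 => k _; exact: (M0 (f \o g k)).
Qed.

Lemma jasso_sub X Y (i : {linear X -> Y}) : injective i -> jasso Y -> V X -> jasso X.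
Proof.
move=> iI [_ Y0] VX; split=> // f x; apply: iI; rewrite linear0; exact: (Y0 (i \o f)).
Qed.

Lemma jasso_image X Y (f : {linear X -> Y}) : V X -> jasso Y ->
  exists I (c : {linear X -> I}) (i : {linear I -> Y}),
  [/\ jasso I, surjective c, injective i & forall x, i (c x) = f x].
Proof.
move=> VX JY; have [I [c [i [WI cS iI icE]]]] := wide_image Ww f (torsion_sub tV VX) (torsion_sub tV JY.1).
exists I, c, i; split=> //; apply: (jasso_sub iI JY); exact: (torsion_quo tV cS VX WI).
Qed.

Lemma jasso_cok X0 Y0 (f : {linear X0 -> Y0}) X (p : {linear Y0 -> X}) :
  jasso X0 -> jasso Y0 -> surjective p -> (forall y, p y = 0 <-> exists x, f x = y) -> jasso X.
Proof.
move=> [[WX0 MX0] _] [VY0 Y00] pS pP; have WY0 := torsion_sub tV VY0.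
have WX : wideset W X := wide_cokP Ww WX0 WY0 pS pP.
split=> [|u x]; first exact: (torsion_quo tV pS VY0 WX).
have [v vP] := csplit_lift Ww u WM WY0 WX MX0 pS pP.
by rewrite -vP Y00 linear0.
Qed.

(** [csplit] passes to quotients but not directly to submodules such as [X]. Push the sequence X ->
    E -> M out along X -> X0; the result [P] splits over [M] because [X0] satisfies [csplit]. The
    section lands in [E], since P / E is the image [I] of [f] and Hom(M, I) = 0. *)
Lemma jasso_ker X0 Y0 (f : {linear X0 -> Y0}) X (i : {linear X -> X0}) :
  jasso X0 -> jasso Y0 -> injective i -> (forall x, f x = 0 <-> exists y, i y = x) -> jasso X.
Proof.
move=> JX0 JY0 iI iP; have [[[WX0 MX0] _] [[WY0 _] _]] := (JX0, JY0).
have WX : wideset W X := wide_kerP Ww WX0 WY0 iI iP.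
apply: (jasso_sub iI JX0); split=> // E h p WE pS hP.
have ph x : p (h x) = 0 by apply/hP; exists x.
have [I [c [l [JI cS lI lcE]]]] := jasso_image f JX0.1 JY0.
have ci x : c (i x) = 0 by apply: lI; rewrite lcE linear0; apply/iP; exists x.
have [D [e1 [e2 [p1 [p2 b]]]]] := biprod E X0; have [b1 b2 b3 b4 b5] := b.
have WD := wide_biprod Ww b WE WX0.
have [P [q [WP qS qP]]] := wide_cok Ww ((e1 \o h) \- (e2 \o i)) WX WD.
have [|p' p'P] := factor_surj (f := p \o p1) qS.
  by move=> u /qP[x <-] /=; rewrite !linearB b1 b3 ph linear0 subrr.
have [|r rP] := factor_surj (f := c \o p2) qS.
  by move=> u /qP[x <-] /=; rewrite !linearB b2 b4 ci linear0 subrr.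
have qrel x : q (e1 (h x)) = q (e2 (i x)).
  by apply/eqP; rewrite -subr_eq0 -linearB; apply/eqP/qP; exists x.
have qe1I : injective (q \o e1).
  apply/lin_inj => e /= /qP[x /= xE].
  have := congr1 p2 xE; rewrite linearB b2 b4 b2 sub0r => /eqP; rewrite oppr_eq0 => /eqP ix.
  have x0 : x = 0 by apply: iI; rewrite ix linear0.
  by have := congr1 p1 xE; rewrite x0 linearB !b1 b3 linear0 subr0 => <-; rewrite ?linear0.
have [||s sP] := MX0 P (q \o e2) p' WP.
- by move=> m; have [e <-] := pS m; exists (q (e1 e)); rewrite p'P /= b1.
- move=> d; split=> [|[x <-]]; last by rewrite /= p'P /= b3 linear0.
  have [d' <-] := qS d; rewrite p'P /= => /hP[x xE].
  exists (i x + p2 d'); rewrite /= 2!linearD -qrel [d' in RHS]b5 linearD -xE.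
  by rewrite -linearD.
have rs m : r (s m) = 0 by exact: (JI.2 (r \o s)).
have [|t tP] := factor_inj (f := s) qe1I.
  move=> m; have [d dE] := qS (s m).
  have : f (p2 d) = 0 by rewrite -lcE -[c _]/((c \o p2) d) -rP dE rs linear0.
  move=> /iP[x xE]; exists (p1 d + h x); rewrite /= linearD linearD qrel -dE [d in RHS]b5 linearD.
  by rewrite xE.
exists t => m; rewrite -[RHS]sP -tP /= p'P /= b1 //.
Qed.

Lemma jasso_wide : is_wide jasso.
Proof.
split.
- have [Z Z0] := zero_exists A; exists Z; split; first exact: (torsion_zero Ww tV).
  by move=> f x; rewrite (Z0 (f x)).
- by move=> X0 Y0 f X i JX0 JY0 [iI /range_ker]; exact: jasso_ker.
- move=> X0 Y0 f X p JX0 JY0 [/surjectiveE pS pP]; apply: (jasso_cok JX0 JY0 pS).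
  exact: range_ker (esym pP).
- apply/ext_closedE => E Y p pS pN [VY Y0].
  have VE : V E by apply: (torsion_ext tV pS _ VY); apply: kernel_inW pN => X [].
  split=> // u x; have [N [i [[_ N0] iI iP]]] := pN.
  have [|v vP] := factor_inj (f := u) iI.
    by move=> z; apply/iP; exact: (Y0 (p \o u)).
  by rewrite -vP N0 linear0.
Qed.

Lemma jquotient X : V X -> exists Y (p : {linear X -> Y}),
  [/\ jasso Y, surjective p & kernel_in T p].
Proof.
move=> VX; have [Y [p [WY pS pT Yf]]] := torsion_quotient Ww tT (torsion_sub tV VX).
exists Y, p; split=> //; split; first exact: (torsion_quo tV pS VX WY).
exact/tfree_Gen.
Qed.

Variable J : wide A.
Hypothesis JE : wideset J = jasso.
Let Jw : is_wide J := wideP J.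
Let JW : J `<=` W. Proof. by rewrite JE => X [[]]. Qed.
Let JV : J `<=` V. Proof. by rewrite JE => X []. Qed.

Lemma restrict_torsion U : is_torsion_class W U -> is_torsion_class J (U `&` J).
Proof.
move=> tU; apply: torsion_classI => //.
- move=> Z Z0; split; [exact: (torsion_zero Ww tU)|exact: wide_zero].
- move=> X Y p pS [UX JX] JY; split=> //; exact: (torsion_quo tU pS UX (JW JY)).
- move=> E Y p pS pN [UY JY]; split.
    by apply: (torsion_ext tU pS _ UY); apply: kernel_inW pN => X [].
  by apply: (wide_ext Jw pS _ JY); apply: kernel_inW pN => X [].
Qed.

(* The torsion class of the extensions of an object of U by one of T.         *)
Definition star U : set (fgmod A) :=
  fun X => V X /\ forall Y (p : {linear X -> Y}), surjective p -> wideset J Y -> U Y.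

(** For closure under extensions, let [Y] in J be a quotient of an extension of [Z] by [X]. The
    image of [X] in [Y] is in J by [jasso_image], and so is its cokernel, a quotient of [Z]; both
    are in [U], hence so is [Y]. *)
Lemma star_torsion U : is_torsion_class J U ->
  [/\ is_torsion_class W (star U), T `<=` star U & star U `&` J = U].
Proof.
move=> tU; split.
- apply: torsion_classI => //.
  + by move=> X [[]].
  + move=> Z Z0; split; first exact: (torsion_zero Ww tV).
    move=> Y p pS _; apply: (torsion_zero Jw tU) => y; have [x <-] := pS y.
    by rewrite (Z0 x) linear0.
  + move=> X Y p pS [VX Xp] WY; split; first exact: (torsion_quo tV pS VX WY).
    move=> Z q qS JZ; apply: (Xp Z (q \o p)) => //.
    by move=> z; have [y <-] := qS z; have [x <-] := pS y; exists x.
  + move=> E Z p pS [X [i [[VX Xp] iI iP]]] [VZ Zp].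
    split; first by apply: (torsion_ext tV pS _ VZ); exists X, i.
    move=> Y f fS JY.
    have [I [c [l [JI cS lI lcE]]]] : exists I (c : {linear X -> I}) (l : {linear I -> Y}),
      [/\ jasso I, surjective c, injective l & forall x, l (c x) = (f \o i) x].
      by apply: jasso_image VX _; rewrite -JE.
    have UI : U I by apply: (Xp I c) => //; rewrite JE.
    have JI' : wideset J I by rewrite JE.
    have [C [q [JC qS qP]]] := wide_cok Jw l JI' JY.
    have [|g gP] := factor_surj (f := q \o f) pS.
      by move=> u /iP[x <-]; apply/qP; exists (c x); rewrite lcE.
    have UC : U C.
      apply: (Zp C g) => // y; have [y' <-] := qS y; have [e <-] := fS y'.
      by exists (p e); rewrite gP.
    by apply: (torsion_ext tU qS _ UC); exists I, l.
- move=> X TX; split; first exact: TV.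
  move=> Y p pS JY; have TY : T Y by exact: (torsion_quo tT pS TX (JW JY)).
  apply: (torsion_zero Jw tU) => y; have Yf : tfree T Y by apply/tfree_Gen; move: JY; rewrite JE => -[].
  exact: (Yf Y idfun TY y).
- apply/seteqP; split=> [X [[_ Xp] JX]|X UX].
    by apply: (Xp X idfun) => // x; exists x.
  have JX := torsion_sub tU UX; split=> //; split; first exact: JV.
  by move=> Y p pS JY; exact: (torsion_quo tU pS UX JY).
Qed.

Lemma star_sub U : star U `<=` V.
Proof. by move=> X []. Qed.

(** By [jquotient] an object of [U1] is an extension of an object of J by one of [T], so a class
    between [T] and [V] is determined by its intersection with J. *)
Lemma restrict_le U1 U2 : is_torsion_class W U1 -> is_torsion_class W U2 ->
  U1 `<=` V -> T `<=` U2 -> U1 `&` J `<=` U2 -> U1 `<=` U2.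
Proof.
move=> t1 t2 U1V TU2 h X UX; have [Y [p [JY pS pT]]] := jquotient (U1V _ UX).
apply: (torsion_ext t2 pS); first exact: kernel_inW pT.
have JY' : wideset J Y by rewrite JE.
by apply: h; split=> //; exact: (torsion_quo t1 pS UX (JW JY')).
Qed.

Definition restrict_tors u : tors J := mktors (restrict_torsion (torsP u)).

Lemma star_tors (k : tors J) : is_torsion_class W (star k).
Proof. by case: (star_torsion (torsP k)). Qed.

Definition star_tors_of (k : tors J) : tors W := mktors (star_tors k).
Definition gen_tors : tors W := mktors tT.
Definition perp_tors : tors W := mktors tV.

Lemma restrict_star k : restrict_tors (star_tors_of k) = k.
Proof. by apply: torsset_inj => /=; case: (star_torsion (torsP k)). Qed.

Lemma star_ge k : (gen_tors <= star_tors_of k)%O.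
Proof. by apply/letE; case: (star_torsion (torsP k)). Qed.

Lemma star_le k : (star_tors_of k <= perp_tors)%O.
Proof. exact/letE/star_sub. Qed.

Lemma restrict_tors_le u v : (gen_tors <= u)%O -> (u <= perp_tors)%O -> (gen_tors <= v)%O ->
  (restrict_tors u <= restrict_tors v)%O = (u <= v)%O.
Proof.
move=> /letE Tu /letE uV /letE Tv; apply/idP/idP => /letE h; apply/letE.
  by apply: restrict_le => //; [exact: torsP|exact: torsP|move=> X /h[]].
by move=> X [uX JX]; split=> //; exact: h.
Qed.

Lemma star_restrict u : (gen_tors <= u)%O -> (u <= perp_tors)%O -> star_tors_of (restrict_tors u) = u.
Proof.
move=> Tu uV; apply: le_anti; have := restrict_star (restrict_tors u).
have [ge le] := (star_ge (restrict_tors u), star_le (restrict_tors u)) => e.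
rewrite -(restrict_tors_le ge le Tu) -(restrict_tors_le Tu uV ge).
by apply/andP; split; apply/letE; rewrite e.
Qed.

Lemma restrict_tors_inj u v : (gen_tors <= u)%O -> (u <= perp_tors)%O -> (gen_tors <= v)%O -> (v <= perp_tors)%O ->
  restrict_tors u = restrict_tors v -> u = v.
Proof.
by move=> Tu uV Tv vV uv; rewrite -(star_restrict Tu uV) uv star_restrict.
Qed.

Hypothesis Wf : finite_set [set: tors W].
Variable G : fgmod A.
Hypothesis Gp : progenerator W G.

Lemma finite_tors_jasso : finite_set [set: tors J].
Proof.
have : restrict_tors @` [set: tors W] = [set: tors J].
  by apply/seteqP; split=> [//|k _]; exists (star_tors_of k); rewrite ?restrict_star.
by move=> <-; exact: finite_image.
Qed.

(** Take the [T]-torsion-free quotient of the minimal [V]-approximation [E] of G: maps from [E] to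
    objects of J factor through it. *)
Lemma progenerator_jasso : exists G', progenerator J G'.
Proof.
have cV := fin_gen_all Wf Gp tV.
have [E [C [a [c [[VE aP] VC cS cP [XE XC]]]]]] := left_approx_minimal Ww Gp tV cV.
have [Y [p [JY pS pT]]] := jquotient VE.
have JY' : wideset J Y by rewrite JE.
exists Y; split=> //.
  move=> Y' Z g JY1 JZ gS gJ u.
  have [v vP] := XE Y' Z g (JW JY1) (JW JZ) gS (kernel_inW JV gJ) (u \o p).
  have [|w wP] := factor_surj (f := v) pS.
    have [N [i [TN iI iP]]] := pT; move=> x /iP[n <-].
    have Yf : tfree T Y' by apply/tfree_Gen; move: JY1; rewrite JE => -[].
    exact: (Yf N (v \o i) TN).
  by exists w => x; have [e <-] := pS x; rewrite wP vP.
move=> X JX; have [_ _ Gg] := Gp; have VX := JV JX.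
have [n [f fP]] := Gg X (JW JX).
have /choice[k kP] : forall l, exists k : {linear E -> X}, forall x, f l x = k (a x).
  by move=> l; exact: aP.
have /choice[w wP] : forall l, exists w : {linear Y -> X}, forall x, w (p x) = k l x.
  move=> l; apply: factor_surj => // x; have [N [i [TN iI iP]]] := pT; move=> /iP[m <-].
  have Xf : tfree T X by apply/tfree_Gen; move: JX; rewrite JE => -[].
  exact: (Xf N (k l \o i) TN).
exists n, w => x; have [y ->] := fP x; exists (fun l => p (a (y l))).
by apply: eq_bigr => l _; rewrite wP kP.
Qed.

Lemma meet_tors u v X : torsset u X -> torsset v X -> torsset (Order.meet u v) X.
Proof.
move=> uX vX; have /letE : (tors_meet u v <= Order.meet u v)%O.
  by rewrite lexI -tors_meetP lexx.
by apply=> Z [] ->.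
Qed.

Hypothesis Mi : indecomposable M.

(* The extension E of M by the label S lies in y.  The torsion part L of E    *)
(* maps onto M: otherwise S embeds in the torsion-free quotient Z of E, and   *)
(* the cover hypothesis makes S a direct summand of Z.                        *)
Lemma cover_le_perp y : covered_by gen_tors y -> (y <= perp_tors)%O.
Proof.
move=> Ty; have /covered_tcover c := Ty; have [_ ty Tsy yT _] := c.
have [S l] := label_exists yT; have [yS TS _] := l.
suff VS : V S.
  (* If [S] is in [V], the meet of y and [V] contains [S] and so lies strictly above Gen M; as y
     covers Gen M, the meet is y. *)
  have le : (Order.meet y perp_tors <= y)%O by exact: leIl.
  have [lt|] := boolP (Order.meet y perp_tors < y)%O; last first.
    by rewrite lt_neqAle le andbT negbK => /eqP <-; exact: leIr.
  case: Ty => lt' /(_ (Order.meet y perp_tors))[]; rewrite lt andbT.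
  apply/lttE; split.
    apply/letE; rewrite lexI (ltW lt') /=; apply/letE; exact: TV.
  by move=> h; apply: TS; apply: h; exact: meet_tors.
have WS := torsion_sub ty yS; split=> // E h p WE pS hP.
have [I [q [i [WI qS iI iqE]]]] := wide_image Ww h WS WE.
have ph x : p (h x) = 0 by apply/hP; exists x.
have hP' e : p e = 0 <-> exists x, i x = e.
  rewrite hP; split=> [[x <-]|[x <-]]; first by exists (q x).
  by have [s <-] := qS x; exists s.
have [qI|TI] := label_quo c l qS WI; last first.
  apply: (XM WE WM pS _ idfun); exists I, i; split=> //; exact: TV.
have hI : injective h by move=> x z; rewrite -!iqE => /iI/qI.
have TM : T M by exact: Gen_self.
have yE : torsset y E.
  by apply: (torsion_ext ty pS _ (Tsy _ TM)); exists S, h.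
have [Z [r [WZ rS rT Zf]]] := torsion_quotient Ww tT WE.
have [L [k [TL kI kP]]] := rT.
have yZ : torsset y Z by exact: (torsion_quo ty rS yE WZ).
have plS : surjective (p \o k).
  suff rhS : surjective (r \o h).
    move=> m; have [e eE] := pS m; have [s sE] := rhS (r e).
    have /kP[x xE] : r (e - h s) = 0 by rewrite linearB -sE subrr.
    by exists x; rewrite /= xE linearB ph subr0.
  have [rh0|rh0] := pselect (exists s, r (h s) <> 0); last first.
    have [|g gP] := factor_surj (f := r) pS.
      by move=> e /hP[s <-]; apply: contrapT => h0; apply: rh0; exists s.
    have TZ : T Z.
      by apply: (torsion_quo tT (p := g)) => // z; have [e <-] := rS z; exists (p e); rewrite gP.
    by move=> z; exists 0; rewrite linear0; exact: esym (Zf Z idfun TZ z).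
  have [N [n [WN nS nP]]] := wide_cok Ww (r \o h) WS WZ.
  have [|g gP] := factor_surj (f := n \o r) pS.
    by move=> e /hP[s <-]; apply/nP; exists s.
  have TN : T N.
    apply: (torsion_quo tT (p := g)) => // z; have [z' <-] := nS z; have [e <-] := rS z'.
    by exists (p e); rewrite gP.
  have [phi phi0] : exists (phi : {linear Z -> S}) z, phi z <> 0.
    apply: contrapT => h0; have [s0 rs0] := rh0; apply: rs0.
    have TZ : T Z.
      apply/(label_perp Ww c l); split=> // f x.
      by apply: contrapT => fx; apply: h0; exists f, x.
    exact: (Zf Z idfun TZ).
  have [bI bS] : injective (phi \o r \o h) /\ surjective (phi \o r \o h).
    apply: (label_endo Ww c l); apply: contrapT => h0.
    have [|f fP] := factor_surj (f := phi) nS.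
      by move=> z /nP[s <-]; apply: contrapT => h1; apply: h0; exists s.
    have [z pz] := phi0; apply: pz; rewrite -fP; exact: (label_tfree Ww c l).
  have [b bK Kb] := inv_lin bI bS.
  have [|f fP] := factor_surj (f := idfun \- (r \o h \o b \o phi)) nS.
    move=> z /nP[s <-]; rewrite /= -[X in r (h (b X))]/((phi \o r \o h) s) bK subrr //.
  move=> z; exists (b (phi z)); apply/eqP; rewrite eq_sym -subr_eq0; apply/eqP.
  exact: (etrans (esym (fP z)) (Zf N f TN _)).
(* Now [L], in Gen M, maps onto [M]. Let [pi] map [M] to the label of a lower cover of Gen M. Some
   [f : M -> L] keeps pi p k f nonzero, so p k f is an automorphism of [M] by [cover_endo], and [p]
   splits. *)
have [u /covered_tcover uT] := rigid_lower Wf Mi WM (erefl : torsset gen_tors = _).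
have [_ _ _ Tu _] := uT; have [S1 l1] := label_exists Tu; have [TS1 _ _] := l1.
have [pi pi0] := Gen_nonzero TS1 (label_nonzero Ww uT l1).
have /Gen1E[_ LM] := TL.
have pl0 : exists x, (pi \o p \o k) x <> 0.
  by have [m pm] := pi0; have [x xE] := plS m; exists x; rewrite /= -[p _]/((p \o k) x) xE.
have [f f0] := nonzero_part pl0 LM.
have [eI eS] : injective (p \o k \o f) /\ surjective (p \o k \o f).
  exact: (cover_endo Ww uT l1 Mi TM (rigid_Gen_ext_projective Mr) pi0 (e := p \o k \o f) f0).
have [d dK Kd] := inv_lin eI eS.
by exists (k \o f \o d) => m; rewrite -[RHS]Kd.
Qed.

(** If J is not inside z, an object [S] of J outside z of least dimension is simple in J. A torsion
    class [C] of J around [S] lifts by [star] to a class strictly above Gen M. A cover of Gen M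
    below it contains a nonzero object of J in [C], which maps onto [S]; so [S] is in z after
    all. *)
Lemma perp_le_join z : (gen_tors <= z)%O -> (forall y, covered_by gen_tors y -> (y <= z)%O) ->
  (perp_tors <= z)%O.
Proof.
move=> Tz zc; apply/letE => X0 VX0; have [Y0 [p0 [JY0 p0S p0T]]] := jquotient VX0.
apply: (torsion_ext (torsP z) p0S); first by exact: (kernel_inW ((letE gen_tors z).1 Tz) p0T).
suff Jz X : wideset J X -> torsset z X by apply: Jz; rewrite JE.
apply: contrapT => nz.
have [|S [JS zS] Smin] := @fgmod_min _ _ (fun X => wideset J X /\ ~ torsset z X).
  by exists X; apply: contrapT => h; apply: nz => JX; apply: contrapT => zX; apply: h.
have simple Y (p : {linear S -> Y}) : surjective p -> wideset J Y -> (exists x, p x <> 0) -> injective p.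
  move=> pS JY [x0 px0].
  have [zY|zY] := pselect (torsset z Y); last first.
    by apply: (surj_inj pS); apply: Smin.
  have [N [i [JN iI iP]]] := wide_ker Jw p JS JY.
  have [zN|zN] := pselect (torsset z N).
    by case: zS; apply: (torsion_ext (torsP z) pS _ zY); exists N, i.
  have iS := inj_surj iI (Smin N (conj JN zN)).
  by case: px0; apply/iP; have [n <-] := iS x0; exists n.
have S0 : exists x : S, x <> 0.
  apply: contrapT => h; apply: zS; apply: (torsion_zero Ww (torsP z)) => x.
  by apply: contrapT => x0; apply: h; exists x.
(* Equivalently, the objects of J whose simple quotients in J are all isomorphic to [S]. *)
pose C : set (fgmod A) := fun X => wideset J X /\
  forall Y (p : {linear X -> Y}), surjective p -> wideset J Y -> (exists y : Y, y <> 0) ->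
  exists (f : {linear Y -> S}) y, f y <> 0.
have tC : is_torsion_class J C.
  apply: torsion_classI => //.
  - by move=> Y [].
  - move=> Z Z0; split; first exact: wide_zero.
    move=> Y p pS _ [y y0]; case: y0; have [x <-] := pS y; by rewrite (Z0 x) linear0.
  - move=> Y Y' p pS [JY Yp] JY'; split=> // Y2 q qS.
    apply: (Yp Y2 (q \o p)) => y; have [y' <-] := qS y; have [y2 <-] := pS y'.
    by exists y2.
  - move=> E Z p pS [N [i [[JN Np] iI iP]]] [JZ Zp].
    have JE' : wideset J E by apply: (wide_ext Jw pS _ JZ); exists N, i.
    split=> // Y f fS JY Y1.
    have [I [c [l [JI cS lI lcE]]]] := wide_image Jw (f \o i) JN JY.
    have [D [q [JD qS qP]]] := wide_cok Jw (f \o i) JN JY.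
    have [d0|d0] := pselect (exists d : D, d <> 0).
      have [|g gP] := factor_surj (f := q \o f) pS.
        by move=> e /iP[n <-]; apply/qP; exists n.
      have [|h [d hd]] := Zp D g _ JD d0.
        by move=> d; have [y <-] := qS d; have [e <-] := fS y; exists (p e); rewrite gP.
      by have [y yE] := qS d; exists (h \o q), y; rewrite /= yE.
    apply: (Np Y (f \o i)) => // y; apply/qP.
    by apply: contrapT => qy; apply: d0; exists (q y).
have CS : C S.
  split=> // Y p pS JY [y y0]; have [x xE] := pS y.
  have pI : injective p by apply: simple => //; exists x; rewrite xE.
  by have [g gK Kg] := inv_lin pI pS; have [s s0] := S0; exists g, (p s); rewrite gK.
pose w := star_tors_of (mktors tC).
have JCw Y : wideset J Y -> torsset w Y -> C Y.
  by move=> JY [_ Yp]; apply: (Yp Y idfun) => // y; exists y.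
have wS : torsset w S.
  by split; [exact: JV|move=> Y p pS JY; exact: (torsion_quo tC pS CS JY)].
have /(upper_cover Wf)[y /letE yw Ty] : (gen_tors < w)%O.
  apply/lttE; split; first exact/letE/star_ge.
  by move=> wT; apply: zS; move/letE: Tz; apply; exact: wT.
have /covered_tcover[_ ty Tsy yT _] := Ty.
have [R [yR [JR R0]]] : exists R, torsset y R /\ wideset J R /\ exists r : R, r <> 0.
  apply: contrapT => h; apply: yT => X1 yX1.
  have [Y [p [JY pS pT]]] := jquotient (star_sub (yw _ yX1)).
  have JY' : wideset J Y by rewrite JE.
  apply: (torsion_ext tT pS pT); apply: (torsion_zero Ww tT) => y0; apply: contrapT => ny0; apply: h.
  by exists Y; do 2?split=> //; [exact: (torsion_quo ty pS yX1 (JW JY'))|exists y0].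
have [f [r fr]] : exists (f : {linear R -> S}) y, f y <> 0.
  have [_ Rp] := JCw R JR (yw _ yR).
  by apply: (Rp R idfun) => // x; exists x.
apply: zS; have /letE := zc y Ty; apply.
apply: (torsion_quo ty (p := f) _ yR) => [|]; last exact: JW.
have [D [q [JD qS qP]]] := wide_cok Jw f JR JS.
have [d0|d0] := pselect (exists d : D, d <> 0).
  have [d nd] := d0; have [s sE] := qS d.
  have qI : injective q by apply: simple => //; exists s; rewrite sE.
  by case: fr; apply: qI; rewrite linear0; apply/qP; exists r.
by move=> s; apply/qP; apply: contrapT => qs; apply: d0; exists (q s).
Qed.

Lemma pop_up_Gen : pop_up gen_tors = perp_tors.
Proof.
have sup : supremums (gen_tors |` [set y | covered_by gen_tors y]) perp_tors.
  split=> [y /= [->|/cover_le_perp //]|z zU].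
    by apply/letE.
  apply: perp_le_join; first by apply: zU; left.
  by move=> y Ty; apply: zU; right.
rewrite /pop_up /supremum; case: eqP => [e|_].
  by have [] : (set0 : set (tors W)) gen_tors by rewrite -e; left.
by apply: xget_subset1 => //; exact: is_subset1_supremums.
Qed.

End Perp.

(** * The Auslander-Reiten translate *)

Section Projectives.
Variables (K : fieldType) (B : falgType K).
Implicit Types (M N X Y Z D E P Q : fgmod B).

Lemma regular_fgmod : exists (R : fgmod B) (th : {linear R -> B^o}), injective th /\ surjective th.
Proof.
have [|R /isoMP[th thI thS]] := @fgmod_dense K B B^o 1 (fun=> 1).
  by move=> x; exists (fun=> x); rewrite big_ord1 /GRing.scale /= mulr1.
by exists R, th.
Qed.

Fact rscale_subproof P X (h : {linear P -> B^o}) (x : X) : linear (fun y => (h y : B) *: x).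
Proof. by move=> a y z; rewrite linearP scalerDl scalerA. Qed.

Definition rscale P X (h : {linear P -> B^o}) (x : X) : {linear P -> X} :=
  mklin (rscale_subproof h x).

Fact rmul_subproof P (h : {linear P -> B^o}) (a : B) : linear (fun y => (h y : B) * a : B^o).
Proof. by move=> b y z; rewrite linearP mulrDl; congr (_ + _); exact: esym (mulrA _ _ _). Qed.

Definition rmul P (h : {linear P -> B^o}) (a : B) : {linear P -> B^o} :=
  mklin (rmul_subproof h a).

Lemma regular_progenerator (R : fgmod B) (th : {linear R -> B^o}) : injective th -> surjective th -> progenerator setT R.
Proof.
move=> thI thS; have [e eE] := thS 1.
split=> // [Y Z g _ _ gS _ u|X _].
  have [y yE] := gS (u e); exists (rscale th y) => x /=.
  rewrite linearZ /= yE -linearZ /=; congr (u _); apply: thI.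
  by rewrite linearZ /= eE /GRing.scale /= mulr1.
exists (fgdim X), (fun i => rscale th (delta_mx i 0 : X)) => x.
have [s sK] := choice thS; exists (fun i => s ((x : 'cV[K]_(fgdim X)) i 0)%:A).
by rewrite [LHS]fg_gen; apply: eq_bigr => i _ /=; rewrite sK.
Qed.

Lemma projectiveP P : projective P <-> forall M N (p : {linear M -> N}) (h : {linear P -> N}),
  surjective p -> exists l : {linear P -> M}, forall x, p (l x) = h x.
Proof.
split=> [PP M N p h /surjectiveE pS|PP M N p h /surjectiveE pS]; last exact: PP.
by have [l lP] := PP M N p h pS; exists l => x; exact: lP.
Qed.

Lemma projective_retract P X (i : {linear X -> P}) (r : {linear P -> X}) :
  (forall x, r (i x) = x) -> projective P -> projective X.
Proof.
move=> ri /projectiveP PP; apply/projectiveP => M N p h pS.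
have [l lP] := PP M N p (h \o r) pS; exists (l \o i) => x.
by rewrite /= lP /= ri.
Qed.

Lemma progenerator_projective (R : fgmod B) : progenerator setT R -> projective R.
Proof.
move=> [_ XR _]; apply/projectiveP => M N p h pS; apply: XR => //; exact: (wide_ker (is_wide_setT B) p).
Qed.

Lemma projective_zero Z : zeroM Z -> projective Z.
Proof. by move=> Z0; apply/projectiveP => M N p h _; exists (\0) => x; rewrite (Z0 x) !linear0. Qed.

Lemma projective_biprod D X Y (i1 : {linear X -> D}) (i2 : {linear Y -> D})
  (p1 : {linear D -> X}) (p2 : {linear D -> Y}) :
  is_biprod i1 i2 p1 p2 -> projective X -> projective Y -> projective D.
Proof.
move=> [_ _ _ _ zE] /projectiveP PX /projectiveP PY; apply/projectiveP => M N p h pS.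
have [l1 l1P] := PX M N p (h \o i1) pS; have [l2 l2P] := PY M N p (h \o i2) pS.
by exists ((l1 \o p1) \+ (l2 \o p2)) => x; rewrite /= linearD l1P l2P /= -linearD -zE.
Qed.

Definition dual_basis P (I : finType) (e : I -> {linear P -> B^o}) (p : I -> P) :=
  forall x, x = \sum_i (e i x : B) *: p i.

Lemma dual_basis_exists P : projective P ->
  exists (I : finType) (e : I -> {linear P -> B^o}) (p : I -> P), dual_basis e p.
Proof.
have [R [th [thI thS]]] := regular_fgmod; have [e eE] := thS 1.
have [_ _ /(_ P Logic.I) RP] := regular_progenerator thI thS.
pose Q D := exists (I : finType) (e : I -> {linear D -> B^o}) (p : I -> D), dual_basis e p.
have [|D X Y i1 i2 p1 p2 [_ _ _ _ zE] [I [eX [pX XP]]] [J [eY [pY YP]]]||D [s [[I [eD [pD DP]]] sS]]] :=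
  @genby_surj _ _ R P Q RP.
- move=> Z Z0; exists void, (fun=> \0), (fun=> 0) => x.
  by rewrite [LHS]Z0 big_pred0 => [|[]].
- exists (I + J)%type.
  exists (fun k => match k return {linear D -> B^o} with inl i => eX i \o p1 | inr j => eY j \o p2 end).
  exists (fun k => match k with inl i => i1 (pX i) | inr j => i2 (pY j) end) => z.
  rewrite big_sumType /= [LHS]zE {1}(XP (p1 z)) {1}(YP (p2 z)) !linear_sum /=.
  by congr (_ + _); apply: eq_bigr => k _; rewrite linearZ.
- exists unit, (fun=> th), (fun=> e) => x.
  rewrite big_const card_unit /= addr0; apply: thI.
  by rewrite linearZ /= eE /GRing.scale /= mulr1.
move=> /projectiveP PP; have [l lP] := PP D P s idfun sS.
exists I, (fun i => eD i \o l), (s \o pD) => x.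
rewrite -[LHS]/(idfun x) -lP [in LHS](DP (l x)) linear_sum /=.
by apply: eq_bigr => i _; rewrite linearZ.
Qed.

(** A projective of least dimension that maps onto [N]: by the Fitting lemma an endomorphism over
    [N] is onto, which makes [g] essential. *)
Lemma projective_cover N : exists P (g : {linear P -> N}), [/\ projective P, surjective g & essential g].
Proof.
have [R [th [thI thS]]] := regular_fgmod; have Rp := regular_progenerator thI thS.
have [_ _ /(_ N Logic.I) RN] := Rp.
have [|P [PP [g gS]] Pmin] :=
  @fgmod_min _ _ (fun P => projective P /\ exists g : {linear P -> N}, surjective g).
  have [D [s [PD sS]]] := genby_surj RN projective_zero projective_biprod (progenerator_projective Rp).
  by exists D; split=> //; exists s.
exists P, g; split=> // X h hg; apply/surjectiveE.
have ghS : surjective (g \o h) by apply/surjectiveE; rewrite hg; apply/surjectiveE.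
have /projectiveP/(_ _ _ (g \o h) g ghS)[l lP] := PP.
pose e := h \o l; have ge x : g (e x) = g x by rewrite -[RHS]lP.
have [n [I [i [r [ri iP]]]]] := fitting e.
have gn m x : g (epow e m x) = g x by elim: m => //= m <-; exact: ge.
have iS : surjective i.
  apply: inj_surj; first by move=> x y /(congr1 r); rewrite !ri.
  apply: Pmin; split; first exact: projective_retract ri PP.
  exists (g \o i) => y; have [x <-] := gS y.
  have [z zE] : exists z, i z = epow e n.+1 x by apply/iP; exists x.
  by exists z; rewrite /= zE gn.
move=> y; have /iP[z <-] : exists x, i x = y by exact: iS.
by exists (l (epow e n z)).
Qed.

Lemma minimal_presentation M : exists P1 P0 (f : {linear P1 -> P0}) (g : {linear P0 -> M}),
  minimal_projective_presentation f g.
Proof.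
have [P0 [g [PP0 gS ge]]] := projective_cover M.
have [N [i [iI iP]]] := ker_exists g.
have [P1 [c [PP1 cS ce]]] := projective_cover N.
exists P1, P0, (i \o c), g; split=> //; first exact/surjectiveE.
  apply/seteqP; split=> x /=; first by move=> [y _ <-]; apply/iP; exists (c y).
  by move=> /iP[y <-]; have [z <-] := cS y; exists z.
split=> // X h hE; apply: ce; apply/seteqP; split=> y [x _ <-]; first by exists (h x).
have : range (i \o c) (i (c x)) by exists x.
by rewrite -hE => -[z _ /iI <-]; exists z.
Qed.

End Projectives.

(** * Homomorphisms into the translate *)

Section Translate.
Variables (K : fieldType) (B : falgType K).
Implicit Types (M N X Y Z D E P Q : fgmod B).

(** Surjectivity of Hom(P0, X) -> Hom(P1, X); for a minimal presentation of M, the cokernel of this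
    map is dual to Hom(X, tau M). *)
Definition factors P1 P0 X (f : {linear P1 -> P0}) :=
  forall u : {linear P1 -> X}, exists v : {linear P0 -> X}, forall x, u x = v (f x).

(** The presentation maps to the sequence by [a] on P0 and [u] on P1. Once [u] extends to [v] on P0,
    the map a - h v kills the image of [f] and descends to a section. *)
Lemma factors_csplit P1 P0 M (f : {linear P1 -> P0}) (g : {linear P0 -> M}) X :
  minimal_projective_presentation f g -> factors X f -> csplit setT M X.
Proof.
move=> [/projectiveP PP1 /projectiveP PP0 /surjectiveE gS /range_ker fg _] fX E h p _ pS hP.
have [a aP] := PP0 E M p g pS.
have [I [c [i [cS iI icE]]]] := image_exists h.
have [|b bP] := factor_inj (f := a \o f) iI.
  move=> x; have /hP[y yE] : p (a (f x)) = 0 by rewrite aP; apply/fg; exists x.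
  by exists (c y); rewrite icE yE.
have [u uP] := PP1 X I c b cS.
have [v vP] := fX u.
have [|s sP] := factor_surj (f := a \- (h \o v)) gS.
  by move=> y /fg[x <-]; rewrite /= -vP -icE uP bP subrr.
exists s => m; have [y <-] := gS m; rewrite sP /= linearB aP.
by have -> : p (h (v y)) = 0; [apply/hP; exists (v y)|rewrite subr0].
Qed.

(** Splitting the pushout of the presentation along [u] writes u = v f + u l k, where l k has values
    in the kernel of [f]. So [h] = 1 - l k satisfies f h = f and u h = v f. Essentiality of [f]
    makes [h] onto, whence u = v f. *)
Lemma csplit_factors P1 P0 M (f : {linear P1 -> P0}) (g : {linear P0 -> M}) X :
  minimal_projective_presentation f g -> csplit setT M X -> factors X f.
Proof.
move=> [/projectiveP PP1 /projectiveP PP0 /surjectiveE gS /range_ker fg [fe _]] MX u.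
have gf x : g (f x) = 0 by apply/fg; exists x.
have [D [e1 [e2 [p1 [p2 b]]]]] := biprod X P0; have [b1 b2 b3 b4 b5] := b.
pose r : {linear P1 -> D} := (e1 \o u) \- (e2 \o f).
have [E [q [qS qP]]] := submod_quo (image_submod r).
have [|p pP] := factor_surj (f := g \o p2) qS.
  by move=> d /qP[x <-] /=; rewrite !linearB b2 b4 gf linear0 subrr.
have qrel x : q (e1 (u x)) = q (e2 (f x)).
  by apply/eqP; rewrite -subr_eq0 -linearB; apply/eqP/qP; exists x.
have pS : surjective p by move=> m; have [y <-] := gS m; exists (q (e2 y)); rewrite pP /= b4.
have hP e : p e = 0 <-> exists x, (q \o e1) x = e.
  split=> [|[x <-]]; last by rewrite /= pP /= b2 linear0.
  have [d <-] := qS e; rewrite pP => /fg[x xE].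
  exists (p1 d + u x); rewrite /= 2!linearD qrel [d in RHS]b5 linearD.
  by rewrite xE.
have [s sP] := MX E (q \o e1) p Logic.I pS hP.
have [I [c [i [cS iI icE]]]] := image_exists (q \o e1).
have [|w wP] := factor_inj (f := (q \o e2) \- (s \o g)) iI.
  move=> y; have /hP[x xE] : p (q (e2 y) - s (g y)) = 0 by rewrite linearB pP sP /= b4 subrr.
  by exists (c x); rewrite icE; exact: xE.
have [v vP] := PP0 X I c w cS.
have [L [l [lI lP]]] := ker_exists f.
have ul x : exists y, u (l y) = u x - v (f x).
  have : q (e1 (u x - v (f x))) = 0.
    have qv : q (e1 (v (f x))) = q (e2 (f x)).
      by rewrite -[LHS]/((q \o e1) (v (f x))) -icE vP wP /= gf linear0 subr0.
    by rewrite 2!linearB qv qrel subrr.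
  move=> /qP[y]; rewrite /r /= => yE; have [z zE] : exists z, l z = y.
    apply/lP/eqP; rewrite -oppr_eq0; apply/eqP.
    by have := congr1 p2 yE; rewrite b2 linearB b2 b4 sub0r.
  by exists z; have := congr1 p1 yE; rewrite b1 linearB b1 b3 subr0 zE.
have [J [c' [i' [c'S i'I ic'E]]]] := image_exists (u \o l).
have [|t tP] := factor_inj (f := u \- (v \o f)) i'I.
  by move=> x; have [y yE] := ul x; exists (c' y); rewrite ic'E.
have [k kP] := PP1 L J c' t c'S.
pose h : {linear P1 -> P1} := idfun \- (l \o k).
have fl y : f (l y) = 0 by apply/lP; exists y.
have fh x : f (h x) = f x by rewrite /h /= linearB fl subr0.
have hS : surjective h.
  apply/surjectiveE; apply: fe; apply/seteqP; split=> y [x _ <-]; first by exists (h x).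
  by exists x => //=; rewrite fh.
have uh x : u (h x) = v (f x).
  rewrite /h /= linearB -[u (l _)]/((u \o l) (k x)) -ic'E kP tP /=.
  by rewrite opprB addrC subrK.
by exists v => x; have [y <-] := hS x; rewrite uh fh.
Qed.

Section DualFunctional.
Variables (P : fgmod B) (phi : {linear P -> B^o} -> K).
Hypothesis phiP : dual_functional phi.

Lemma dual0 (h : {linear P -> B^o}) : (forall x, h x = 0) -> phi h = 0.
Proof.
move=> h0; have /eqP : phi h = 1 * phi h + phi h.
  by apply: phiP => x; rewrite !h0 scaler0 addr0.
by rewrite mul1r -subr_eq0 opprD addrA subrr sub0r oppr_eq0 => /eqP.
Qed.

Lemma dualP (h h1 h2 : {linear P -> B^o}) k :
  (forall x, h x = k%:A *: h1 x + h2 x) -> phi h = k * phi h1 + phi h2.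
Proof. exact: phiP. Qed.

Fact lsum_subproof (I : Type) (s : seq I) (h : I -> {linear P -> B^o}) (c : I -> K) :
  linear (fun x => \sum_(i <- s) (c i)%:A *: h i x).
Proof.
move=> a x y; rewrite scaler_sumr -big_split /=; apply: eq_bigr => i _.
by rewrite linearP scalerDr kscale_comm.
Qed.

Lemma dual_sum (I : Type) (s : seq I) (h : I -> {linear P -> B^o}) (c : I -> K)
    (H : {linear P -> B^o}) :
  (forall x, H x = \sum_(i <- s) (c i)%:A *: h i x) -> phi H = \sum_(i <- s) c i * phi (h i).
Proof.
elim: s H => [|i s IH] H HP; first by rewrite big_nil dual0 // => x; rewrite HP big_nil.
rewrite big_cons -(IH (mklin (lsum_subproof s h c))) //.
by apply: dualP => x; rewrite HP big_cons.
Qed.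
End DualFunctional.

Lemma dual_basis_rmul P (I : finType) (e : I -> {linear P -> B^o}) p (h : {linear P -> B^o}) x :
  dual_basis e p -> h x = \sum_i (1 : K)%:A *: rmul (e i) (h (p i)) x.
Proof.
move=> eP; rewrite {1}(eP x) linear_sum; apply: eq_bigr => i _.
by rewrite scale1r scale1r linearZ.
Qed.

Section ARFunctional.
Variables (P1 P0 M N : fgmod B) (f : {linear P1 -> P0}) (g : {linear P0 -> M}).
Variable iota : N -> {linear P1 -> B^o} -> K.
Hypotheses (fg : minimal_projective_presentation f g) (iI : injective iota)
  (iD : forall x y h, iota (x + y) h = iota x h + iota y h)
  (iZ : forall (a : B) x (h ha : {linear P1 -> B^o}),
     (forall y, ha y = (h y : B) * a) -> iota (a *: x) h = iota x ha)
  (ir : range iota = [set phi | dual_functional phi /\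
     forall (q : {linear P0 -> B^o}) (h : {linear P1 -> B^o}), h =1 q \o f -> phi h = 0]).

Let iota_dual x : dual_functional (iota x).
Proof. by have : range iota (iota x) by [exists x]; rewrite ir => -[]. Qed.

Let iota_van x (q : {linear P0 -> B^o}) (h : {linear P1 -> B^o}) : h =1 q \o f -> iota x h = 0.
Proof. by have : range iota (iota x) by [exists x]; rewrite ir => -[_ +]; apply. Qed.

Let iota0 h : iota 0 h = 0.
Proof. by apply/eqP; rewrite -[_ == 0](inj_eq (addrI (iota 0 h))) -iD !addr0. Qed.

Let iota_sum (I : finType) (F : I -> N) h : iota (\sum_i F i) h = \sum_i iota (F i) h.
Proof. by apply: (big_morph (fun x => iota x h)). Qed.

(** The map y |-> h(y) x extends along [f] to [v]. Expanding in dual bases of P1 and P0 rewrites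
    iota (G x) h as a sum of values of elements of the range of [iota] at functionals q f, where
    they vanish. *)
Lemma factors_hom_zero X : factors X f -> hom_zero X N.
Proof.
move=> fX G x; apply: iI; apply: funext => h; rewrite iota0.
have [PP1 PP0 _ _ _] := fg.
have [J [e [p eP]]] := dual_basis_exists PP1.
have [I [q [r qP]]] := dual_basis_exists PP0.
have [v vP] := fX (rscale h x).
rewrite (dual_sum (@iota_dual (G x)) (fun y => dual_basis_rmul h y eP)).
transitivity (\sum_i iota (G (v (r i))) (q i \o f)); last first.
  by apply: big1 => i _; apply: iota_van.
transitivity (\sum_j \sum_i iota (G (v (r i))) (rmul (e j) (q i (f (p j))))).
  apply: eq_bigr => j _; rewrite mul1r -(@iZ (h (p j)) (G x) (e j)) // -linearZ.
  rewrite -[_ *: x]/(rscale h x (p j)) vP {1}(qP (f (p j))) !linear_sum iota_sum.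
  by apply: eq_bigr => i _; rewrite linearZ /= linearZ /= (@iZ _ _ _ (rmul (e j) (q i (f (p j))))).
rewrite exchange_big; apply: eq_bigr => i _.
rewrite (dual_sum (@iota_dual _) (fun y => dual_basis_rmul (q i \o f) y eP)).
by apply: eq_bigr => j _; rewrite mul1r.
Qed.

(** The [L i] are coordinates on the cokernel of Hom(P0, X) -> Hom(P1, X). Each gives a homomorphism
    X -> N sending x to the form h |-> L i (h(-) x), which is zero by hypothesis. The maps h(-) x
    span Hom(P1, X) by the dual basis, so every [L i] vanishes. *)
Lemma hom_zero_factors X : hom_zero X N -> factors X f.
Proof.
move=> XN u; have [PP1 PP0 _ _ _] := fg.
have [J [e [p eP]]] := dual_basis_exists PP1.
have [r [b [bP bI]]] := hom_basis P1 X; have [co coP] := choice bP.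
have coD (w w1 w2 : {linear P1 -> X}) k : (forall x, w x = k%:A *: w1 x + w2 x) ->
    forall i, co w i = k * co w1 i + co w2 i.
  move=> wE i; apply/eqP; rewrite -subr_eq0; apply/eqP.
  apply: (bI (fun i => co w i - (k * co w1 i + co w2 i))) => x.
  transitivity (klin (co w) b x - (k%:A *: klin (co w1) b x + klin (co w2) b x)).
    rewrite !klinE scaler_sumr -big_split -sumrB; apply: eq_bigr => l _.
    by rewrite /= scalerA mulr_algl scalerA -!scalerDl -!scalerBl.
  by rewrite -!coP wE subrr.
pose S (c : 'cV[K]_r) := exists v : {linear P0 -> X}, forall x, klin (fun i => c i 0) b x = v (f x).
have SP k (c1 c2 : 'cV[K]_r) : S c1 -> S c2 -> S (k *: c1 + c2).
  move=> [v1 v1P] [v2 v2P].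
  exists (klin (fun i : 'I_2 => if i == ord0 then k else 1)
               (fun i : 'I_2 => if i == ord0 then v1 else v2)) => x.
  rewrite !klinE !big_ord_recl big_ord0 /= addr0 -v1P -v2P !klinE.
  rewrite scale1r scale1r scaler_sumr -big_split.
  apply: eq_bigr => l _. by rewrite !mxE /= scalerA mulr_algl scalerA -!scalerDl.
have S0 : S 0.
  by exists (\0) => x; rewrite klinE; apply: big1 => i _; rewrite mxE scale0r scale0r.
have [m [Q [R [QR QS]]]] := subspace_quo S0 SP.
pose L i (w : {linear P1 -> X}) := (Q *m \col_l co w l) i 0.
have LD i (w w1 w2 : {linear P1 -> X}) k : (forall x, w x = k%:A *: w1 x + w2 x) ->
    L i w = k * L i w1 + L i w2.
  move=> wE; rewrite /L; have -> : \col_l co w l = k *: (\col_l co w1 l) + \col_l co w2 l.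
    by apply/colP => l; rewrite !mxE (coD _ _ _ _ wE).
  by rewrite mulmxDr -scalemxAr !mxE.
have LS i (w : {linear P1 -> X}) : (exists v : {linear P0 -> X}, forall x, w x = v (f x)) -> L i w = 0.
  move=> [v vP]; have /QS : S (\col_l co w l).
    by exists v => x; rewrite -vP (coP w) !klinE; apply: eq_bigr => l _; rewrite mxE.
  by rewrite /L => ->; rewrite mxE.
suff Lu i : L i u = 0.
  have [|v vP] := (QS (\col_l co u l)).2.
    by apply/colP => i; rewrite [LHS]Lu mxE.
  by exists v => x; rewrite -vP (coP u) !klinE; apply: eq_bigr => l _; rewrite mxE.
have nP x : exists n, iota n = fun h => L i (rscale h x).
  suff : range iota (fun h => L i (rscale h x)) by case=> n _ nE; exists n.
  rewrite ir; split=> [k h h1 h2 hE|q h hE].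
    by apply: LD => y /=; rewrite hE scalerDl scalerA.
  by apply: LS; exists (rscale q x) => y /=; rewrite hE.
have [n nE] := choice nP.
have nl : linear n.
  move=> a x y; apply: iI; apply: funext => h.
  rewrite iD (@iZ a _ _ (rmul h a)) // !nE.
  rewrite -[X in _ = X + _]mul1r; apply: LD => z /=.
  by rewrite scale1r scale1r scalerDr scalerA.
have n0 x : n x = 0 by exact: (XN (mklin nl)).
have L0 h x : L i (rscale h x) = 0.
  by have := nE x; rewrite n0 => /(congr1 (fun F => F h)); rewrite iota0.
have Lsum (s : seq J) (w : {linear P1 -> X}) :
    (forall x, w x = \sum_(j <- s) (e j x : B) *: u (p j)) -> L i w = 0.
  elim: s w => [|j s IH] w wE.
    by apply: LS; exists (\0) => x; rewrite wE big_nil.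
  have tl : linear (fun x => \sum_(j <- s) (e j x : B) *: u (p j)).
    move=> a x y; rewrite scaler_sumr -big_split; apply: eq_bigr => l _.
    by rewrite /= linearP scalerDl scalerA.
  rewrite (LD i w (rscale (e j) (u (p j))) (mklin tl) 1) ?L0 ?mulr0 ?add0r; first exact: IH.
  by move=> x; rewrite wE big_cons /= scale1r scale1r.
apply: (Lsum (index_enum J)) => x; rewrite {1}(eP x) linear_sum.
by apply: eq_bigr => j _; rewrite linearZ.
Qed.

End ARFunctional.

Lemma AR_criterion M N X : is_AR_translate M N -> (hom_zero X N <-> csplit setT M X).
Proof.
move=> [P1 [P0 [f [g [iota [fg [iI iD iZ ir]]]]]]]; split=> h.
  exact: (factors_csplit fg) (hom_zero_factors fg iI iD iZ ir h).
exact: (factors_hom_zero fg iI iD iZ ir) (csplit_factors fg h).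
Qed.

End Translate.

(** * Existence of the translate *)

Section Existence.
Variables (K : fieldType) (B : falgType K).
Implicit Types (M N X Y Z D E P Q : fgmod B).

(** D Hom(P1, A) is modelled on a column space through a basis [b] of Hom(P1, A); [rho] records
    right multiplication on that basis, which acts on functionals from the left. [N] is the
    submodule of functionals that vanish on all q f. *)
Lemma AR_exists M : exists N, is_AR_translate M N.
Proof.
have [P1 [P0 [f [g fg]]]] := minimal_presentation M.
have [R [th [thI thS]]] := regular_fgmod B; have [ht htK Kht] := inv_lin thI thS.
have [r [b0 [b0P b0I]]] := hom_basis P1 R.
pose b i : {linear P1 -> B^o} := th \o b0 i.
have bE c x : klin c b x = th (klin c b0 x).
  by rewrite !klinE linear_sum; apply: eq_bigr => i _; rewrite linearZ.
have bP (h : {linear P1 -> B^o}) : exists c, forall x, h x = klin c b x.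
  have [c cP] := b0P (ht \o h); exists c => x.
  by rewrite bE -cP /= Kht.
have bI c : (forall x, klin c b x = 0) -> forall i, c i = 0.
  by move=> c0; apply: b0I => x; apply: thI; rewrite linear0 -bE.
have [co coP] := choice bP.
have coU (h : {linear P1 -> B^o}) c : (forall x, h x = klin c b x) -> co h = c.
  move=> hc; apply/funext => i; apply/eqP; rewrite -subr_eq0; apply/eqP.
  apply: (bI (fun i => co h i - c i)) => x.
  rewrite -[RHS](subrr (h x)) {1}coP hc !klinE -sumrB; apply: eq_bigr => l _.
  by rewrite -!scalerBl.
have coD (h h1 h2 : {linear P1 -> B^o}) k : (forall x, h x = k%:A *: h1 x + h2 x) ->
    forall i, co h i = k * co h1 i + co h2 i.
  move=> hE i; rewrite (coU h (fun i => k * co h1 i + co h2 i)) // => x.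
  rewrite hE (coP h1) (coP h2) !klinE scaler_sumr -big_split; apply: eq_bigr => l _.
  by rewrite /= scalerA mulr_algl scalerA -!scalerDl.
pose rho a : 'M[K]_r := \matrix_(i, j) co (rmul (b i) a) j.
have rho_co (h : {linear P1 -> B^o}) a j : co (rmul h a) j = \sum_i co h i * rho a i j.
  rewrite (coU (rmul h a) (fun j => \sum_i co h i * rho a i j)) // => x.
  rewrite /= (coP h) !klinE mulr_suml.
  transitivity (\sum_i (co h i)%:A *: klin (co (rmul (b i) a)) b x).
    by apply: eq_bigr => i _; rewrite -coP /= -mulrA.
  transitivity (\sum_i \sum_l (co h i)%:A *: ((co (rmul (b i) a) l)%:A *: b l x)).
    by apply: eq_bigr => i _; rewrite klinE scaler_sumr.
  rewrite exchange_big; apply: eq_bigr => l _ /=.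
  rewrite scaler_suml scaler_suml; apply: eq_bigr => i _.
  by rewrite scalerA mulr_algl scalerA mxE.
have act_lin : linear rho.
  move=> k a a'; apply/matrixP => i j; rewrite !mxE; apply: coD => x /=.
  by rewrite mulrDr -scalerAr -[_ *: (b i x * a : B^o)]/(k%:A * (_ * _)) mulr_algl.
have act1 : rho 1 = 1%:M.
  apply/matrixP => i j; rewrite !mxE.
  rewrite (coU _ (fun l => (i == l)%:R)) // => x; rewrite klinE (bigD1 i) //= eqxx mulr1.
  rewrite scale1r scale1r big1 ?addr0 // => l li.
  by rewrite eq_sym (negbTE li) scale0r scale0r.
have actM : {morph rho : a a' / a * a' >-> a *m a'}.
  move=> a a'; apply/matrixP => i j; rewrite !mxE.
  under eq_bigr => l _ do rewrite [rho a i l]mxE.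
  rewrite -rho_co; congr (co _ j); apply: lin_ext => x /=; exact: mulrA.
pose D := FgMod act_lin act1 actM.
pose io (c : D) (h : {linear P1 -> B^o}) := \sum_i co h i * (c : 'cV[K]_r) i 0.
have ioD x y h : io (x + y) h = io x h + io y h.
  by rewrite /io -big_split; apply: eq_bigr => i _; rewrite mxE mulrDr.
have ioZ (a : B) x (h ha : {linear P1 -> B^o}) :
    (forall y, ha y = (h y : B) * a) -> io (a *: x) h = io x ha.
  move=> haE; have -> : ha = rmul h a by apply: lin_ext.
  rewrite /io; under [RHS]eq_bigr => j _ do rewrite rho_co mulr_suml.
  rewrite exchange_big; apply: eq_bigr => i _.
  rewrite [(a *: x) : 'cV_r]/(rho a *m (x : 'cV_r)) !mxE mulr_sumr.
  by apply: eq_bigr => j _; rewrite mulrA.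
have io_dual x : dual_functional (io x).
  move=> k h h1 h2 /coD hE; rewrite /io mulr_sumr -big_split; apply: eq_bigr => i _.
  by rewrite hE mulrDl mulrA.
pose S (x : D) := forall (q : {linear P0 -> B^o}) (h : {linear P1 -> B^o}),
  h =1 q \o f -> io x h = 0.
have S_sub : submod S.
  split=> [q h _|a x y Sx Sy q h hq].
    by rewrite /io big1 // => i _; rewrite mxE mulr0.
  rewrite ioD (ioZ a x h (rmul h a)) // (Sx (rmul q a)) ?(Sy q) ?addr0 // => z /=.
  by rewrite hq.
have [N [i [iI iP]]] := submod_sub S_sub.
exists N, P1, P0, f, g, (fun n => io (i n)); split=> //; split.
- move=> x y xy; apply: iI; apply/matrixP => j k; rewrite (ord1 k).
  have ioj (z : D) : io z (b j) = (z : 'cV[K]_r) j 0.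
    rewrite /io (coU (b j) (fun l => (j == l)%:R)) => [|u]; last first.
      rewrite klinE (bigD1 j) //= eqxx scale1r scale1r big1 ?addr0 // => l lj.
      by rewrite eq_sym (negbTE lj) scale0r scale0r.
    rewrite (bigD1 j) //= eqxx mul1r big1 ?addr0 // => l lj.
    by rewrite eq_sym (negbTE lj) mul0r.
  by rewrite -!ioj; exact: (congr1 (fun F => F (b j)) xy).
- by move=> x y h; rewrite linearD ioD.
- by move=> a x h ha haE; rewrite linearZ; apply: ioZ.
- apply/seteqP; split=> [_ [n _ <-]|phi [phiP phi0]] /=.
    by split=> // q h hq; have /iP : exists x, i x = i n by [exists n]; apply.
  pose c : D := \col_j phi (b j).
  have cE h : io c h = phi h.
    rewrite (dual_sum (h := b) (c := co h) phiP (s := index_enum _) (H := h)) //.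
    by apply: eq_bigr => j _; rewrite mxE.
  have /iP[n nE] : S c by move=> q h hq; rewrite cE; exact: phi0 hq.
  by exists n => //; apply: funext => h; rewrite nE cE.
Qed.

End Existence.

(** * Transport along an equivalence of categories *)

Section Cokernel.
Variables (K : fieldType) (A : falgType K) (W : set (fgmod A)).
Hypothesis Ww : is_wide W.

Definition is_cok (X E M : fgmod A) (h : {linear X -> E}) (p : {linear E -> M}) :=
  surjective p /\ forall e, p e = 0 <-> exists x, h x = e.

(** The universal property only mentions objects and maps of W, so an equivalence preserves and
    reflects it. *)
Lemma is_cokP (X E M : fgmod A) (h : {linear X -> E}) (p : {linear E -> M}) :
    W X -> W E -> W M -> is_cok h p <->
  [/\ forall x, p (h x) = 0,
      forall (Z : fgmod A) (g : {linear E -> Z}), W Z -> (forall x, g (h x) = 0) ->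
        exists t : {linear M -> Z}, forall e, g e = t (p e)
    & forall (Z : fgmod A) (t : {linear M -> Z}), W Z -> (forall e, t (p e) = 0) ->
        forall m, t m = 0].
Proof.
move=> WX WE WM; split=> [[pS pP]|[ph pg pt]].
  split=> [x|Z g _ gh|Z t _ tp m]; first by apply/pP; exists x.
    have [|t tP] := factor_surj (f := g) pS; first by move=> e /pP[x <-].
    by exists t => e; rewrite tP.
  by have [e <-] := pS m.
split.
  have [C [q [WC qS qP]]] := wide_cok Ww p WE WM.
  by move=> m; apply/qP; apply: (pt C q WC) => e; apply/qP; exists e.
move=> e; split=> [pe|[x <-]//].
have [C [q [WC qS qP]]] := wide_cok Ww h WX WE.
have [|t tP] := pg C q WC; first by move=> x; apply/qP; exists x.
by apply/qP; rewrite tP pe linear0.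
Qed.

End Cokernel.

Section Transfer.
Variables (K : fieldType) (A B : falgType K) (W : set (fgmod A)).
Hypothesis Ww : is_wide W.
Variable F : equivalence B W.
Implicit Types (M N X Y Z E : fgmod A).
Local Notation hom := (eqv_hom F).
Local Notation obj := (eqv_obj F).

Lemma eqv_eq M N (f g : {linear M -> N}) : f =1 g -> hom f = hom g.
Proof. by move/lin_ext => ->. Qed.

Lemma eqv_compE (L M N : fgmod A) (f : {linear L -> M}) (g : {linear M -> N}) x :
  W L -> W M -> W N -> hom (g \o f) x = hom g (hom f x).
Proof. by move=> WL WM WN; rewrite (@eqv_comp _ _ _ _ F L M N WL WM WN f g (g \o f)). Qed.

Lemma eqv0 M N (f : {linear M -> N}) : W M -> W N -> (forall x, f x = 0) -> forall y, hom f y = 0.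
Proof.
move=> WM WN f0 y; have := eqv_linear (e := F) WM WN (k := 1) (h := f) (f := f) (g := f).
move=> /(_ _ y); rewrite !scale1r => e.
apply: (addrI (hom f y)); rewrite addr0 -e // => x.
by rewrite !f0 scaler0 addr0.
Qed.

Lemma eqv_inj M N (f g : {linear M -> N}) : W M -> W N -> hom f =1 hom g -> f =1 g.
Proof.
move=> WM WN /lin_ext; have [k hk _] := eqv_full_faithful F WM WN.
by move=> /(congr1 k); rewrite !hk => ->.
Qed.

Lemma eqv_inj0 M N (f : {linear M -> N}) : W M -> W N -> (forall y, hom f y = 0) -> forall x, f x = 0.
Proof.
move=> WM WN f0; have z := eqv0 WM WN (f := \0) (fun _ => erefl).
by apply: (eqv_inj (g := \0) WM WN) => y; rewrite f0 z.
Qed.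

Lemma eqv_full M N (th : {linear obj M -> obj N}) : W M -> W N -> exists f : {linear M -> N}, hom f = th.
Proof. by move=> WM WN; have [k _ kh] := eqv_full_faithful F WM WN; exists (k th). Qed.

Lemma eqv_denseP (Y : fgmod B) : exists M (s : {linear obj M -> Y}) (t : {linear Y -> obj M}),
  [/\ W M, forall x, t (s x) = x & forall y, s (t y) = y].
Proof.
have [M WM /isoMP[s sI sS]] := eqv_dense F Y; have [t tK Kt] := inv_lin sI sS.
by exists M, s, t.
Qed.

Lemma eqv_hom_zero M N : W M -> W N -> hom_zero M N <-> hom_zero (obj M) (obj N).
Proof.
move=> WM WN; split=> [MN f x|MN f x].
  by have [g <-] := eqv_full f WM WN; apply: (eqv0 WM WN); exact: MN.
by apply: (eqv_inj0 WM WN) => y; exact: MN.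
Qed.

Lemma eqv_cok X E M (h : {linear X -> E}) (p : {linear E -> M}) : W X -> W E -> W M ->
  is_cok h p <-> is_cok (hom h) (hom p).
Proof.
move=> WX WE WM; rewrite (is_cokP Ww) // (is_cokP (is_wide_setT B)) //.
split=> -[ph pg pt]; split.
- by move=> x; rewrite -eqv_compE //; apply: eqv0.
- move=> Z' g' _ gh; have [Z [s [t [WZ ts st]]]] := eqv_denseP Z'.
  have [g gE] := eqv_full (t \o g') WE WZ.
  have [|u uP] := pg Z g WZ.
    apply: (eqv_inj0 (f := g \o h) WX WZ) => y.
    by rewrite eqv_compE // gE /= gh linear0.
  exists (s \o hom u) => e /=; rewrite -[LHS]st; congr (s _).
  have gEe : hom g e = t (g' e) by rewrite gE.
  by rewrite -gEe (eqv_eq (g := u \o p)) // eqv_compE.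
- move=> Z' t' _ tp; have [Z [s [t [WZ ts st]]]] := eqv_denseP Z'.
  have [u uE] := eqv_full (t \o t') WM WZ => m.
  have uEm : hom u m = t (t' m) by rewrite uE.
  rewrite -[LHS]st -uEm eqv0 ?linear0 //.
  apply: (pt Z u WZ); apply: (eqv_inj0 (f := u \o p) WE WZ) => y.
  by rewrite eqv_compE // uE /= tp linear0.
- by apply: (eqv_inj0 (f := p \o h) WX WM) => y; rewrite eqv_compE.
- move=> Z g WZ gh; have [|t' t'P] := pg (obj Z) (hom g) Logic.I.
    by move=> x; rewrite -eqv_compE //; apply: eqv0.
  have [t tE] := eqv_full t' WM WZ; exists t.
  by apply: (eqv_inj (g := t \o p) WE WZ) => y; rewrite eqv_compE // tE t'P.
- move=> Z t WZ tp; apply: (eqv_inj0 WM WZ); apply: (pt (obj Z) (hom t) Logic.I) => e.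
  by rewrite -eqv_compE //; apply: eqv0.
Qed.

Lemma eqv_csplit M X : W M -> W X -> csplit W M X <-> csplit setT (obj M) (obj X).
Proof.
move=> WM WX; split=> MX.
- move=> E' h' p' _ pS pP; have [E [s [t [WE ts st]]]] := eqv_denseP E'.
  have [h hE] := eqv_full (t \o h') WX WE; have [p pE] := eqv_full (p' \o s) WE WM.
  have [pS' pP'] : is_cok h p.
    apply/(eqv_cok h p WX WE WM); split.
      by move=> m; have [e eE] := pS m; exists (t e); rewrite pE /= st.
    move=> e; rewrite pE /= pP; split=> [[x xE]|[x <-]]; exists x.
      by rewrite hE /= xE ts.
    by rewrite hE /= st.
  have [u uP] := MX E h p WE pS' pP'; exists (s \o hom u) => m.
  have pEm : hom p (hom u m) = p' (s (hom u m)) by rewrite pE.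
  by rewrite /= -pEm -eqv_compE // (eqv_id WM).
- move=> E h p WE pS pP.
  have [pS' pP'] : is_cok (hom h) (hom p) by apply/(eqv_cok h p WX WE WM).
  have [u' u'P] := MX (obj E) (hom h) (hom p) Logic.I pS' pP'.
  have [u uE] := eqv_full u' WM WE; exists u.
  apply: (eqv_inj (f := p \o u) (g := idfun) WM WM) => m.
  by rewrite eqv_compE // uE u'P (eqv_id WM).
Qed.

Lemma AR_iso (M N N' : fgmod B) (s : {linear N' -> N}) : injective s -> surjective s ->
  is_AR_translate M N -> is_AR_translate M N'.
Proof.
move=> sI sS [P1 [P0 [f [g [iota [fg [iI iD iZ ir]]]]]]].
exists P1, P0, f, g, (iota \o s); split=> //; split.
- by move=> x y /iI /sI.
- by move=> x y h; rewrite /= linearD iD.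
- by move=> a x h ha hE; rewrite /= linearZ; apply: iZ.
- rewrite -ir; apply/seteqP; split=> _ [x _ <-]; first by exists (s x).
  by have [y <-] := sS x; exists y.
Qed.

Lemma tau_exists M : W M -> exists N, is_tau W M N.
Proof.
move=> WM; have [N' MN'] := AR_exists (obj M).
have [N [s [t [WN ts st]]]] := eqv_denseP N'.
exists N; split=> //; exists B, F; apply: (AR_iso (s := s)) MN'.
  by move=> x y /(congr1 t); rewrite !ts.
by move=> y; exists (t y).
Qed.

End Transfer.

(** * Elimination of the translate *)

Section TauPerp.
Variables (K : fieldType) (A : falgType K) (W : set (fgmod A)).
Hypothesis Ww : is_wide W.
Implicit Types (M N X : fgmod A).

Lemma tau_csplit M N X : W X -> is_tau W M N -> hom_zero X N <-> csplit W M X.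
Proof.
move=> WX [WM WN [B [F MN]]].
by rewrite (eqv_hom_zero F WX WN) (eqv_csplit Ww F WM WX) (AR_criterion _ MN).
Qed.

(** A [falgType] is a nonzero ring, so the zero subcategory is not equivalent to any of these module
    categories; hence the condition on W. *)
Hypothesis Wequiv : (exists2 X, W X & ~ zeroM X) -> exists B, inhabited (equivalence B W).

Lemma tau_ex M : W M -> ~ zeroM M -> exists N, is_tau W M N.
Proof.
by move=> WM M0; have [|B [F]] := Wequiv; [exists M|exact: (tau_exists F)].
Qed.

Lemma tau_rigidE M : ~ zeroM M -> tau_rigid W M <-> W M /\ csplit W M M.
Proof.
move=> M0; split=> [[N MN MN0]|[WM MM]].
  by have [WM _ _] := MN; split=> //; apply/(tau_csplit WM MN).
by have [N MN] := tau_ex WM M0; exists N => //; apply/(tau_csplit WM MN).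
Qed.

Lemma tau_perpE M : W M -> ~ zeroM M ->
  tau_perp W M = (fun X => (W X /\ csplit W M X) /\ hom_zero M X).
Proof.
move=> WM M0; apply/seteqP; split=> X /=.
  by move=> [WX MX [N MN XN]]; do 2?split=> //; apply/(tau_csplit WX MN).
move=> [[WX MX] HX]; split=> //.
by have [N MN] := tau_ex WM M0; exists N => //; apply/(tau_csplit WX MN).
Qed.

End TauPerp.

(** * Progenerators and module categories *)

Section Endomorphisms.
Variables (K : fieldType) (A : falgType K).

(* The opposite of End(G): it consists of the transposes of the matrices that *)
(* commute with the action of A.                                              *)
Lemma endo_algebra (G : fgmod A) : ~ zeroM G ->
  exists (B : falgType K) (hat : B -> {linear G -> G}),
  [/\ forall k b c x, hat (k *: b + c) x = k%:A *: hat b x + hat c x,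
      forall x, hat 1 x = x, forall b c x, hat (b * c) x = hat c (hat b x),
      forall phi : {linear G -> G}, exists b, forall x, hat b x = phi x
    & forall b, (forall x, hat b x = 0) -> b = 0].
Proof.
case: G => -[|n] rho rho_lin rho1 rhoM G0.
  by case: G0 => x; apply/matrixP => -[].
pose G := FgMod rho_lin rho1 rhoM.
have trho_lin : linear (fun a => (rho a)^T : 'M[K]_n.+1).
  by move=> k a b; rewrite rho_lin linearP.
pose U := limg (linfun (mklin trho_lin)).
have inU a : (rho a)^T \in U by rewrite -[(rho a)^T]/(mklin trho_lin a) -lfunE memv_img ?memvf.
pose B := subvs_of (centraliser_aspace U).
have hatP (b : B) : exists phi : {linear G -> G}, forall x : G, phi x = (vsval b)^T *m (x : 'cV_n.+1).
  apply: mxlin => a; apply: trmx_inj; rewrite !trmx_mul trmxK.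
  by have /centvP/(_ _ (inU a)) := valP b.
have [hat hatE] := choice hatP.
exists B, hat; split.
- move=> k b c x; rewrite !hatE kscaleE -[vsval (k *: b + c)]/(k *: vsval b + vsval c) linearP /=.
  by rewrite mulmxDl -scalemxAl.
- move=> x; rewrite hatE -[vsval 1]/(algid (centraliser_aspace U)).
  have /eqP -> : algid (centraliser_aspace U) == 1 by rewrite algid_eq1; exact: centv1.
  by rewrite trmx1 mul1mx.
- by move=> b c x; rewrite !hatE -[vsval (b * c)]/(vsval b *m vsval c) trmx_mul mulmxA.
- move=> phi.
  have cU : (hmx phi)^T \in 'C(U)%VS.
    apply/centvP => _ /memv_imgP[a _ ->]; rewrite lfunE /=.
    by rewrite -[LHS]trmx_mul -[RHS]trmx_mul; congr trmx; exact: esym (hmx_comm phi a).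
  by exists (Subvs cU) => x; rewrite hatE /= trmxK [RHS]hmxP.
- move=> b b0; apply: val_inj; apply: trmx_inj; rewrite linear0 /=.
  apply: mx_ext => v; rewrite mul0mx; have := b0 v; by rewrite hatE.
Qed.

End Endomorphisms.

Section Coordinates.
Variables (K : fieldType) (A : falgType K).
Implicit Types X Y : fgmod A.

Lemma hom_coord X Y : exists r (ph : 'cV[K]_r -> {linear X -> Y}) (co : {linear X -> Y} -> 'cV[K]_r),
  [/\ forall c, co (ph c) = c, forall f, ph (co f) = f
    & forall k c d x, ph (k *: c + d) x = k%:A *: ph c x + ph d x].
Proof.
have [r [h [hP hI]]] := hom_basis X Y; have [co coP] := choice hP.
pose ph (c : 'cV[K]_r) := klin (fun i => c i 0) h.
have phco f : ph (\col_i co f i) = f.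
  apply: lin_ext => x; rewrite (coP f) !klinE; apply: eq_bigr => i _.
  by rewrite mxE.
have phD k c d x : ph (k *: c + d) x = k%:A *: ph c x + ph d x.
  rewrite !klinE scaler_sumr -big_split; apply: eq_bigr => i _.
  by rewrite !mxE /= scalerA mulr_algl scalerA -!scalerDl.
exists r, ph, (fun f => \col_i co f i); split=> // c.
apply/eqP; rewrite -subr_eq0; apply/eqP/colP => i; rewrite [RHS]mxE.
apply: (hI (fun i => (\col_i co (ph c) i - c) i 0)) => x.
rewrite -[LHS]/(ph (\col_i co (ph c) i - c) x).
by rewrite addrC -scaleN1r phD phco scaleN1r scaleNr scale1r addNr.
Qed.

Lemma lin_colmx r s (L : 'cV[K]_r -> 'cV[K]_s) : (forall k c d, L (k *: c + d) = k *: L c + L d) ->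
  forall c, (\matrix_(j, i) L (delta_mx i 0) j 0) *m c = L c.
Proof.
move=> LP c; have L0 : L 0 = 0.
  by have := LP (-1) 0 0; rewrite scaler0 addr0 scaleN1r addNr.
have LZ k d : L (k *: d) = k *: L d by have := LP k d 0; rewrite !addr0 L0 addr0.
have LD d e : L (d + e) = L d + L e by have := LP 1 d e; rewrite !scale1r.
rewrite [in RHS](colsum c) (big_morph L LD L0) [in LHS](colsum c) mulmx_sumr.
apply: eq_bigr => i _; rewrite LZ -scalemxAr; congr (_ *: _).
by apply/colP => j; rewrite -colE !mxE.
Qed.

End Coordinates.

(** * The functor Hom(G, -) of a progenerator *)

Section Morita.
Variables (K : fieldType) (A B : falgType K) (W : set (fgmod A)).
Hypothesis Ww : is_wide W.
Variable G : fgmod A.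
Hypothesis Gp : progenerator W G.
Variable hat : B -> {linear G -> G}.
Hypotheses (hatD : forall k b c x, hat (k *: b + c) x = k%:A *: hat b x + hat c x)
  (hat1 : forall x, hat 1 x = x) (hatM : forall b c x, hat (b * c) x = hat c (hat b x))
  (hatS : forall phi : {linear G -> G}, exists b, forall x, hat b x = phi x)
  (hatI : forall b, (forall x, hat b x = 0) -> b = 0).
Implicit Types (M N X Y Z D E : fgmod A).

Let WG : W G. Proof. by case: Gp. Qed.

(** Coordinates on Hom(G, X), so that it can carry an [fgmod] structure over B. *)
Record hcoord X := HCoord {
  hdim : nat;
  hph : 'cV[K]_hdim -> {linear G -> X};
  hco : {linear G -> X} -> 'cV[K]_hdim;
  hcoK : forall c, hco (hph c) = c;
  hphK : forall f, hph (hco f) = f;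
  hphD : forall k c d x, hph (k *: c + d) x = k%:A *: hph c x + hph d x }.

Lemma hcoord_exists X : exists h : hcoord X, True.
Proof. by have [r [ph [co [h1 h2 h3]]]] := hom_coord G X; exists (HCoord h1 h2 h3). Qed.

Definition hc X : hcoord X := sval (cid (hcoord_exists X)).
Local Notation ph := (hph (h := hc _)).
Local Notation co := (hco (hc _)).

Lemma hcoP X (f g h : {linear G -> X}) k : (forall x, f x = k%:A *: g x + h x) ->
  co f = k *: co g + co h.
Proof.
move=> fE; rewrite -[RHS]hcoK; congr hco; apply: lin_ext => x.
by rewrite hphD !hphK fE.
Qed.

Definition hact_fun X b (c : 'cV[K]_(hdim (hc X))) := co (ph c \o hat b).
Definition hact X b : 'M[K]_(hdim (hc X)) := \matrix_(j, i) hact_fun b (delta_mx i 0) j 0.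

Lemma hactE X b (c : 'cV[K]_(hdim (hc X))) : hact X b *m c = co (ph c \o hat b).
Proof.
apply: (lin_colmx (L := @hact_fun X b)) => k d e.
by apply: hcoP => x; rewrite /= hphD.
Qed.

Fact hact_linear X : linear (hact X).
Proof.
move=> k b b'; apply: mx_ext => v; rewrite mulmxDl -scalemxAl !hactE.
by apply: hcoP => x; rewrite /= hatD linearD linearZ.
Qed.

Fact hact1 X : hact X 1 = 1%:M.
Proof.
apply: mx_ext => v; rewrite hactE mul1mx -[RHS]hcoK; congr hco.
by apply: lin_ext => x /=; rewrite hat1.
Qed.

Fact hactM X : {morph hact X : a b / a * b >-> a *m b}.
Proof.
move=> a b; apply: mx_ext => v; rewrite -mulmxA !hactE; congr hco.
by apply: lin_ext => x /=; rewrite hatM hphK.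
Qed.

Definition hom_obj X : fgmod B := FgMod (@hact_linear X) (hact1 X) (@hactM X).

Fact hom_map_subproof M N (f : {linear M -> N}) :
  linear (fun c : hom_obj M => co (f \o ph c) : hom_obj N).
Proof.
move=> b c d.
suff : co (f \o ph (hact M b *m c + d)) =
    hact N b *m co (f \o ph c) + co (f \o ph d) by [].
rewrite [hact N b *m _]hactE.
rewrite (hcoP (g := ph (co (f \o ph c)) \o hat b) (h := f \o ph d) (k := 1)) ?scale1r // => x.
rewrite !scale1r /= hphK /= -linearD; congr (f _).
by rewrite -[hact M b *m c]scale1r hphD hactE hphK scale1r scale1r.
Qed.

Definition hom_map M N (f : {linear M -> N}) : {linear hom_obj M -> hom_obj N} :=
  mklin (hom_map_subproof f).

Arguments hom_map : simpl never.

Lemma hom_mapE M N (f : {linear M -> N}) (u : {linear G -> M}) :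
  hom_map f (co u : hom_obj M) = co (f \o u).
Proof. by rewrite /hom_map /= hphK. Qed.

Lemma hom_obj_co X (c : hom_obj X) : exists u : {linear G -> X}, c = co u.
Proof. by exists (ph c); rewrite hcoK. Qed.

Lemma hom_obj_act X b (u : {linear G -> X}) : b *: (co u : hom_obj X) = co (u \o hat b).
Proof.
suff : hact X b *m co u = co (u \o hat b) by [].
by rewrite hactE hphK.
Qed.

Lemma co_inj X (u v : {linear G -> X}) : co u = co v -> u = v.
Proof. by move=> e; rewrite -(hphK (hc X) u) e hphK. Qed.

Lemma hom_map_faithful M N (f g : {linear M -> N}) : W M -> hom_map f = hom_map g -> f = g.
Proof.
move=> WM fg; apply: lin_ext => m; have [_ _ Gg] := Gp; have [n [k kP]] := Gg M WM.
have [y ->] := kP m; rewrite !linear_sum; apply: eq_bigr => i _.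
have /co_inj e : co (f \o k i) = co (g \o k i) by rewrite -!hom_mapE fg.
by have := congr1 (fun h : {linear G -> N} => h (y i)) e.
Qed.

Definition natural M N (th : {linear G -> M} -> {linear G -> N}) :=
  (forall u v w : {linear G -> M}, (forall x, u x = v x + w x) -> forall x, th u x = th v x + th w x) /\
  (forall (u : {linear G -> M}) (phi : {linear G -> G}) x, th (u \o phi) x = th u (phi x)).

Definition representable M := forall N (th : {linear G -> M} -> {linear G -> N}),
  natural th -> exists g : {linear M -> N}, forall u x, th u x = g (u x).

Lemma natural0 M N (th : {linear G -> M} -> {linear G -> N}) (u : {linear G -> M}) :
  natural th -> (forall x, u x = 0) -> forall x, th u x = 0.
Proof.
move=> [tD _] u0 x; apply: (addrI (th u x)); rewrite addr0 -(tD u u u) // => y.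
by rewrite u0 addr0.
Qed.

(** For G, evaluate at the identity; then pass to finite sums and to quotients. The map found on a
    sum [D] over [M] vanishes on the kernel of D -> M, because G generates this kernel. *)
Lemma representable_all M : W M -> representable M.
Proof.
move=> WM; have [_ _ Gg] := Gp.
pose Q D := W D /\ representable D.
have [|D X Y i1 i2 p1 p2 b [WX RX] [WY RY]||D [s [[WD RD] sS]]] := @genby_surj _ _ G M Q (Gg M WM).
- move=> Z Z0; split; first exact: wide_zero.
  move=> N th tn; exists (\0) => u x; apply: (natural0 tn) => y; exact: Z0.
- have [b1 b2 b3 b4 b5] := b; split; first exact: (wide_biprod Ww b).
  move=> N th [tD tn].
  have [|g1 g1P] := RX N (fun u => th (i1 \o u)).
    split=> [u v w uE x|u phi x]; first by apply: tD => y; rewrite /= uE linearD.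
    by rewrite -tn; congr (_ x); congr th; apply: lin_ext.
  have [|g2 g2P] := RY N (fun u => th (i2 \o u)).
    split=> [u v w uE x|u phi x]; first by apply: tD => y; rewrite /= uE linearD.
    by rewrite -tn; congr (_ x); congr th; apply: lin_ext.
  exists ((g1 \o p1) \+ (g2 \o p2)) => u x /=.
  by rewrite -(g1P (p1 \o u)) -(g2P (p2 \o u)); apply: tD => y /=; exact: b5.
- split=> // N th [tD tn]; exists (th idfun) => u x; rewrite -tn.
  by congr (_ x); congr th; apply: lin_ext.
move=> N th [tD tn].
have [|g' g'P] := RD N (fun u => th (s \o u)).
  split=> [u v w uE x|u phi x]; first by apply: tD => y; rewrite /= uE linearD.
  by rewrite -tn; congr (_ x); congr th; apply: lin_ext.
have [|g gP] := factor_surj (f := g') sS.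
  have [L [l [WL lI lP]]] := wide_ker Ww s WD WM.
  move=> d /lP[z <-]; have [n [k kP]] := Gg L WL; have [y ->] := kP z.
  rewrite !linear_sum; apply: big1 => i _; rewrite -(g'P (l \o k i)).
  by apply: (natural0 (conj tD tn)) => x; apply/lP; exists (k i x).
exists g => u x; have [v vP] := progenerator_lift Ww Gp u WD WM sS.
by rewrite -vP gP -(g'P v); congr (_ x); congr th; apply: lin_ext => y; rewrite /= vP.
Qed.

Lemma hom_map_full M N (th : {linear hom_obj M -> hom_obj N}) : W M ->
  exists f : {linear M -> N}, hom_map f = th.
Proof.
move=> WM; pose t (u : {linear G -> M}) : {linear G -> N} := ph (th (co u)).
have [|f fP] := representable_all WM (th := t).
  split=> [u v w uE x|u phi x].
    rewrite /t (hcoP (g := v) (h := w) (k := 1)); last by move=> y; rewrite scale1r scale1r.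
    have := @hphD N (hc N) 1 (th (co v)) (th (co w)) x; rewrite !scale1r => <-.
    congr (ph _ x); exact: (linearD th (co v : hom_obj M) (co w)).
  have [b bE] := hatS phi.
  have -> : u \o phi = u \o hat b :> {linear G -> M} by apply: lin_ext => y; rewrite /= bE.
  rewrite /t -hom_obj_act linearZ /=.
  have [v ->] := hom_obj_co (th (co u)).
  by rewrite hom_obj_act !hphK /= bE.
exists f; apply: lin_ext => c; have [u ->] := hom_obj_co c; rewrite hom_mapE.
by rewrite -[RHS]hcoK; congr hco; apply: lin_ext => x; rewrite /= -fP.
Qed.

Lemma hom_cok X E M (h : {linear X -> E}) (p : {linear E -> M}) : W X -> W E -> W M ->
  is_cok h p -> is_cok (hom_map h) (hom_map p).
Proof.
move=> WX WE WM [pS pP]; split.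
  move=> c; have [u ->] := hom_obj_co c.
  have [v vP] := progenerator_lift Ww Gp u WE WM pS; exists (co v); rewrite hom_mapE.
  by congr hco; apply: lin_ext.
move=> c; have [u ->] := hom_obj_co c; rewrite hom_mapE; split=> [pu|[d]].
  have pu0 x : p (u x) = 0.
    have <- : (\0 : {linear G -> M}) x = 0 by [].
    have -> : (\0 : {linear G -> M}) = p \o u; last by [].
    apply: co_inj; rewrite pu; apply: (addrI (co (\0 : {linear G -> M}))).
    rewrite addr0 -[X in X + _]scale1r -(hcoP (f := \0)) // => y.
    by rewrite /= scaler0 addr0.
  have [I [k [i [WI kS iI ikE]]]] := wide_image Ww h WX WE.
  have [|u1 u1P] := factor_inj (f := u) iI.
    by move=> x; have /pP[y yE] := pu0 x; exists (k y); rewrite ikE.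
  have [v vP] := progenerator_lift Ww Gp u1 WX WI kS; exists (co v); rewrite hom_mapE.
  by congr hco; apply: lin_ext => x; rewrite /= -ikE vP u1P.
have [v ->] := hom_obj_co d; rewrite hom_mapE => /co_inj uE.
rewrite -hom_mapE -uE hom_mapE.
apply: (addrI (co (p \o (h \o v)))); rewrite addr0.
rewrite -[X in X + _]scale1r -(hcoP (f := p \o (h \o v))) // => x.
by rewrite scale1r scale1r /=; have -> : p (h (v x)) = 0; [apply/pP; exists (v x)|rewrite addr0].
Qed.

Lemma cok_iso (X E M X' E' M' : fgmod B) (h : {linear X -> E}) (p : {linear E -> M})
  (h' : {linear X' -> E'}) (p' : {linear E' -> M'}) (s : {linear E -> E'}) :
  injective s -> surjective s -> is_cok h p -> is_cok h' p' ->
  (forall e, (exists x, h x = e) <-> exists x, h' x = s e) -> isoM M M'.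
Proof.
move=> sI sS [pS pP] [p'S p'P] hs.
have [|f fP] := factor_surj (f := p' \o s) pS.
  by move=> e /pP/hs/p'P.
apply/isoMP; exists f.
  apply/lin_inj => m; have [e <-] := pS m; rewrite fP => /p'P/hs/pP //.
by move=> m; have [e <-] := p'S m; have [e' <-] := sS e; exists (p e'); rewrite fP.
Qed.

Definition free_type (P : fgmod B) :=
  exists2 D, W D & exists s : {linear hom_obj D -> P}, injective s /\ surjective s.

Lemma hom_map_comp (L M N : fgmod A) (f : {linear L -> M}) (g : {linear M -> N}) c :
  hom_map (g \o f) c = hom_map g (hom_map f c).
Proof.
by have [u ->] := hom_obj_co c; rewrite !hom_mapE; congr hco; apply: lin_ext.
Qed.

Lemma hom_map_id M (f : {linear M -> M}) : f =1 id -> forall c, hom_map f c = c.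
Proof.
move=> fid c; have [u ->] := hom_obj_co c; rewrite hom_mapE; congr hco.
by apply: lin_ext => x /=; rewrite fid.
Qed.

Lemma hom_map_lin M N (k : K) (h f g : {linear M -> N}) :
  (forall x, h x = k%:A *: f x + g x) ->
  forall y, hom_map h y = k%:A *: hom_map f y + hom_map g y.
Proof.
move=> hE c; have [u ->] := hom_obj_co c; rewrite kscaleE !hom_mapE.
by apply: hcoP => x; rewrite /= hE.
Qed.

Lemma hom_map0 M N (f : {linear M -> N}) : (forall x, f x = 0) -> forall c, hom_map f c = 0.
Proof.
move=> f0 c; have := @hom_map_lin M N 1 f f f _ c; rewrite !scale1r => e.
by apply: (addrI (hom_map f c)); rewrite addr0 -e // => x; rewrite f0 scaler0 addr0.
Qed.

Lemma free_cover (Y : fgmod B) : exists D (s : {linear hom_obj D -> Y}), W D /\ surjective s.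
Proof.
have [R [th [thI thS]]] := regular_fgmod B.
have [_ _ /(_ Y Logic.I) RY] := regular_progenerator thI thS.
have [|P X Z i1 i2 p1 p2 b [D1 WD1 [s1 [s1I s1S]]] [D2 WD2 [s2 [s2I s2S]]]||
      P [s [[D WD [t [tI tS]]] sS]]] :=
  genby_surj (Q := free_type) RY.
- move=> Z Z0; have [Z' Z'0] := zero_exists A; exists Z'; first exact: wide_zero.
  exists (\0); split; last by move=> z; exists 0; rewrite [RHS]Z0.
  apply/lin_inj => c _; rewrite -[c](hom_map_id (f := idfun)) // hom_map0 //.
- have [b1 b2 b3 b4 b5] := b.
  have [D [j1 [j2 [q1 [q2 c]]]]] := biprod D1 D2; have [c1 c2 c3 c4 c5] := c.
  exists D; first exact: (wide_biprod Ww c).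
  have [t1 t1K Kt1] := inv_lin s1I s1S; have [t2 t2K Kt2] := inv_lin s2I s2S.
  have m11 y : hom_map q1 (hom_map j1 y) = y by rewrite -hom_map_comp hom_map_id.
  have m22 y : hom_map q2 (hom_map j2 y) = y by rewrite -hom_map_comp hom_map_id.
  have m12 y : hom_map q1 (hom_map j2 y) = 0 by rewrite -hom_map_comp hom_map0.
  have m21 y : hom_map q2 (hom_map j1 y) = 0 by rewrite -hom_map_comp hom_map0.
  have mE y : y = hom_map j1 (hom_map q1 y) + hom_map j2 (hom_map q2 y).
    rewrite -!hom_map_comp -[hom_map _ y as X in X + _]scale1r -[1]scale1r.
    rewrite -(hom_map_lin (h := idfun)) ?hom_map_id // => x.
    by rewrite scale1r scale1r /= -c5.
  exists ((i1 \o s1 \o hom_map q1) \+ (i2 \o s2 \o hom_map q2)); split.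
    apply/lin_inj => y /= y0; rewrite [y]mE.
    have y1 : hom_map q1 y = 0.
      by apply: s1I; rewrite linear0; have := congr1 p1 y0; rewrite linearD b1 b3 addr0 linear0.
    have y2 : hom_map q2 y = 0.
      by apply: s2I; rewrite linear0; have := congr1 p2 y0; rewrite linearD b2 b4 add0r linear0.
    by rewrite y1 y2 !linear0 addr0.
  move=> z; pose y := hom_map j1 (t1 (p1 z)) + hom_map j2 (t2 (p2 z)); exists y.
  have y1 : hom_map q1 y = t1 (p1 z) by rewrite linearD m11 m12 addr0.
  have y2 : hom_map q2 y = t2 (p2 z) by rewrite linearD m21 m22 add0r.
  by rewrite -[LHS]/(i1 (s1 (hom_map q1 y)) + i2 (s2 (hom_map q2 y))) y1 y2 Kt1 Kt2 -b5.
- exists G => //.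
  have [ht htK Kht] := inv_lin thI thS.
  pose f : {linear R -> hom_obj G} := rscale th (co idfun : hom_obj G).
  have fE r : f r = co (hat (th r)).
    by rewrite /f /= hom_obj_act; congr hco; apply: lin_ext.
  have fI : injective f.
    apply/lin_inj => r r0; apply: thI; rewrite linear0; apply: hatI => x.
    have e : co (hat (th r)) = co (\0 : {linear G -> G}).
      rewrite -fE r0; apply: (addrI (co (\0 : {linear G -> G}))).
      rewrite addr0 -[X in _ = X + _]scale1r -(hcoP (f := \0)) // => y.
      by rewrite /= scaler0 addr0.
    by rewrite (co_inj e).
  have fS : surjective f.
    move=> c; have [u ->] := hom_obj_co c; have [b bE] := hatS u.
    by exists (ht b); rewrite fE; congr hco; apply: lin_ext => x; rewrite Kht bE.
  have [g gK Kg] := inv_lin fI fS; exists g; split.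
    by move=> x y /(congr1 f); rewrite !Kg.
  by move=> y; exists (f y); rewrite gK.
exists D, (s \o t); split=> // y; have [p <-] := sS y; have [c <-] := tS p; by exists c.
Qed.

(** A presentation of [Y] by modules Hom(G, D') and Hom(G, D) comes from a map D' -> D by fullness,
    and Hom(G, -) preserves its cokernel. *)
Lemma hom_dense (Y : fgmod B) : exists2 M, W M & isoM (hom_obj M) Y.
Proof.
have [D [s [WD sS]]] := free_cover Y.
have [L [l [lI lP]]] := ker_exists s.
have [D' [s' [WD' s'S]]] := free_cover L.
have [w wE] := hom_map_full (l \o s') WD'.
have [M [c [WM cS cP]]] := wide_cok Ww w WD' WD.
exists M => //.
apply: (cok_iso (s := idfun) _ _ (hom_cok WD' WD WM (conj cS cP)) (h' := l \o s') (p' := s)).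
- by [].
- by move=> x; exists x.
- split=> // x; rewrite lP; split=> [[y <-]|[y <-]]; last by exists (s' y).
  by have [z <-] := s'S y; exists z.
- by move=> e; rewrite wE.
Qed.

Lemma morita : inhabited (equivalence B W).
Proof.
apply: inhabits; apply: (@Equivalence K A B W hom_obj hom_map).
- by move=> M N _ _ k h f g; exact: hom_map_lin.
- by move=> M _ f; exact: hom_map_id.
- move=> L M N _ _ _ f g h hE c.
  have -> : h = g \o f :> {linear L -> N} by exact: lin_ext.
  by rewrite hom_map_comp.
- move=> M N WM WN; have /choice[k kP] := fun th => @hom_map_full M N th WM.
  by exists k => [f|th]; [apply: hom_map_faithful; rewrite ?kP|exact: kP].
- exact: hom_dense.
Qed.

End Morita.

Lemma progenerator_equivalence (K : fieldType) (A : falgType K) (W : set (fgmod A)) G :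
  is_wide W -> progenerator W G -> (exists2 X, W X & ~ zeroM X) ->
  exists B : falgType K, inhabited (equivalence B W).
Proof.
move=> Ww Gp [X WX X0].
have [|B [hat [h1 h2 h3 h4 h5]]] := @endo_algebra K A G.
  move=> G0; apply: X0 => x; have [_ _ Gg] := Gp; have [n [f fP]] := Gg X WX.
  by have [y ->] := fP x; apply: big1 => i _; rewrite (G0 (y i)) linear0.
by exists B; exact: (morita Ww Gp h1 h2 h3 h4 h5).
Qed.

(** * Labels in finite lattices *)

Section OrderIso.
Variables (d d' : Order.disp_t) (L : latticeType d) (L' : latticeType d') (phi : L -> L').
Hypotheses (phi_bij : bijective phi) (phi_le : forall x y, (phi x <= phi y)%O = (x <= y)%O).
Implicit Types x y u v i j : L.

Let phiI : injective phi. Proof. exact: bij_inj. Qed.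

Let phiS (y' : L') : exists x, phi x = y'. Proof. by case: phi_bij => g _ gK; exists (g y'). Qed.

Let phi_lt x y : (phi x < phi y)%O = (x < y)%O.
Proof. by rewrite !lt_leAnge !phi_le. Qed.

Lemma iso_join x y : phi (Order.join x y) = Order.join (phi x) (phi y).
Proof.
apply: le_anti; have [z zE] := phiS (Order.join (phi x) (phi y)).
rewrite leUx !phi_le leUl leUr andbT -zE phi_le leUx -!phi_le zE.
by rewrite leUl leUr.
Qed.

Lemma iso_covered x y : covered_by (phi x) (phi y) <-> covered_by x y.
Proof.
split=> -[xy h]; split.
- by rewrite -phi_lt.
- by move=> z /andP[xz zy]; apply: (h (phi z)); rewrite !phi_lt xz.
- by rewrite phi_lt.
- by move=> z'; have [z <-] := phiS z'; rewrite !phi_lt; exact: h.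
Qed.

Lemma iso_cji x : cji x -> cji (phi x).
Proof.
move=> [u [/iso_covered uv un]]; exists (phi u); split=> // u'.
by have [w <-] := phiS u' => /iso_covered/un ->.
Qed.

Lemma iso_j_labels x y i : j_labels x y i -> j_labels (phi x) (phi y) (phi i).
Proof.
move=> [u [v [xu uv vy [iu im]]]]; exists (phi u), (phi v); split; rewrite ?phi_le //.
  exact/iso_covered.
split=> [|z'] /=; first by rewrite -iso_join iu.
by have [z <-] := phiS z'; rewrite -iso_join => /phiI/im; rewrite phi_le.
Qed.

Lemma iso_pop_up x : phi (pop_up x) = pop_up (phi x).
Proof.
have setE (S : set L) (S' : set L') : (forall z, S z <-> S' (phi z)) ->
    forall z, supremums S z <-> supremums S' (phi z).
  move=> SS z; split=> -[ub lb]; split.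
  - by move=> y'; have [y <-] := phiS y' => /SS /ub; rewrite phi_le.
  - move=> y'; have [y <-] := phiS y' => yu; rewrite phi_le; apply: lb => w /SS Sw.
    by rewrite -phi_le; exact: yu.
  - by move=> y /SS /ub; rewrite phi_le.
  - move=> y yu; rewrite -phi_le; apply: lb => w'; have [w <-] := phiS w' => /SS Sw.
    by rewrite phi_le; exact: yu.
have SS z : (x |` [set y | covered_by x y]) z <-> (phi x |` [set y | covered_by (phi x) y]) (phi z).
  split=> -[/= h|/= h]; [left|right|left|right] => /=.
  - by rewrite h.
  - exact/iso_covered.
  - exact: phiI.
  - exact/iso_covered.
have sE := setE _ _ SS.
have ne (e : Order.disp_t) (P : porderType e) (z : P) (S : set P) : (z |` S) == set0 = false.
  by apply/eqP => e0; have [] : (set0 : set P) z by rewrite -e0; left.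
rewrite /pop_up /supremum !ne.
(* If no supremum exists, the two sides take the default values [phi x]. *)
case: (pselect (exists z, supremums (x |` [set y | covered_by x y]) z)) => [[z zs]|nz].
  rewrite (xget_subset1 _ zs); last exact: is_subset1_supremums.
  have /sE zs' := zs.
  by rewrite (xget_subset1 _ zs') //; exact: is_subset1_supremums.
rewrite xgetPN; last by move=> z zs; apply: nz; exists z.
by rewrite xgetPN // => z'; have [z <-] := phiS z' => /sE zs; apply: nz; exists z.
Qed.

End OrderIso.

Lemma cji_below d (L : latticeType d) (j m : L) :
  (m < j)%O -> (forall w, (w < j)%O -> (w <= m)%O) -> cji j.
Proof.
move=> mj h; exists m; split; first by split=> // z /andP[mz /h]; rewrite lt_geF.
move=> w [wj wh]; have wm := h w wj; apply/eqP; apply: contraT => ne.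
by case: (wh m); rewrite mj andbT lt_neqAle wm andbT eq_sym.
Qed.

(** * Labels and join-irreducible elements of an interval *)

Section FiniteLattice.
Variables (d : Order.disp_t) (L : latticeType d).
Hypothesis Lf : finite_set [set: L].
Implicit Types x y u v i j : L.

Lemma interval_leE x y (k l : interval x y) : (k <= l)%O = (ival k <= ival l)%O.
Proof. by rewrite -[RHS]/(val k <= val l)%O Order.le_val. Qed.

Lemma interval_ltE x y (k l : interval x y) : (k < l)%O = (ival k < ival l)%O.
Proof. by rewrite !lt_leAnge !interval_leE. Qed.

Lemma ival_ge x y (k : interval x y) : (x <= ival k)%O.
Proof. by case: k => k /= /andP[]. Qed.

Lemma ival_le x y (k : interval x y) : (ival k <= y)%O.
Proof. by case: k => k /= /andP[]. Qed.

Lemma finite_interval x y : finite_set [set: interval x y].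
Proof.
rewrite -(preimage_setT (@ival _ _ x y)); apply: finite_preimage => // k l _ _.
exact: val_inj.
Qed.

Lemma interval_covered x y (k l : interval x y) :
  covered_by k l -> covered_by (ival k) (ival l).
Proof.
move=> [kl h]; split; first by rewrite -interval_ltE.
move=> z /andP[kz zl].
have zP : (x <= z <= y)%O.
  by rewrite (le_trans (ival_ge k) (ltW kz)) (le_trans (ltW zl) (ival_le l)).
by apply: (h (Interval zP)); rewrite !interval_ltE kz.
Qed.

Lemma j_label_le u v i w : covered_by u v -> j_label u v i -> (w <= v)%O -> ~~ (w <= u)%O -> (i <= w)%O.
Proof.
move=> [uv h] [_ im] wv wu; apply: im => /=.
apply/eqP; rewrite eq_le leUx wv (ltW uv) /=; apply: contraT => nle.
case: (h (Order.join w u)); apply/andP; split.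
  rewrite lt_neqAle leUr andbT; apply: contra wu => /eqP ->; exact: leUl.
by rewrite lt_leAnge nle andbT leUx wv ltW.
Qed.

Lemma j_label_bounds u v i : covered_by u v -> j_label u v i -> (i <= v)%O /\ ~~ (i <= u)%O.
Proof.
move=> [uv _] [/= iu _]; split; first by rewrite -iu leUl.
by apply/negP => /join_r e; move: uv; rewrite -iu e ltxx.
Qed.

(** The greatest element strictly below a label [i] of u < v is the meet of [i] and u. *)
Lemma j_labels_cji x y i : j_labels x y i -> cji i.
Proof.
move=> [u [v [xu uv vy iuv]]]; have [iv iu] := j_label_bounds uv iuv.
apply: (@cji_below _ _ i (Order.meet i u)).
  by rewrite lt_leAnge leIl lexI lexx /=.
move=> w wi; rewrite lexI (ltW wi) /=; apply: contraT => wu.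
have := j_label_le uv iuv (le_trans (ltW wi) iv) wu.
by rewrite (lt_geF wi).
Qed.

Section Labels.
Variables x y : L.

Fact join_bounds i : j_labels x y i -> (x <= Order.join i x <= y)%O.
Proof.
move=> [u [v [xu uv vy iuv]]]; have [iv _] := j_label_bounds uv iuv.
rewrite leUr leUx (le_trans iv vy) /=.
by rewrite (le_trans xu) // (le_trans (ltW uv.1) vy).
Qed.

Definition ijoin i (h : j_labels x y i) : interval x y := Interval (join_bounds h).

(** So i v x is join-irreducible in the interval; the formula for the element just below it is what
    recovers the label in [ijoin_inj]. *)
Lemma ijoin_below i (h : j_labels x y i) u v : (x <= u)%O -> covered_by u v ->
  (v <= y)%O -> j_label u v i -> exists2 m : interval x y, (m < ijoin h)%O &
    ival m = Order.meet u (Order.join i x) /\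
    forall w : interval x y, (w < ijoin h)%O -> (w <= m)%O.
Proof.
move=> xu uv vy iuv; have [iv iu] := j_label_bounds uv iuv.
have mP : (x <= Order.meet u (Order.join i x) <= y)%O.
  rewrite lexI xu leUr /=; apply: le_trans (leIr _ _) _.
  by have /andP[] := join_bounds h.
exists (Interval mP).
  rewrite interval_ltE /= lt_leAnge leIr /= lexI negb_and; apply/orP; left.
  by apply: contra iu; apply: le_trans; exact: leUl.
split=> // w; rewrite interval_ltE interval_leE /= => wk; rewrite lexI (ltW wk) andbT.
apply: contraT => wu.
have kv : (Order.join i x <= v)%O by rewrite leUx iv (le_trans xu (ltW uv.1)).
have := j_label_le uv iuv (le_trans (ltW wk) kv) wu => iw.
by move: wk; rewrite lt_leAnge [X in ~~ X]leUx iw ival_ge andbF.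
Qed.

(** Equal joins have the same greatest element below them in the interval. If [k'] were below u, it
    would be below that element and so below u', which a label of u' < v' is not. Hence [k'] is
    below v but not below u, and minimality of the label gives k <= k'. *)
Lemma ijoin_inj i i' (h : j_labels x y i) (h' : j_labels x y i') :
  Order.join i x = Order.join i' x -> i = i'.
Proof.
have key k k' (g : j_labels x y k) (g' : j_labels x y k') :
    Order.join k x = Order.join k' x -> (k <= k')%O.
  move=> e; have [u [v [xu uv vy iuv]]] := g; have [u' [v' [xu' uv' vy' iuv']]] := g'.
  have [m mk [mE mmax]] := ijoin_below g xu uv vy iuv.
  have [m' mk' [mE' mmax']] := ijoin_below g' xu' uv' vy' iuv'.
  have gg : ijoin g = ijoin g' by exact: val_inj.
  have mm : ival m' = ival m.
    by apply: le_anti; rewrite -!interval_leE mmax ?gg // mmax' -?gg.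
  have [_ iu'] := j_label_bounds uv' iuv'.
  have [kv _] := j_label_bounds uv iuv.
  have kv' : (k' <= v)%O.
    by apply: le_trans (leUl k' x) _; rewrite -e leUx kv (le_trans xu (ltW uv.1)).
  apply: (j_label_le uv iuv kv'); apply: contra iu' => ku.
  have : (k' <= ival m)%O by rewrite mE lexI ku e leUl.
  by rewrite -mm mE' lexI => /andP[].
by move=> e; apply: le_anti; rewrite (key _ _ h h') ?(key _ _ h' h).
Qed.

Hypothesis JL : forall u v, covered_by u v -> exists j, j_label u v j.

(** Take the label [i] of the only cover l < k. If i v x were smaller than k it would lie below l,
    but [i] does not. *)
Lemma cji_ijoin (k : interval x y) : cji k -> exists2 i, j_labels x y i & ival k = Order.join i x.
Proof.
move=> [l [lk lu]]; have lk' := interval_covered lk; have [i il] := JL lk'.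
have ik : j_labels x y i.
  by exists (ival l), (ival k); split=> //; [exact: ival_ge|exact: ival_le].
exists i => //; apply/eqP; rewrite eq_sym; apply: contraT => ne.
have [ile inl] := j_label_bounds lk' il.
have lt : (ijoin ik < k)%O.
  by rewrite interval_ltE lt_neqAle ne /= leUx ile ival_ge.
have [l' jl' l'k] := lower_cover (finite_interval x y) lt.
case/negP: inl; rewrite (lu _ l'k).
by apply: le_trans (leUl i x) _; rewrite -[Order.join i x]/(ival (ijoin ik)) -interval_leE.
Qed.

End Labels.
End FiniteLattice.

(** * Exceptional sequences *)

Lemma inj_surj_bij (X Y : Type) (f : X -> Y) : injective f -> surjective f -> bijective f.
Proof.
move=> fI /choice[g gP]; exists g => // x; exact: fI.
Qed.

(** The lattice is itself an index of the predicate; the [match] avoids equalities between dependent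
    pairs. *)
Lemma kappa_exceptional_inv d (L : latticeType d) (s : seq L) : kappa_exceptional s ->
  match s with
  | [::] => True
  | j :: js => exists ks : seq (interval j (pop_up j)),
      [/\ forall i, i \in j :: js -> cji i, forall i, i \in js -> j_labels j (pop_up j) i,
          [seq val k | k <- ks] = [seq Order.join i j | i <- js] & kappa_exceptional ks]
  end.
Proof. by case=> // d' L' j js ks h1 h2 h3 h4; exists ks. Qed.

Lemma kappa_exceptional_iso d (L : latticeType d) (s : seq L) : kappa_exceptional s ->
  forall d' (L' : latticeType d') (phi : L -> L'), bijective phi ->
  (forall x y, (phi x <= phi y)%O = (x <= y)%O) -> kappa_exceptional [seq phi x | x <- s].
Proof.
elim=> {d L s} [d L d' L' phi _ _|d L j js ks jc jl kE _ IH d' L' phi phiB phiL]; first exact: kappa_nil.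
have kP (k : interval j (pop_up j)) : (phi j <= phi (ival k) <= pop_up (phi j))%O.
  by rewrite -iso_pop_up // !phiL ival_ge ival_le.
pose psi k : interval (phi j) (pop_up (phi j)) := Interval (kP k).
apply: (@kappa_cons _ _ (phi j) _ [seq psi k | k <- ks]).
- by move=> i; rewrite -map_cons => /mapP[i' /jc ic ->]; exact: iso_cji.
- by move=> i /mapP[i' /jl il ->]; rewrite -iso_pop_up //; exact: iso_j_labels.
- rewrite -map_comp (eq_map (g := phi \o val)) // map_comp kE -!map_comp.
  by apply: eq_map => i /=; rewrite iso_join.
- apply: IH; last by move=> x y; rewrite interval_leE phiL -interval_leE.
  apply: inj_surj_bij => [x y /(congr1 (@ival _ _ _ _)) /= /(bij_inj phiB)|y].
    exact: val_inj.
  have [g gK Kg] := phiB.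
  have yP : (j <= g (ival y) <= pop_up j)%O.
    by rewrite -!phiL Kg iso_pop_up // ival_ge ival_le.
  by exists (Interval yP); apply: val_inj; rewrite /= Kg.
Qed.

(** * The correspondence of sequences *)

Section Sequences.
Variables (K : fieldType) (A : falgType K).
Implicit Types (M N X : fgmod A) (W V : wide A).

Lemma Gen_correspond_inv W Ms (js : seq (tors W)) : Gen_correspond Ms js ->
  match Ms, js with
  | [::], [::] => True
  | M :: Ms', j :: js' => exists V (ks : seq (tors V)),
      [/\ torsset j = Gen W [set M], wideset V = tau_perp W M,
          [seq torsset k | k <- ks] = [seq torsset (Order.join i j) `&` V | i <- js']
        & Gen_correspond Ms' ks]
  | _, _ => False
  end.
Proof. by case=> // W' V M Ms' j js' ks h1 h2 h3 h4; exists V, ks. Qed.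

Lemma tau_exceptional_inv W M Ms : tau_exceptional W (M :: Ms) ->
  [/\ indecomposable M, tau_rigid W M & tau_exceptional (tau_perp W M) Ms].
Proof. by move=> h; inversion h. Qed.

Lemma wide_eq W V : wideset W = wideset V -> W = V.
Proof.
case: W V => W Ww [V Vw] /= e; move: Vw; rewrite -e => Vw.
by rewrite (Prop_irrelevance Ww Vw).
Qed.

(** The invariant of the induction: it holds for mod A when A is tau-tilting finite, and [good_step]
    passes it on to J_W(M). *)
Definition good W := (exists G, progenerator W G) /\ finite_set [set: tors W].

Lemma good_equiv W : good W -> (exists2 X, wideset W X & ~ zeroM X) ->
  exists B : falgType K, inhabited (equivalence B W).
Proof. by move=> [[G Gp] _]; exact: progenerator_equivalence (wideP W) Gp. Qed.

Lemma good_rigid W M : good W -> indecomposable M -> tau_rigid W M <-> rigid W M.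
Proof. by move=> gW [M0 _]; exact: (tau_rigidE (wideP W) (good_equiv gW) M0). Qed.

Lemma good_perp W M (gW : good W) (Mi : indecomposable M) (Mr : rigid W M) :
  tau_perp W M = jasso W M.
Proof. by case: Mi => M0 _; exact: (tau_perpE (wideP W) (good_equiv gW) Mr.1 M0). Qed.

Lemma good_step W V M (j : tors W) : good W -> indecomposable M -> rigid W M ->
    wideset V = tau_perp W M -> torsset j = Gen W [set M] ->
  good V /\ exists psi : interval j (pop_up j) -> tors V,
    [/\ bijective psi, forall k l, (psi k <= psi l)%O = (k <= l)%O
      & forall k, torsset (psi k) = torsset (ival k) `&` V].
Proof.
move=> gW Mi Mr VE jM; have [[G Gp] Wf] := gW.
rewrite (good_perp gW Mi Mr) in VE.
have jE : j = gen_tors Mr by exact: torsset_inj.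
subst j; have popE := pop_up_Gen Mr VE Wf Mi.
split; first by split; [exact: (progenerator_jasso Mr VE Wf Gp)|exact: (finite_tors_jasso Mr VE Wf)].
have kv (k : interval (gen_tors Mr) (pop_up (gen_tors Mr))) : (ival k <= perp_tors Mr)%O.
  by rewrite -popE ival_le.
have le (k l : interval (gen_tors Mr) (pop_up (gen_tors Mr))) :
    (restrict_tors VE (ival k) <= restrict_tors VE (ival l))%O = (k <= l)%O.
  by rewrite interval_leE; exact: (restrict_tors_le VE (ival_ge k) (kv k) (ival_ge l)).
exists (fun k => restrict_tors VE (ival k)); split=> //.
apply: inj_surj_bij => [k l kl|t].
  by apply: val_inj; exact: (restrict_tors_inj (ival_ge k) (kv k) (ival_ge l) (kv l) kl).
have tP : (gen_tors Mr <= star_tors_of Mr VE t <= pop_up (gen_tors Mr))%O.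
  by rewrite popE star_ge star_le.
by exists (Interval tP); exact: restrict_star.
Qed.

Lemma kappa_cji d (L : latticeType d) (s : seq L) : kappa_exceptional s -> forall i, i \in s -> cji i.
Proof. by case: s => [|j js] // /kappa_exceptional_inv[ks []]. Qed.

Lemma tau_kappa Ms W : good W -> tau_exceptional W Ms ->
  exists js : seq (tors W), kappa_exceptional js /\ Gen_correspond Ms js.
Proof.
elim: Ms W => [|M Ms IH] W gW h.
  by exists [::]; split; [exact: kappa_nil|exact: Gen_correspond_nil].
have [Mi /(good_rigid gW Mi) Mr te] := tau_exceptional_inv h; have [[G Gp] Wf] := gW.
pose V := Wide (jasso_wide Mr).
have VE : wideset V = tau_perp W M by rewrite good_perp.
pose j := gen_tors Mr.
have [gV [psi [psiB psiL psiE]]] := good_step gW Mi Mr VE (erefl : torsset j = _).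
rewrite -VE in te; have [ks0 [kk co]] := IH V gV te.
have [psi' pK Kp] := psiB.
have psi'L x y : (psi' x <= psi' y)%O = (x <= y)%O by rewrite -psiL !Kp.
have psi'B : bijective psi' by exists psi.
(* Each entry of the sequence in tors(V) is join-irreducible, hence of the form i v j for a label
   [i]; [j] is a dummy value outside [ks0]. *)
have /choice[f fP] k : exists i, k \in ks0 ->
    j_labels j (pop_up j) i /\ ival (psi' k) = Order.join i j.
  have [kin|kout] := boolP (k \in ks0); last by exists j.
  have kc := iso_cji psi'B psi'L (kappa_cji kk kin).
  by have [i il iE] := cji_ijoin Wf (@j_label_exists K A W) kc; exists i.
exists (j :: [seq f k | k <- ks0]); split.
  apply: (@kappa_cons _ _ j _ [seq psi' k | k <- ks0]).
  - move=> i; rewrite in_cons => /orP[/eqP ->|/mapP[k kin ->]].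
      exact: (rigid_cji Wf Mi Mr).
    exact: j_labels_cji (fP k kin).1.
  - by move=> i /mapP[k kin ->]; exact: (fP k kin).1.
  - by rewrite -!map_comp; apply/eq_in_map => k kin; exact: (fP k kin).2.
  - exact: kappa_exceptional_iso kk _ _ _ psi'B psi'L.
apply: (@Gen_correspond_cons _ _ W V M Ms j _ ks0) => //.
rewrite -map_comp; apply/eq_in_map => k kin.
by rewrite -[k in LHS]Kp psiE (fP k kin).2.
Qed.

(** The induction is on the length, because the tail of [js] is replaced by a sequence in another
    lattice. *)
Lemma kappa_tau n W (js : seq (tors W)) : size js = n -> good W -> kappa_exceptional js ->
  exists Ms, tau_exceptional W Ms /\ Gen_correspond Ms js.
Proof.
elim: n W js => [|n IH] W [|j js] //= sz gW.
  by exists [::]; split; [exact: tau_nil|exact: Gen_correspond_nil].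
case: sz => sz /kappa_exceptional_inv[ks [jc jl ksE kk]]; have [[G Gp] Wf] := gW.
have [M [Mi Mr jM]] := cji_rigid Wf Gp (jc j (mem_head _ _)).
pose V := Wide (jasso_wide Mr).
have VE : wideset V = tau_perp W M by rewrite good_perp.
have [gV [psi [psiB psiL psiE]]] := good_step gW Mi Mr VE jM.
have kk' := kappa_exceptional_iso kk psiB psiL.
have szE : size [seq psi k | k <- ks] = n.
  by rewrite size_map -(size_map val) ksE size_map.
have [Ms [te co]] := IH V _ szE gV kk'.
exists (M :: Ms); split.
  by apply: tau_cons => //; [exact/(good_rigid gW Mi)|rewrite -VE].
apply: (@Gen_correspond_cons _ _ W V M Ms j js [seq psi k | k <- ks]) => //.
rewrite -map_comp (eq_map (g := (fun i => torsset i `&` V) \o val)) => [|k]; last exact: psiE.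
by rewrite map_comp ksE -map_comp.
Qed.

Lemma csplit_iso W M M' X : isoM M M' -> csplit W M X -> csplit W M' X.
Proof.
move=> /isoMP[f fI fS] MX E h p WE pS pP; have [g gK Kg] := inv_lin fI fS.
have [||s sP] := MX E h (g \o p) WE.
- by move=> m; have [e eE] := pS (f m); exists e; rewrite /= eE gK.
- move=> e; rewrite -pP; split=> [/= gp|/= ->]; last by rewrite linear0.
  by rewrite -[LHS]Kg gp linear0.
by exists (s \o g) => m; rewrite /= -[LHS]Kg -[g (p _)]/((g \o p) _) sP Kg.
Qed.

Lemma hom_zero_iso M M' X : isoM M M' -> hom_zero M X -> hom_zero M' X.
Proof.
move=> /isoMP[f fI fS] MX u m; have [x <-] := fS m; exact: (MX (u \o f)).
Qed.

Lemma Gen_iso_sub W M M' : isoM M M' -> Gen W [set M] `<=` Gen W [set M'].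
Proof.
move=> /isoMP[f fI fS] X /Gen1E[WX [n [k kP]]]; have [g gK Kg] := inv_lin fI fS.
apply/Gen1E; split=> //; exists n, (fun i => k i \o g) => x.
by have [y ->] := kP x; exists (fun i => f (y i)); apply: eq_bigr => i _; rewrite /= gK.
Qed.

Lemma Gen_iso W M M' : isoM M M' -> Gen W [set M] = Gen W [set M'].
Proof. by move=> i; apply/seteqP; split; apply: Gen_iso_sub => //; exact: isoM_sym. Qed.

Lemma jasso_iso W M M' : isoM M M' -> jasso W M = jasso W M'.
Proof.
move=> i; have i' := isoM_sym i.
apply/seteqP; split=> X [[WX MX] M0]; do 2?split=> //;
  by [exact: csplit_iso MX|exact: hom_zero_iso M0].
Qed.

Lemma rigid_isoE W M M' : isoM M M' -> rigid W M -> rigid W M'.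
Proof.
move=> i [WM MM]; have /isoMP[f fI fS] := i.
have WM' : wideset W M' := wide_iso (wideP W) fI fS WM.
have [//] : rigid_perp W M' M'.
apply: (torsion_iso (wideP W) (rigid_perp_torsion (wideP W) WM') fI fS); split=> //.
exact: csplit_iso MM.
Qed.

Lemma indecomposable_iso M M' : isoM M M' -> indecomposable M -> indecomposable M'.
Proof.
move=> i [M0 Mi]; split=> [M'0|X Y /(isoM_trans i)]; last exact: Mi.
apply: M0 => x; have /isoMP[f fI _] := i; by apply: fI; rewrite [LHS]M'0 [RHS]M'0.
Qed.

Lemma isoclassP M M' : isoclass M = isoclass M' <-> isoM M M'.
Proof.
split=> [e|i].
  have : isoclass M' M' by exact: isoM_refl.
  by rewrite -e.
apply/seteqP; split=> N; first exact: isoM_trans (isoM_sym i).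
exact: isoM_trans i.
Qed.

(** The first modules are isomorphic by [rigid_iso]; isomorphic modules have the same perpendicular
    category, so both tails live in the same place. *)
Lemma Gen_correspond_unique Ms W Ms' (js : seq (tors W)) : good W ->
  tau_exceptional W Ms -> tau_exceptional W Ms' ->
  Gen_correspond Ms js -> Gen_correspond Ms' js ->
  [seq isoclass M | M <- Ms] = [seq isoclass M | M <- Ms'].
Proof.
elim: Ms W Ms' js => [|M Ms IH] W [|M' Ms'] [|j js] // gW te te' /Gen_correspond_inv // c /Gen_correspond_inv // c'.
have [V [ks [jM VE ksE co]]] := c; have [V' [ks' [jM' VE' ksE' co']]] := c'.
have [Mi /(good_rigid gW Mi) Mr teM] := tau_exceptional_inv te.
have [Mi' /(good_rigid gW Mi') Mr' teM'] := tau_exceptional_inv te'.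
have [[G Gp] Wf] := gW.
have iso : isoM M M' by apply: (rigid_iso Wf Mi Mr Mi' Mr'); rewrite -jM -jM'.
have VV : V = V'.
  by apply: wide_eq; rewrite VE VE' !good_perp //; exact: jasso_iso.
subst V'; rewrite -VE in teM; rewrite -VE' in teM'.
have kk : ks = ks' by apply: (inj_map (@torsset_inj K A V)); rewrite ksE ksE'.
subst ks'; have [gV _] := good_step gW Mi Mr VE jM.
by rewrite /= (IH V Ms' ks) //; congr (_ :: _); apply/isoclassP.
Qed.

Lemma Gen_correspond_iso Ms W Ms' (js : seq (tors W)) : good W -> tau_exceptional W Ms ->
  [seq isoclass M | M <- Ms] = [seq isoclass M | M <- Ms'] ->
  Gen_correspond Ms js -> Gen_correspond Ms' js.
Proof.
elim: Ms W Ms' js => [|M Ms IH] W [|M' Ms'] // [|j js] gW te isoE /Gen_correspond_inv //; case: isoE.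
move=> /isoclassP iso isoE [V [ks [jM VE ksE co]]].
have [Mi /(good_rigid gW Mi) Mr teM] := tau_exceptional_inv te.
have Mr' := rigid_isoE iso Mr; have Mi' := indecomposable_iso iso Mi.
have [gV _] := good_step gW Mi Mr VE jM.
rewrite -VE in teM; have co' := IH V Ms' ks gV teM isoE co.
apply: (@Gen_correspond_cons _ _ W V M' Ms' j js ks) => //.
  by rewrite jM; exact: Gen_iso.
by rewrite VE !good_perp //; exact: jasso_iso.
Qed.

Lemma map_inj_prop (T : eqType) (U : Type) (f : T -> U) (P : T -> Prop) s s' :
  (forall x, x \in s -> P x) -> (forall x, x \in s' -> P x) ->
  (forall x y, P x -> P y -> f x = f y -> x = y) -> map f s = map f s' -> s = s'.
Proof.
move=> + + fP; elim: s s' => [|x s IH] [|y s'] //= sP s'P [xy ss'].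
congr (_ :: _).
  by apply: fP => //; [apply: sP|apply: s'P]; rewrite mem_head.
by apply: IH => // z zs; [apply: sP|apply: s'P]; rewrite in_cons zs orbT.
Qed.

(** The correspondence only sees the joins i v j; as the entries are labels, [ijoin_inj] recovers
    them. *)
Lemma Gen_correspond_inj Ms W (js js' : seq (tors W)) : good W -> tau_exceptional W Ms ->
  kappa_exceptional js -> kappa_exceptional js' ->
  Gen_correspond Ms js -> Gen_correspond Ms js' -> js = js'.
Proof.
elim: Ms W js js' => [|M Ms IH] W [|j js] [|j' js'] // gW te k k' /Gen_correspond_inv // c /Gen_correspond_inv // c'.
have [V [ks [jM VE ksE co]]] := c; have [V' [ks' [jM' VE' ksE' co']]] := c'.
have [Mi /(good_rigid gW Mi) Mr teM] := tau_exceptional_inv te.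
have jj : j = j' by apply: torsset_inj; rewrite jM jM'.
have VV : V = V' by apply: wide_eq; rewrite VE VE'.
subst j' V'; have [gV [psi [psiB psiL psiE]]] := good_step gW Mi Mr VE jM.
have [is1 [jc jl isE kk]] := kappa_exceptional_inv k; have [is1' [jc' jl' isE' kk']] := kappa_exceptional_inv k'.
have mapE (l : seq (tors W)) (ls : seq (interval j (pop_up j))) (r : seq (tors V)) :
    [seq val k | k <- ls] = [seq Order.join i j | i <- l] ->
    [seq torsset k | k <- r] = [seq torsset (Order.join i j) `&` V | i <- l] ->
    r = [seq psi k | k <- ls].
  move=> lE rE; apply: (inj_map (@torsset_inj K A V)); rewrite rE -map_comp.
  rewrite (eq_map (f := @torsset K A V \o psi) (g := (fun i => torsset i `&` V) \o val));
    last by move=> z; exact: psiE.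
  by rewrite (map_comp (fun i => torsset i `&` V) val) lE -map_comp.
have e := mapE _ _ _ isE ksE; have e' := mapE _ _ _ isE' ksE'.
rewrite -VE in teM.
have kksE : ks = ks'.
  apply: (IH V) => //; [rewrite e|rewrite e'].
    exact: kappa_exceptional_iso kk _ _ _ psiB psiL.
  exact: kappa_exceptional_iso kk' _ _ _ psiB psiL.
have isE1 : is1 = is1' by apply: (inj_map (bij_inj psiB)); rewrite -e -e'.
have [[G Gp] Wf] := gW.
congr (_ :: _); apply: (map_inj_prop (f := fun i => Order.join i j) jl jl').
  by move=> x y xl yl; exact: ijoin_inj xl yl.
by rewrite -isE -isE' isE1.
Qed.

(** The empty sequence is a default; by [tau_ofP] a kappa^d-exceptional sequence never falls into
    that branch. *)
Definition tau_of (js : seq (tors (modcat A))) : seq (set (fgmod A)) :=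
  match pselect (exists Ms, tau_exceptional (modcat A) Ms /\ Gen_correspond Ms js) with
  | left h => [seq isoclass M | M <- sval (cid h)]
  | right _ => [::]
  end.

Lemma good_modcat : tau_tilting_finite A -> good (modcat A).
Proof.
move=> Af; split=> //; have [R [th [thI thS]]] := regular_fgmod A.
by exists R; exact: (regular_progenerator thI thS).
Qed.

Hypothesis Af : tau_tilting_finite A.

Lemma tau_ofP js : kappa_exceptional js -> exists Ms,
  [/\ tau_exceptional (modcat A) Ms, Gen_correspond Ms js & tau_of js = [seq isoclass M | M <- Ms]].
Proof.
move=> kjs; rewrite /tau_of; case: pselect => [h|nh].
  by have [te co] := svalP (cid h); exists (sval (cid h)).
by case: nh; exact: kappa_tau erefl (good_modcat Af) kjs.
Qed.

Lemma tau_ofE js Ms : kappa_exceptional js -> tau_exceptional (modcat A) Ms ->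
  Gen_correspond Ms js -> tau_of js = [seq isoclass M | M <- Ms].
Proof.
move=> kjs te co; have [Ms' [te' co' ->]] := tau_ofP kjs.
exact: (Gen_correspond_unique (good_modcat Af) te' te co' co).
Qed.

Lemma tau_of_corr js Ms : kappa_exceptional js -> tau_of js = [seq isoclass M | M <- Ms] ->
  Gen_correspond Ms js.
Proof.
move=> kjs; have [Ms' [te' co' ->]] := tau_ofP kjs => e.
exact: (Gen_correspond_iso (good_modcat Af) te' e co').
Qed.

Lemma tau_of_bij : set_bij (kappa_exceptional_sequences A) (tau_exceptional_sequences A) tau_of.
Proof.
split.
- by move=> js kjs; have [Ms [te co ->]] := tau_ofP kjs; exists Ms.
- move=> js js' /set_mem kjs /set_mem kjs' e.
  have [Ms [te co jsE]] := tau_ofP kjs.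
  apply: (Gen_correspond_inj (good_modcat Af) te kjs kjs' co).
  by apply: tau_of_corr => //; rewrite -e.
- move=> _ [Ms te <-]; have [js [kjs co]] := tau_kappa (good_modcat Af) te.
  by exists js => //; exact: tau_ofE.
Qed.

End Sequences.

Theorem theorem4 (K : fieldType) (A : falgType K) :
  basic_algebra A -> tau_tilting_finite A ->
  (exists Phi : seq (tors (modcat A)) -> seq (set (fgmod A)),
     set_bij (kappa_exceptional_sequences A) (tau_exceptional_sequences A) Phi /\
     (forall (js : seq (tors (modcat A))) (Ms : seq (fgmod A)),
        kappa_exceptional_sequences A js ->
        Phi js = [seq isoclass M | M <- Ms] ->
        Gen_correspond Ms js)) /\
  (forall (K' : fieldType) (A' : falgType K'),
     basic_algebra A' -> tau_tilting_finite A' ->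
     forall phi : tors (modcat A) -> tors (modcat A'),
       bijective phi ->
       (forall S T, (phi S <= phi T)%O = (S <= T)%O) ->
     exists Psi : seq (set (fgmod A)) -> seq (set (fgmod A')),
       set_bij (tau_exceptional_sequences A) (tau_exceptional_sequences A') Psi /\
       (forall (js : seq (tors (modcat A))) (Ms : seq (fgmod A))
               (Ms' : seq (fgmod A')),
          kappa_exceptional_sequences A js ->
          tau_exceptional (modcat A) Ms ->
          Gen_correspond Ms js ->
          Psi [seq isoclass M | M <- Ms] = [seq isoclass M | M <- Ms'] ->
          Gen_correspond Ms' [seq phi j | j <- js])).
Proof.
move=> _ Af; split.
  by exists (@tau_of K A); split; [exact: tau_of_bij|exact: tau_of_corr].
move=> K' A' _ Af' phi phiB phiL.
have [g gK Kg] := phiB.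
have gB : bijective g by exists phi.
have gL S T : (g S <= g T)%O = (S <= T)%O by rewrite -phiL !Kg.
(* The choice function [ka] inverts [tau_of] on the tau-exceptional sequences; elsewhere its value
   is arbitrary. The bijection [Psi] is [tau_of] after [phi] after [ka]. *)
have ex s : exists js, tau_exceptional_sequences A s ->
    kappa_exceptional js /\ tau_of js = s.
  have [[Ms te <-]|n] := pselect (tau_exceptional_sequences A s); last by exists [::].
  have [_ _ /(_ _ (ex_intro2 _ _ Ms te erefl))[js kjs e]] := tau_of_bij Af.
  by exists js.
have [ka kaP] := choice ex.
exists (fun s => tau_of [seq phi j | j <- ka s]).
have [b1 b2 b3] := tau_of_bij Af; have [c1 c2 c3] := tau_of_bij Af'.
have kphi js : kappa_exceptional js -> kappa_exceptional [seq phi j | j <- js].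
  by move=> kjs; exact: kappa_exceptional_iso kjs _ _ _ phiB phiL.
have phiI := bij_inj phiB.
split; first split.
- by move=> s /kaP[ks _]; apply: c1; exact: kphi.
- move=> s s' /set_mem /kaP[ks sE] /set_mem /kaP[ks' sE'] e.
  have /(inj_map phiI) kE : [seq phi j | j <- ka s] = [seq phi j | j <- ka s'].
    by apply: c2 e; apply/mem_set; exact: kphi.
  by rewrite -sE -sE' kE.
- move=> s' /c3[js' kjs' <-].
  have kjs : kappa_exceptional [seq g j | j <- js'] by exact: kappa_exceptional_iso kjs' _ _ _ gB gL.
  exists (tau_of [seq g j | j <- js']); first exact: b1.
  have [ks e] := kaP _ (b1 _ kjs).
  have -> : ka (tau_of [seq g j | j <- js']) = [seq g j | j <- js'].
    by apply: b2 => //; apply/mem_set.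
  by rewrite -map_comp (eq_map (g := id)) ?map_id.
- move=> js Ms Ms' kjs te co; rewrite -(tau_ofE Af kjs te co) => e.
  apply: (tau_of_corr Af' (kphi _ kjs)); rewrite -e.
  have [ks e'] := kaP _ (b1 _ kjs).
  have -> // : ka (tau_of js) = js by apply: b2 => //; exact/mem_set.
Qed.
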